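(* Let $U\subset\mathbb{R}^2$ be open, let $f\colon U\to\mathbb{R}^3$ be a $C^\infty$ regular surface (immersion) with unit normal vector field $\nu$ and principal curvatures $\kappa_1,\kappa_2$, let $p\in U$ and $i\in\{1,2\}$ with $\kappa_i(p)\neq0$, and set $t=1/\kappa_i(p)$. Suppose that the parallel surface $f^t=f+t\nu$ is a cuspidal lips (resp. a cuspidal beaks) at $p$, and that the limiting normal curvature $\kappa_\nu^t$ of $f^t$ vanishes at $p$. Then the singular curvature $\kappa_s^{C_i}$ of the focal surface $C_i=f+\frac{1}{\kappa_i}\nu$ at its cuspidal edge $p$ is positive (resp. negative).
   Context: For an immersion $f$, $\nu=(f_u\times f_v)/|f_u\times f_v|$, and the principal curvatures $\kappa_1,\kappa_2$ are the eigenvalues of $\begin{pmatrix} E & F \\ F & G \end{pmatrix}^{-1}\begin{pmatrix} L & M \\ M & N \end{pmatrix}$, where $E=\langle f_u,f_u\rangle$, $F=\langle f_u,f_v\rangle$, $G=\langle f_v,f_v\rangle$, $L=-\langle f_u,\nu_u\rangle$, $M=-\langle f_u,\nu_v\rangle$, $N=-\langle f_v,\nu_v\rangle$. Near a non-umbilic point ($\kappa_1\ne\kappa_2$) they are $C^\infty$; the hypotheses force $p$ to be non-umbilic, and everything is considered on a small neighborhood of $p$. A $C^\infty$ map $g\colon U\to\mathbb{R}^3$ is a front if there is a $C^\infty$ map $n\colon U\to S^2$ (a unit normal vector field of $g$) with $\langle dg_q(w),n(q)\rangle=0$ for all $q\in U$, $w\in T_q\mathbb{R}^2$, and such that $(g,n)$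 is an immersion. The parallel surface $f^t$ is a front with unit normal $\nu$. Two map germs $g_j\colon(U_j,p_j)\to\mathbb{R}^3$ are $\mathcal{A}$-equivalent if $\Phi\circ g_1=g_2\circ\varphi$ for diffeomorphism germs $\varphi\colon(U_1,p_1)\to(U_2,p_2)$, $\Phi\colon(\mathbb{R}^3,g_1(p_1))\to(\mathbb{R}^3,g_2(p_2))$. A front is, at $p$, a cuspidal edge / cuspidal lips / cuspidal beaks if its germ at $p$ is $\mathcal{A}$-equivalent to the germ at the origin of $(u,v)\mapsto(u,v^2,v^3)$ / $(u,2v^3+u^2v,3v^4+u^2v^2)$ / $(u,2v^3-u^2v,3v^4-u^2v^2)$, respectively. Limiting normal curvature at a cuspidal lips or beaks: if $g$ is a front with unit normal $n$ and $p$ is such a point (a degenerate rank one singular point), take local coordinates $(x,y)$ with $g_y(p)=0$ and put $\kappa_\nu(p)=\langle g_{xx}(p),n(p)\rangle/|g_x(p)|^2$; this is independent of the choice of such coordinates. Singular curvature: let $g$ be a front with unit normal $n$ and a cuspidal edge at $p$. Let $\lambda=\det(g_u,g_v,n)$, let $\gamma(s)$ be a regular curve with $\gamma(0)=p$ parametrizing the singular set $\lambda^{-1}(0)$ near $p$, let $\eta$ be a nonvanishing vector field near $p$ spanning $\ker dg$ at singular points, and $\hat\gamma=g\circ\gamma$. Then $$\kappa_s(p)=\operatorname{sgn}\bigl(\eta\lambda\cdot\det(\gamma',\eta)\bigr)\,\frac{\det(\hat\gamma',\hat\gamma'',n\circ\gamma)}{|\hat\gamma'|^3}\Big|_{s=0}$$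 (independent of the choices, including the sign of $n$). The focal surface $C_i=f+\frac1{\kappa_i}\nu$ is defined where $\kappa_i\neq0$; away from umbilic points it is a front, with unit normal the unit principal direction of $f$ associated with $\kappa_i$ (as a vector in $\mathbb{R}^3$). If $f^t$, $t=1/\kappa_i(p)$, is a cuspidal lips or cuspidal beaks at $p$, then $C_i$ is a cuspidal edge at $p$, so that $\kappa_s^{C_i}(p)$ is defined. *)

(* Defs.v *)
From HB Require Import structures.
From mathcomp Require Import all_boot all_order all_algebra.
From mathcomp Require Import all_classical all_reals all_analysis.
Set Implicit Arguments. Unset Strict Implicit. Unset Printing Implicit Defensive.
Import Order.TTheory GRing.Theory Num.Theory.
Import numFieldNormedType.Exports.
Local Open Scope classical_set_scope.
Local Open Scope ring_scope.

(* The library norm on 'rV[R]_n is the maximum norm; the Euclidean structure is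
   given by [dot] and [enorm].  Both induce the same topology. *)
Definition dot (R : realType) (n : nat) (x y : 'rV[R]_n) : R :=
  \sum_(j < n) x 0 j * y 0 j.

Definition enorm (R : realType) (n : nat) (x : 'rV[R]_n) : R :=
  Num.sqrt (dot x x).

Definition vec2 (R : realType) (a b : R) : 'rV[R]_2 := \row_j [:: a; b]`_j.
Definition vec3 (R : realType) (a b c : R) : 'rV[R]_3 := \row_j [:: a; b; c]`_j.

Definition det2 (R : realType) (a b : 'rV[R]_2) : R :=
  \det (\matrix_(i < 2) [:: a; b]`_i).
Definition det3 (R : realType) (a b c : 'rV[R]_3) : R :=
  \det (\matrix_(i < 3) [:: a; b; c]`_i).

Definition crossp (R : realType) (x y : 'rV[R]_3) : 'rV[R]_3 :=
  let a (j : nat) := x 0 (inord j) in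
  let b (j : nat) := y 0 (inord j) in
  vec3 (a 1%N * b 2%N - a 2%N * b 1%N)
       (a 2%N * b 0%N - a 0%N * b 2%N)
       (a 0%N * b 1%N - a 1%N * b 0%N).

Definition eu (R : realType) : 'rV[R]_2 := vec2 1 0.
Definition ev (R : realType) : 'rV[R]_2 := vec2 0 1.

(* Only used for finite-dimensional V and W and open A, where it is the usual
   notion of a map of class C^k on A. *)
Fixpoint Cn (R : realType) (V W : normedModType R) (k : nat) (A : set V)
    (f : V -> W) : Prop :=
  match k with
  | 0%N => forall x, A x -> {for x, continuous f}
  | k'.+1 => (forall x, A x -> differentiable f x) /\
             (forall v : V, Cn k' A ('D_v f))
  end.

Definition smooth_on (R : realType) (V W : normedModType R) (A : set V)
    (f : V -> W) : Prop := forall k, Cn k A f.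

Definition smooth_at (R : realType) (V W : normedModType R) (p : V)
    (f : V -> W) : Prop := exists A : set V, [/\ open A, A p & smooth_on A f].

Definition immersion_at (R : realType) (V W : normedModType R) (f : V -> W)
    (q : V) : Prop := injective ('d f q : V -> W).

(* Germs of maps are represented by total functions, of which only the values
   near the base point matter. *)
Definition diffeo_germ (R : realType) (n : nat) (p q : 'rV[R]_n)
    (phi : 'rV[R]_n -> 'rV[R]_n) : Prop :=
  [/\ phi p = q, smooth_at p phi &
      exists psi : 'rV[R]_n -> 'rV[R]_n,
        [/\ smooth_at q psi,
            \forall x \near p, psi (phi x) = x &
            \forall y \near q, phi (psi y) = y]].

Definition A_equivalent (R : realType) (g1 : 'rV[R]_2 -> 'rV[R]_3)
    (p1 : 'rV[R]_2) (g2 : 'rV[R]_2 -> 'rV[R]_3) (p2 : 'rV[R]_2) : Prop :=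
  exists (phi : 'rV[R]_2 -> 'rV[R]_2) (Phi : 'rV[R]_3 -> 'rV[R]_3),
    [/\ diffeo_germ p1 p2 phi, diffeo_germ (g1 p1) (g2 p2) Phi &
        \forall q \near p1, Phi (g1 q) = g2 (phi q)].

Definition std_lips (R : realType) (q : 'rV[R]_2) : 'rV[R]_3 :=
  let u := q 0 0 in let v := q 0 1 in
  vec3 u (2 * v ^+ 3 + u ^+ 2 * v) (3 * v ^+ 4 + u ^+ 2 * v ^+ 2).

Definition std_beaks (R : realType) (q : 'rV[R]_2) : 'rV[R]_3 :=
  let u := q 0 0 in let v := q 0 1 in
  vec3 u (2 * v ^+ 3 - u ^+ 2 * v) (3 * v ^+ 4 - u ^+ 2 * v ^+ 2).

Definition cuspidal_lips (R : realType) (g : 'rV[R]_2 -> 'rV[R]_3)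
    (p : 'rV[R]_2) : Prop := A_equivalent g p (@std_lips R) 0.

Definition cuspidal_beaks (R : realType) (g : 'rV[R]_2 -> 'rV[R]_3)
    (p : 'rV[R]_2) : Prop := A_equivalent g p (@std_beaks R) 0.

Definition unit_normal (R : realType) (f : 'rV[R]_2 -> 'rV[R]_3)
    (q : 'rV[R]_2) : 'rV[R]_3 :=
  let c := crossp ('D_(eu R) f q) ('D_(ev R) f q) in (enorm c)^-1 *: c.

Definition mx2 (R : realType) (a b c d : R) : 'M[R]_2 :=
  \matrix_(i < 2) [:: vec2 a b; vec2 c d]`_i.

Definition first_form (R : realType) (f : 'rV[R]_2 -> 'rV[R]_3)
    (q : 'rV[R]_2) : 'M[R]_2 :=
  let fu := 'D_(eu R) f q in
  let fv := 'D_(ev R) f q in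
  mx2 (dot fu fu) (dot fu fv) (dot fu fv) (dot fv fv).

Definition second_form (R : realType) (f : 'rV[R]_2 -> 'rV[R]_3)
    (q : 'rV[R]_2) : 'M[R]_2 :=
  let fu := 'D_(eu R) f q in
  let fv := 'D_(ev R) f q in
  let nu_u := 'D_(eu R) (unit_normal f) q in
  let nu_v := 'D_(ev R) (unit_normal f) q in
  mx2 (- dot fu nu_u) (- dot fu nu_v) (- dot fu nu_v) (- dot fv nu_v).

Definition weingarten (R : realType) (f : 'rV[R]_2 -> 'rV[R]_3)
    (q : 'rV[R]_2) : 'M[R]_2 := invmx (first_form f q) *m second_form f q.

(* k 0 and k 1 are the two eigenvalues, with multiplicity.  A pointwise
   labelling could jump between them; continuity rules this out, and makes each
   k i smooth near a non-umbilic point. *)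
Definition principal_curvatures (R : realType) (U : set 'rV[R]_2)
    (f : 'rV[R]_2 -> 'rV[R]_3) (k : 'I_2 -> 'rV[R]_2 -> R) : Prop :=
  (forall q, U q ->
     char_poly (weingarten f q) = \prod_(i < 2) ('X - (k i q)%:P)) /\
  (forall i q, U q -> {for q, continuous (k i)}).

Definition parallel_surface (R : realType) (f : 'rV[R]_2 -> 'rV[R]_3) (t : R)
    (q : 'rV[R]_2) : 'rV[R]_3 := f q + t *: unit_normal f q.

(* Meaningful where the principal curvature k does not vanish. *)
Definition focal_surface (R : realType) (f : 'rV[R]_2 -> 'rV[R]_3)
    (k : 'rV[R]_2 -> R) (q : 'rV[R]_2) : 'rV[R]_3 :=
  f q + (k q)^-1 *: unit_normal f q.

Definition front_on (R : realType) (V : set 'rV[R]_2)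
    (g n : 'rV[R]_2 -> 'rV[R]_3) : Prop :=
  [/\ smooth_on V g, smooth_on V n &
      forall q, V q ->
        [/\ dot (n q) (n q) = 1,
            forall w, dot ('d g q w) (n q) = 0 &
            immersion_at (fun x => (g x, n x)) q]].

(* Local coordinates (x, y) are given by the inverse phi of the chart; phi sends
   a to p. *)
Definition is_limiting_normal_curvature (R : realType)
    (g n : 'rV[R]_2 -> 'rV[R]_3) (p : 'rV[R]_2) (c : R) : Prop :=
  exists (a : 'rV[R]_2) (phi : 'rV[R]_2 -> 'rV[R]_2),
    let h := g \o phi in
    [/\ diffeo_germ a p phi, 'D_(ev R) h a = 0 &
        c = dot ('D_(eu R) ('D_(eu R) h) a) (n p) / enorm ('D_(eu R) h a) ^+ 2].

Definition signed_area_density (R : realType) (g n : 'rV[R]_2 -> 'rV[R]_3)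
    (q : 'rV[R]_2) : R := det3 ('D_(eu R) g q) ('D_(ev R) g q) (n q).

Definition singular_curve (R : realType) (g n : 'rV[R]_2 -> 'rV[R]_3)
    (p : 'rV[R]_2) (gam : R^o -> 'rV[R]_2) : Prop :=
  let lam := signed_area_density g n in
  [/\ smooth_at (0 : R^o) gam, gam 0 = p, derive1 gam 0 != 0,
      \forall s \near (0 : R), lam (gam s) = 0 &
      forall e : R, 0 < e ->
        \forall q \near p, lam q = 0 -> exists2 s : R, `|s| < e & gam s = q].

Definition null_field (R : realType) (g n : 'rV[R]_2 -> 'rV[R]_3)
    (p : 'rV[R]_2) (eta : 'rV[R]_2 -> 'rV[R]_2) : Prop :=
  [/\ smooth_at p eta,
      \forall q \near p, eta q != 0 &
      \forall q \near p, signed_area_density g n q = 0 ->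
        forall w, 'd g q w = 0 <-> exists a : R, w = a *: eta q].

(* c is the value at p computed from some admissible choice of the unit normal n,
   the singular curve gam and the null vector field eta.  Such choices exist when
   p is a cuspidal edge of g, and the value is then independent of them. *)
Definition is_singular_curvature (R : realType) (g : 'rV[R]_2 -> 'rV[R]_3)
    (p : 'rV[R]_2) (c : R) : Prop :=
  exists (V : set 'rV[R]_2) (n : 'rV[R]_2 -> 'rV[R]_3)
         (gam : R^o -> 'rV[R]_2) (eta : 'rV[R]_2 -> 'rV[R]_2),
    let lam := signed_area_density g n in
    let hgam : R -> 'rV[R]_3 := g \o gam in
    [/\ open V /\ V p, front_on V g n, singular_curve g n p gam,
        null_field g n p eta &
        c = Num.sg ('D_(eta p) lam p * det2 (derive1 gam 0) (eta p)) *
            (det3 (derive1 hgam 0) (derive1n 2 hgam 0) (n p)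
             / enorm (derive1 hgam 0) ^+ 3)].

(* Main.v *)
(** Near p choose principal directions X, Y of f for kappa = kappa_i and the other
    curvature kappa'. With rho = 1 / kappa, the focal surface C = f + rho nu has
      dC(X) = (X rho) nu,   dC(Y) = (1 - rho kappa') df(Y) + (Y rho) nu,
    so its singular set is X rho = 0 and its null direction is X.
    The parallel surface g = f + t nu has g_u x g_v = (1 - t kappa)(1 - t kappa') f_u x f_v,
    while the normal form (u, 2v^3 + s u^2 v, 3v^4 + s u^2 v^2), s = 1 for lips and
    s = -1 for beaks, has an area density with factor 6 v^2 + s u^2. Comparing the
    2-jets of these two factorizations of g_u x g_v shows that rho is critical at p
    with Hessian a nonzero multiple of the pull-back of 12 v^2 + 2 s u^2, whose
    determinant has the sign of s. Vanishing of the limiting normal curvature means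
    kappa'(p) = 0, and then the velocity and the nu-component of the acceleration of
    the singular curve of C are read off this Hessian: the singular curvature has
    the sign of its determinant. *)
Require Import Defs.
From HB Require Import structures.
From mathcomp Require Import all_boot all_order all_algebra.
From mathcomp Require Import all_classical all_reals all_analysis.
From mathcomp Require Import ring lra.
Set Implicit Arguments.
Unset Strict Implicit.
Unset Printing Implicit Defensive.
Import Order.TTheory GRing.Theory Num.Theory.
Import numFieldNormedType.Exports.
Local Open Scope classical_set_scope.
Local Open Scope ring_scope.

(** * Calculus of smooth maps *)

(** The hypothesis describes the parallel surface [g] only up to diffeomorphisms of source and
    target, which respect neither lengths nor orientations. What survives is the area vector
    [g_u x g_v]: both descriptions make it a scalar function times a nonvanishing vector field, and
    since one scalar vanishes at [p] with its first derivatives, the two Hessians at [p] differ by a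
    nonzero factor [c]. The sign of [c] is out of reach, but the determinant of a binary form
    changes by [c ^+ 2]. In the same way the choices of [n], [gam] and [eta] enter the sign of the
    singular curvature only through squares. The passage from [kappa] to [rho] rests on
    [(1 - t kappa) rho = rho - t], whose 2-jet at [p] gives Hess rho = t Hess (1 - t kappa). Two
    objects have to be constructed. The curvatures are assumed continuous; they are smooth near [p]
    because their difference is a square root of a smooth nonzero discriminant, [p] being
    non-umbilic: at an umbilic point [dg] would vanish, while the normal forms have rank one. And
    the existence of a singular curvature calls for a parametrization of the singular set, hence for
    an implicit function theorem. *)

Section Cn_calculus.
Context {R : realType} {V : normedModType R}.
Implicit Types (A B : set V).

Lemma Cn_continuous {W : normedModType R} k A (f : V -> W) x :
  Cn k A f -> A x -> {for x, continuous f}.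
Proof.
case: k => [|k] /=; first exact.
by move=> [df _] /df; exact: differentiable_continuous.
Qed.

Lemma Cn_pred {W : normedModType R} k A (f : V -> W) : Cn k.+1 A f -> Cn k A f.
Proof.
elim: k f => [|k IH] f; first by move=> fS x; exact: (@Cn_continuous _ 1).
by move=> [df Df]; split=> // v; exact/IH/Df.
Qed.

Lemma Cn_subset {W : normedModType R} k A B (f : V -> W) :
  A `<=` B -> Cn k B f -> Cn k A f.
Proof.
move=> AB; elim: k f => [|k IH] f /=; first by move=> cf x /AB; exact: cf.
by move=> [df Df]; split=> [x /AB/df//|v]; exact/IH/Df.
Qed.

(** The first-order expansion at [x] involves only values near [x], so that of [f] serves for [g];
    [diff_unique] then identifies its linear part with ['d g x]. *)
Lemma near_eq_differentiable {W : normedModType R} (f g : V -> W) x :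
  (\forall y \near x, f y = g y) -> differentiable f x -> differentiable g x.
Proof.
move=> fg df.
have [cL fE] := (diff_locallyP _ _).1 df.
have gE : g \o shift x = cst (g x) + 'd f x +o_ 0 id.
  apply/eqaddoP => e e0; move/eqaddoP/(_ e e0) : fE.
  have : \forall h \near 0, f (h + x) = g (h + x).
    by move: fg; rewrite (near_shift 0) subr0.
  have <- : f x = g x by exact: nbhs_singleton fg.
  by apply: filterS2 => h /= fgh; rewrite !fctE/= fgh.
apply/diff_locallyP; rewrite (diff_unique cL gE); split; first exact: cL.
exact: gE.
Qed.

(** On an open set, equality at all points is equality near each of them, and so passes to
    derivatives of every order. *)
Lemma Cn_ext {W : normedModType R} k A (f g : V -> W) : open A ->
  (forall x, A x -> f x = g x) -> Cn k A f -> Cn k A g.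
Proof.
move=> oA; elim: k f g => [|k IH] f g fg /=.
  move=> cf x Ax; rewrite /prop_for /continuous_at -fg//.
  apply: cvg_trans (cf x Ax); apply: near_eq_cvg.
  by apply: filterS (open_nbhs_nbhs (conj oA Ax)) => y /fg.
have nfg x : A x -> \forall y \near x, f y = g y.
  by move=> Ax; apply: filterS (open_nbhs_nbhs (conj oA Ax)) => y /fg.
move=> [df Df]; split=> [x Ax|v].
  by apply: near_eq_differentiable (df _ Ax); exact: nfg.
apply: IH (Df v) => x Ax; exact/near_eq_derive/nfg.
Qed.

Lemma Cn_cst {W : normedModType R} k A (c : W) : Cn k A (fun=> c).
Proof.
elim: k c => [|k IH] c /=; first by move=> x _; exact: cvg_cst.
split=> [x _|v]; first exact: differentiable_cst.
rewrite (_ : 'D_v _ = fun=> 0)//.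
by apply/funext => x; exact: derive_cst.
Qed.

Lemma CnD {W : normedModType R} k A (f g : V -> W) : open A ->
  Cn k A f -> Cn k A g -> Cn k A (fun x => f x + g x).
Proof.
move=> oA; elim: k f g => [|k IH] f g /=.
  by move=> cf cg x Ax; apply: cvgD; [exact: cf|exact: cg].
move=> [df Df] [dg Dg]; split=> [x Ax|v].
  by apply: differentiableD; [exact: df|exact: dg].
apply: Cn_ext (IH _ _ (Df v) (Dg v)) => // x Ax /=.
by rewrite -deriveD//; apply: diff_derivable; (exact: df || exact: dg).
Qed.

(** A continuous linear map commutes with ['D_v], so induction applies. The instances used are
    matrix entries and the multiplication of a fixed vector by a scalar function. *)
Lemma Cn_lin {W W' : normedModType R} k A (L : {linear W -> W'}) (f : V -> W) :
  continuous L -> open A -> Cn k A f -> Cn k A (fun x => L (f x)).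
Proof.
move=> cL oA; elim: k f => [|k IH] f /=.
  by move=> cf x Ax; apply: continuous_comp; [exact: cf|exact: cL].
move=> [df Df]; split=> [x Ax|v].
  by apply: differentiable_comp; [exact: df|exact: linear_differentiable].
apply: Cn_ext (IH _ (Df v)) => // x Ax /=.
have dL := linear_differentiable (f x) cL.
rewrite (deriveE _ (df _ Ax)) deriveE; last exact: differentiable_comp (df _ Ax) dL.
by rewrite (diff_comp (df _ Ax) dL)/= (diff_lin _ cL).
Qed.

Lemma CnZl {W : normedModType R} k A (f : V -> R) (w : W) : open A ->
  Cn k A f -> Cn k A (fun x => f x *: w).
Proof.
have sl : linear ( *:%R ^~ w : R -> _) by move=> u y z; rewrite scalerDl scalerA.
pose sM := GRing.isLinear.Build _ _ _ _ _ sl.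
pose L : {linear R -> W} := HB.pack ( *:%R ^~ w) sM.
by apply: (@Cn_lin _ _ k A L f); exact: scalel_continuous.
Qed.

Lemma Cn_coord {m n} k A (f : V -> 'M[R]_(m, n)) i j : open A ->
  Cn k A f -> Cn k A (fun x => f x i j).
Proof.
have sl : linear (fun N : 'M[R]_(m, n) => N i j) by move=> u y z; rewrite !mxE.
pose sM := GRing.isLinear.Build _ _ _ _ _ sl.
pose L : {linear 'M[R]_(m, n) -> R} := HB.pack (fun N : 'M[R]_(m, n) => N i j) sM.
by apply: (@Cn_lin _ _ k A L f); exact: coord_continuous.
Qed.

Lemma Cn_sum {W : normedModType R} k A (I : Type) (r : seq I) (f : I -> V -> W) :
  open A -> (forall i, Cn k A (f i)) -> Cn k A (fun x => \sum_(i <- r) f i x).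
Proof.
move=> oA Cf; elim: r => [|i r IH].
  by rewrite (_ : (fun _ => _) = fun=> 0); [exact: Cn_cst|apply/funext=> x; rewrite big_nil].
rewrite (_ : (fun _ => _) = fun x => f i x + \sum_(j <- r) f j x); first exact: CnD.
by apply/funext => x; rewrite big_cons.
Qed.

Lemma Cn_row {n} k A (f : V -> 'rV[R]_n) : open A ->
  (forall j, Cn k A (fun x => f x 0 j)) -> Cn k A f.
Proof.
move=> oA Cf.
rewrite (_ : f = fun x => \sum_j f x 0 j *: delta_mx 0 j); last first.
  by apply/funext => x; exact: row_sum_delta.
by apply: Cn_sum => // j; exact: CnZl.
Qed.

Lemma CnM k A (f g : V -> R) : open A ->
  Cn k A f -> Cn k A g -> Cn k A (fun x => f x * g x).
Proof.
move=> oA; elim: k f g => [|k IH] f g.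
  by move=> cf cg x Ax; apply: cvgM; [exact: cf|exact: cg].
move=> Cf Cg; have [[df Df] [dg Dg]] := (Cf, Cg); split=> [x Ax|v].
  by apply: differentiableM; [exact: df|exact: dg].
apply: (@Cn_ext _ _ _ (fun x => f x * 'D_v g x + g x * 'D_v f x)) => //.
  move=> x Ax /=; apply: esym; rewrite -[LHS]/('D_v (f * g) x).
  have df' : derivable f x v by exact/diff_derivable/df.
  have dg' : derivable g x v by exact/diff_derivable/dg.
  by rewrite deriveM.
by apply: CnD => //; apply: IH => //; first [exact: Cn_pred|exact: Df|exact: Dg].
Qed.

Lemma CnV k A (f : V -> R) : open A -> (forall x, A x -> f x != 0) ->
  Cn k A f -> Cn k A (fun x => (f x)^-1).
Proof.
move=> oA f0; elim: k f f0 => [|k IH] f f0 Cf.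
  by move=> x Ax; apply: cvgV; [exact: f0|exact: Cf].
have [df Df] := Cf; split=> [x Ax|v].
  by apply: differentiableV; [exact: df|exact: f0].
(* The derivative [- f' / f ^+ 2] is spelled with two factors [(f x)^-1], to which the induction
   hypothesis at order [k] applies. *)
apply: (@Cn_ext _ _ _ (fun x => -1 * ((f x)^-1 * ((f x)^-1 * 'D_v f x)))) => //.
  move=> x Ax /=; rewrite deriveV ?f0//; last exact/diff_derivable/df.
  by rewrite mulN1r scaleNr mulrA -invfM -expr2.
apply: CnM => //; first exact: Cn_cst.
have CV : Cn k A (fun x => (f x)^-1) by apply: IH => //; exact: Cn_pred.
by apply: CnM => //; apply: CnM => //; exact: Df.
Qed.

(* [2 f 'D_v f = 'D_v (f ^+ 2)] trades one order of regularity of f for the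
   regularity of its square. *)
Lemma Cn_square_root k A (f : V -> R) : open A -> (forall x, A x -> f x != 0) ->
  (forall x, A x -> {for x, continuous f}) ->
  Cn k A (fun x => f x ^+ 2) -> Cn k A f.
Proof.
move=> oA f0 cf Cf2.
(* Near [x] the continuous function [f] keeps its sign [s], hence equals [s * sqrt (f ^+ 2)], and
   the square root is differentiable away from 0. *)
have df x : (forall y, A y -> differentiable (fun x => f x ^+ 2) y) ->
    A x -> differentiable f x.
  move=> df2 Ax; pose s := Num.sg (f x).
  have sx0 : 0 < s * f x by rewrite -normrEsg normr_gt0 f0.
  apply: (@near_eq_differentiable _ (fun y => s *: Num.sqrt (f y ^+ 2))).
    have : {for x, continuous (fun y => s * f y)} by apply: cvgMr; exact: cf.
    move=> /cvgr_gt/(_ _ sx0); apply: filterS => y sy0.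
    rewrite sqrtr_sqr -[`|f y|]mul1r.
    have s1 : `|s| = 1 by rewrite normr_sg f0.
    rewrite -s1 -normrM gtr0_norm// [_ *: _]mulrA.
    have -> : s * s = 1 by rewrite -expr2 sqr_sg f0.
    by rewrite mul1r.
  apply: differentiableZ.
  apply: (@differentiable_comp _ _ _ _ (fun y => f y ^+ 2) Num.sqrt); first exact: df2.
  apply/derivable1_diffP; apply: ex_derive.
  by apply: is_derive1_sqrt; rewrite exprn_even_gt0//= f0.
elim: k Cf2 => [|k IH] Cf2; first exact: cf.
have [df2 Df2] := Cf2.
have {}df x (Ax : A x) : differentiable f x by exact: df.
have Cf := IH (Cn_pred Cf2).
split=> // v.
apply: (@Cn_ext _ _ _ (fun x => 2^-1 * ((f x)^-1 * 'D_v (fun x => f x ^+ 2) x))) => //.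
  move=> x Ax /=.
  have -> : 'D_v (fun x => f x ^+ 2) x = 2 * (f x * 'D_v f x).
    rewrite (_ : (fun x => f x ^+ 2) = f * f); last by apply/funext.
    rewrite deriveM; [|exact/diff_derivable/df..].
    by rewrite mulr2n mulrDl mul1r.
  by have := f0 x Ax; move: ('D_v f x) => d ?; field.
apply: CnM => //; first exact: Cn_cst.
by apply: CnM => //; [exact: CnV|exact: Df2].
Qed.

Lemma diff_partials {n} {W : normedModType R} (g : 'rV[R]_n -> W) y w :
  differentiable g y -> 'd g y w = \sum_j w 0 j *: 'D_(delta_mx 0 j) g y.
Proof.
move=> dg; rewrite [in LHS](row_sum_delta w) linear_sum.
by apply: eq_bigr => j _; rewrite linearZ deriveE.
Qed.

End Cn_calculus.

Section Cn_composition.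
Context {R : realType} {V W : normedModType R}.

Lemma CnZ k A (f : V -> R) n (g : V -> 'rV[R]_n) : open A ->
  Cn k A f -> Cn k A g -> Cn k A (fun x => f x *: g x).
Proof.
move=> oA Cf Cg; apply: Cn_row => // j.
rewrite (_ : (fun _ => _) = fun x => f x * g x 0 j); last by apply/funext=> x; rewrite mxE.
by apply: CnM => //; exact: Cn_coord.
Qed.
End Cn_composition.

(** [Cn] speaks of derivatives in fixed directions, whereas the chain rule differentiates [g] in the
    moving direction ['D_v f x]. Expanding that direction in the standard basis leaves sums of
    products of maps of class C^k, which is why the intermediate space consists of rows. *)
Lemma Cn_comp {R : realType} {V : normedModType R} n m k A B (f : V -> 'rV[R]_n)
    (g : 'rV[R]_n -> 'rV[R]_m) : open A -> open B ->
  (forall x, A x -> B (f x)) -> Cn k A f -> Cn k B g -> Cn k A (g \o f).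
Proof.
move=> oA oB AB; elim: k f g AB => [|k IH] f g AB Cf Cg.
  move=> x Ax; apply: continuous_comp; first exact: Cf.
  exact/Cg/AB.
have [[df Df] [dg Dg]] := (Cf, Cg); split=> [x Ax|v].
  by apply: differentiable_comp; [exact: df|exact/dg/AB].
apply: (@Cn_ext _ _ _ _ _ (fun x => \sum_j ('D_v f x) 0 j *: ('D_(delta_mx 0 j) g \o f) x)) => //.
  move=> x Ax /=; have dgx := dg _ (AB x Ax); have dfx := df _ Ax.
  rewrite [RHS]deriveE; last exact: differentiable_comp.
  by rewrite diff_comp//= diff_partials// -deriveE.
apply: Cn_sum => // j; apply: CnZ => //; first by apply: Cn_coord => //; exact: Df.
by apply: IH => //; first [exact: Cn_pred|exact: Df|exact: Dg].
Qed.

(** * Germs of smooth maps *)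

Section Smooth_at.
Context {R : realType} {V : normedModType R}.
Implicit Types (p : V).

Lemma near_open p (P : V -> Prop) : (\forall q \near p, P q) ->
  exists B, [/\ open B, B p & forall q, B q -> P q].
Proof.
move=> nP; have : nbhs p [set q | P q] := nP.
by rewrite nbhsE => -[B [oB Bp] BP]; exists B.
Qed.

Lemma smooth_at_near {W : normedModType R} p (f : V -> W) :
  smooth_at p f -> \forall q \near p, smooth_at q f.
Proof.
move=> [A [oA Ap sf]].
by apply: filterS (open_nbhs_nbhs (conj oA Ap)) => q Aq; exists A.
Qed.

Lemma smooth_at_differentiable {W : normedModType R} p (f : V -> W) :
  smooth_at p f -> differentiable f p.
Proof. by move=> [A [_ Ap /(_ 1%N)[df _]]]; exact: df. Qed.

Lemma smooth_at_continuous {W : normedModType R} p (f : V -> W) :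
  smooth_at p f -> {for p, continuous f}.
Proof. by move=> /smooth_at_differentiable/differentiable_continuous. Qed.

Lemma smooth_at_derive {W : normedModType R} p (f : V -> W) v :
  smooth_at p f -> smooth_at p ('D_v f).
Proof.
move=> [A [oA Ap sf]]; exists A; split=> // k.
by have [_] := sf k.+1; exact.
Qed.

Lemma smooth_at_ext {W : normedModType R} p (f g : V -> W) :
  (\forall q \near p, f q = g q) -> smooth_at p f -> smooth_at p g.
Proof.
move=> /near_open[B [oB Bp fg]] [A [oA Ap sf]].
exists (A `&` B); split=> [||k]; [exact: openI|by []|].
apply: (@Cn_ext _ _ _ _ _ f); first exact: openI.
  by move=> x [_ /fg].
by apply: Cn_subset (sf k) => x [].
Qed.

Lemma smooth_at_cst {W : normedModType R} p (c : W) : smooth_at p (fun=> c).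
Proof. by exists setT; split=> [||k]; [exact: openT|by []|exact: Cn_cst]. Qed.

Lemma smooth_at2 {W W' : normedModType R} p (f : V -> W) (g : V -> W') :
  smooth_at p f -> smooth_at p g ->
  exists A, [/\ open A, A p, smooth_on A f & smooth_on A g].
Proof.
move=> [A [oA Ap sf]] [B [oB Bp sg]]; exists (A `&` B); split=> //.
- exact: openI.
- by move=> k; apply: Cn_subset (sf k) => x [].
- by move=> k; apply: Cn_subset (sg k) => x [].
Qed.

Lemma smooth_atD {W : normedModType R} p (f g : V -> W) :
  smooth_at p f -> smooth_at p g -> smooth_at p (fun x => f x + g x).
Proof.
move=> sf sg; have [A [oA Ap {}sf {}sg]] := smooth_at2 sf sg.
by exists A; split=> // k; exact: CnD.
Qed.

Lemma smooth_atM p (f g : V -> R) :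
  smooth_at p f -> smooth_at p g -> smooth_at p (fun x => f x * g x).
Proof.
move=> sf sg; have [A [oA Ap {}sf {}sg]] := smooth_at2 sf sg.
by exists A; split=> // k; exact: CnM.
Qed.

Lemma smooth_atZ n p (f : V -> R) (g : V -> 'rV[R]_n) :
  smooth_at p f -> smooth_at p g -> smooth_at p (fun x => f x *: g x).
Proof.
move=> sf sg; have [A [oA Ap {}sf {}sg]] := smooth_at2 sf sg.
by exists A; split=> // k; exact: CnZ.
Qed.

Lemma smooth_at_coord {n} p (f : V -> 'rV[R]_n) j :
  smooth_at p f -> smooth_at p (fun x => f x 0 j).
Proof. by move=> [A [oA Ap sf]]; exists A; split=> // k; exact: Cn_coord. Qed.

Lemma smooth_atZl {W : normedModType R} p (f : V -> R) (w : W) :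
  smooth_at p f -> smooth_at p (fun x => f x *: w).
Proof. by move=> [A [oA Ap sf]]; exists A; split=> // k; exact: CnZl. Qed.

Lemma smooth_at_sum {W : normedModType R} p (I : Type) (r : seq I) (f : I -> V -> W) :
  (forall i, smooth_at p (f i)) -> smooth_at p (fun x => \sum_(i <- r) f i x).
Proof.
move=> sf; elim: r => [|i r IH].
  rewrite (_ : (fun _ => _) = fun=> 0); first exact: smooth_at_cst.
  by apply/funext => x; rewrite big_nil.
rewrite (_ : (fun _ => _) = fun x => f i x + \sum_(j <- r) f j x).
  exact: smooth_atD.
by apply/funext => x; rewrite big_cons.
Qed.

Lemma smooth_at_row {n} p (f : V -> 'rV[R]_n) :
  (forall j, smooth_at p (fun x => f x 0 j)) -> smooth_at p f.
Proof.
move=> sf; rewrite (_ : f = fun x => \sum_j f x 0 j *: delta_mx 0 j).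
  by apply: smooth_at_sum => j; exact: smooth_atZl.
by apply/funext => x; exact: row_sum_delta.
Qed.

Lemma smooth_atN p (f : V -> R) : smooth_at p f -> smooth_at p (fun x => - f x).
Proof.
move=> sf; rewrite (_ : (fun _ => _) = fun x => -1 * f x).
  by apply: smooth_atM => //; exact: smooth_at_cst.
by apply/funext => x; rewrite mulN1r.
Qed.

Lemma smooth_atB p (f g : V -> R) :
  smooth_at p f -> smooth_at p g -> smooth_at p (fun x => f x - g x).
Proof. by move=> sf sg; apply: smooth_atD => //; exact: smooth_atN. Qed.

Lemma smooth_atX n p (f : V -> R) : smooth_at p f -> smooth_at p (fun x => f x ^+ n).
Proof.
move=> sf; elim: n => [|n IH].
  by rewrite (_ : (fun _ => _) = fun=> 1); [exact: smooth_at_cst|apply/funext].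
rewrite (_ : (fun _ => _) = fun x => f x * f x ^+ n); first exact: smooth_atM.
by apply/funext => x; rewrite exprS.
Qed.

Lemma near_neq0 p (f : V -> R) : {for p, continuous f} -> f p != 0 ->
  \forall q \near p, f q != 0.
Proof. by move=> cf fp0; exact: (cvgr_neq0 _ cf). Qed.

Lemma smooth_atV p (f : V -> R) : f p != 0 ->
  smooth_at p f -> smooth_at p (fun x => (f x)^-1).
Proof.
move=> fp0 sf.
have /near_open[B [oB Bp f0]] := near_neq0 (smooth_at_continuous sf) fp0.
case: sf => A [oA Ap sf].
exists (A `&` B); split=> [||k]; [exact: openI|by []|].
apply: CnV; first exact: openI.
  by move=> x [_ /f0].
by apply: Cn_subset (sf k) => x [].
Qed.

(** Serves for [enorm] of a nonvanishing field and for the difference of the principal curvatures: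
    in both cases only the square is visibly a smooth expression. *)
Lemma smooth_at_square_root p (f : V -> R) : f p != 0 ->
  (\forall q \near p, {for q, continuous f}) ->
  smooth_at p (fun x => f x ^+ 2) -> smooth_at p f.
Proof.
move=> fp0 cf [A [oA Ap sf]].
have /near_open[C [oC Cp f0]] := near_neq0 (nbhs_singleton cf) fp0.
have {cf} /near_open[B [oB Bp cf]] := cf.
exists (A `&` (B `&` C)); split=> [||k]; [by do !apply: openI|by []|].
apply: Cn_square_root; first by do !apply: openI.
- by move=> x [_ [_ /f0]].
- by move=> x [_ [/cf]].
- by apply: Cn_subset (sf k) => x [].
Qed.

Lemma smooth_at_comp {n m} p (f : V -> 'rV[R]_n) (g : 'rV[R]_n -> 'rV[R]_m) :
  smooth_at p f -> smooth_at (f p) g -> smooth_at p (fun x => g (f x)).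
Proof.
move=> sf [B [oB Bfp sg]].
have /near_open[C [oC Cp CB]] : \forall q \near p, B (f q).
  by apply: (smooth_at_continuous sf); exact: (open_nbhs_nbhs (conj oB Bfp)).
case: sf => A [oA Ap sf].
exists (A `&` C); split=> [||k]; [exact: openI|by []|].
apply: (@Cn_comp _ _ _ _ k (A `&` C) B f g) => //; first exact: openI.
  by move=> x [_ /CB].
by apply: Cn_subset (sf k) => x [].
Qed.

Lemma smooth_at_dot n p (f g : V -> 'rV[R]_n) :
  smooth_at p f -> smooth_at p g -> smooth_at p (fun x => dot (f x) (g x)).
Proof.
by move=> sf sg; apply: smooth_at_sum => j; apply: smooth_atM; exact: smooth_at_coord.
Qed.

Lemma smooth_at_vec2 p (f g : V -> R) :
  smooth_at p f -> smooth_at p g -> smooth_at p (fun x => vec2 (f x) (g x)).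
Proof.
move=> sf sg; apply: smooth_at_row => -[[|[|//]] lt].
  by apply: smooth_at_ext sf; near=> y; rewrite mxE.
by apply: smooth_at_ext sg; near=> y; rewrite mxE.
Unshelve. all: by end_near. Qed.

Lemma smooth_at_vec3 p (f g h : V -> R) :
  smooth_at p f -> smooth_at p g -> smooth_at p h ->
  smooth_at p (fun x => vec3 (f x) (g x) (h x)).
Proof.
move=> sf sg sh; apply: smooth_at_row => -[[|[|[|//]]] lt].
- by apply: smooth_at_ext sf; near=> y; rewrite mxE.
- by apply: smooth_at_ext sg; near=> y; rewrite mxE.
- by apply: smooth_at_ext sh; near=> y; rewrite mxE.
Unshelve. all: by end_near. Qed.

Lemma smooth_at_crossp p (f g : V -> 'rV[R]_3) :
  smooth_at p f -> smooth_at p g -> smooth_at p (fun x => crossp (f x) (g x)).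
Proof.
by move=> sf sg; apply: smooth_at_vec3; apply: smooth_atB; apply: smooth_atM;
  exact: smooth_at_coord.
Qed.

End Smooth_at.

Lemma smooth_at_comp_scalar {R : realType} {V : normedModType R} n (p : V) (f : V -> 'rV[R]_n) (g : 'rV[R]_n -> R) :
  smooth_at p f -> smooth_at (f p) g -> smooth_at p (fun x => g (f x)).
Proof.
move=> sf sg.
have sG : smooth_at (f p) (fun y => const_mx (g y) : 'rV[R]_1).
  by apply: smooth_at_row => j; apply: smooth_at_ext sg; near=> y; rewrite mxE.
have := smooth_at_coord 0 (smooth_at_comp sf sG).
by apply: smooth_at_ext; near=> y; rewrite mxE.
Unshelve. all: by end_near. Qed.

Lemma smooth_at_id {R : realType} {V : normedModType R} (p : V) : smooth_at p id.
Proof.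
exists setT; split=> //; first exact: openT.
case=> [|k]; first by move=> x _; exact: cvg_id.
split=> // v; rewrite (_ : 'D_v _ = fun=> v); first exact: Cn_cst.
by apply/funext => x; exact: derive_id.
Qed.

Lemma smooth_at_diff {R : realType} n m p (f : 'rV[R]_n -> 'rV[R]_m)
    (X : 'rV[R]_n -> 'rV[R]_n) :
  smooth_at p f -> smooth_at p X -> smooth_at p (fun q => 'd f q (X q)).
Proof.
move=> sf sX.
apply: (@smooth_at_ext _ _ _ _ (fun q => \sum_j X q 0 j *: 'D_(delta_mx 0 j) f q)).
  apply: filterS (smooth_at_near sf) => q /smooth_at_differentiable dfq.
  by rewrite diff_partials.
apply: smooth_at_sum => j; apply: smooth_atZ; first exact: smooth_at_coord.
exact: smooth_at_derive.
Qed.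

Lemma smooth_at_diff_scalar {R : realType} n p (f : 'rV[R]_n -> R)
    (X : 'rV[R]_n -> 'rV[R]_n) :
  smooth_at p f -> smooth_at p X -> smooth_at p (fun q => 'd f q (X q)).
Proof.
move=> sf sX.
apply: (@smooth_at_ext _ _ _ _ (fun q => \sum_j X q 0 j * 'D_(delta_mx 0 j) f q)).
  apply: filterS (smooth_at_near sf) => q /smooth_at_differentiable dfq.
  by rewrite diff_partials.
apply: smooth_at_sum => j; apply: smooth_atM; first exact: smooth_at_coord.
exact: smooth_at_derive.
Qed.

(** * Coordinates, cross products and determinants *)

Section Vector_algebra.
Context {R : realType}.
Local Notation co x j := (x 0 (inord j%N)).

Lemma inord0_3 : inord 0 = ord0 :> 'I_3. Proof. by apply/val_inj; rewrite /= inordK. Qed.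
Lemma inord1_3 : inord 1 = lift ord0 ord0 :> 'I_3.
Proof. by apply/val_inj; rewrite /= inordK. Qed.
Lemma inord2_3 : inord 2 = lift ord0 (lift ord0 ord0) :> 'I_3.
Proof. by apply/val_inj; rewrite /= inordK. Qed.

Lemma dot3E (x y : 'rV[R]_3) :
  dot x y = co x 0 * co y 0 + co x 1 * co y 1 + co x 2 * co y 2.
Proof.
by rewrite /dot !big_ord_recl big_ord0 addr0 addrA inord0_3 inord1_3 inord2_3.
Qed.

Lemma vec3E (a b c : R) :
  (co (vec3 a b c) 0 = a) * (co (vec3 a b c) 1 = b) * (co (vec3 a b c) 2 = c).
Proof. by rewrite /vec3 !mxE !inordK. Qed.

Lemma vec2E (a b : R) : (vec2 a b 0 0 = a) * (vec2 a b 0 1 = b).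
Proof. by rewrite /vec2 !mxE. Qed.

Lemma row3P (x y : 'rV[R]_3) :
  co x 0 = co y 0 -> co x 1 = co y 1 -> co x 2 = co y 2 -> x = y.
Proof.
move=> e0 e1 e2; apply/rowP => -[[|[|[|//]]] lt].
- by rewrite (_ : Ordinal lt = inord 0)//; apply/val_inj; rewrite /= inordK.
- by rewrite (_ : Ordinal lt = inord 1)//; apply/val_inj; rewrite /= inordK.
- by rewrite (_ : Ordinal lt = inord 2)//; apply/val_inj; rewrite /= inordK.
Qed.

Lemma row2P (x y : 'rV[R]_2) : x 0 0 = y 0 0 -> x 0 1 = y 0 1 -> x = y.
Proof.
move=> e0 e1; apply/rowP => -[[|[|//]] lt].
- by rewrite (_ : Ordinal lt = 0)//; apply/val_inj.
- by rewrite (_ : Ordinal lt = 1)//; apply/val_inj.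
Qed.

Lemma det2E (a b : 'rV[R]_2) : det2 a b = a 0 0 * b 0 1 - a 0 1 * b 0 0.
Proof.
rewrite /det2 (expand_det_row _ ord0) !big_ord_recl big_ord0 addr0 /cofactor !det_mx11 !mxE /=.
rewrite expr0 mul1r expr1 mulN1r mulrN.
have e1 : lift ord0 ord0 = 1 :> 'I_2 by apply/val_inj.
have e0 : lift (1 : 'I_2) ord0 = 0 :> 'I_2 by apply/val_inj.
by rewrite e1 e0.
Qed.

Lemma crosspE (x y : 'rV[R]_3) :
  (co (crossp x y) 0 = co x 1 * co y 2 - co x 2 * co y 1) *
  (co (crossp x y) 1 = co x 2 * co y 0 - co x 0 * co y 2) *
  (co (crossp x y) 2 = co x 0 * co y 1 - co x 1 * co y 0).
Proof. by rewrite /crossp !vec3E. Qed.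

Lemma det3_dot (a b c : 'rV[R]_3) : det3 a b c = dot (crossp a b) c.
Proof.
rewrite dot3E !crosspE /det3 (expand_det_row _ ord0) !big_ord_recl big_ord0 addr0.
rewrite /cofactor !(expand_det_row _ ord0) !big_ord_recl !big_ord0 !addr0.
rewrite /cofactor !det_mx11 !mxE /=.
(* Reading the entries as a function of a natural number lets the nested [lift] indices of the
   cofactor expansion reduce by computation before [ring]. *)
have coE (x : 'rV[R]_3) : exists fx : nat -> R, forall i, x 0 i = fx (nat_of_ord i).
  by exists (fun j => x 0 (inord j)) => i; rewrite inord_val.
have [[fa ea] [fb eb] [fc ec]] := And3 (coE a) (coE b) (coE c).
rewrite !ea !eb !ec !inordK//= /bump /=.
by ring.
Qed.

End Vector_algebra.

(** * Rules for the differential applied to a vector *)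

Section Differential_rules.
Context {R : realType} {V : normedModType R}.
Implicit Types (q w : V).

Lemma diff_ext {W : normedModType R} (f g : V -> W) q w :
  differentiable f q -> (\forall x \near q, f x = g x) -> 'd f q w = 'd g q w.
Proof.
move=> df fg; have dg := near_eq_differentiable fg df.
by rewrite -!deriveE//; exact: near_eq_derive.
Qed.

Lemma diff_constE {W : normedModType R} (c : W) q w : 'd (fun=> c) q w = 0.
Proof. by rewrite -[LHS]/('d (cst c) q w) diff_cst. Qed.

Lemma diff_addE {W : normedModType R} (f g : V -> W) q w :
  differentiable f q -> differentiable g q ->
  'd (fun x => f x + g x) q w = 'd f q w + 'd g q w.
Proof. by move=> df dg; rewrite [LHS](congr1 (@^~ w) (diffD df dg)). Qed.

Lemma diff_compE {W W' : normedModType R} (f : V -> W) (g : W -> W') q w :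
  differentiable f q -> differentiable g (f q) ->
  'd (fun x => g (f x)) q w = 'd g (f q) ('d f q w).
Proof. by move=> df dg; rewrite [LHS](congr1 (@^~ w) (diff_comp df dg)). Qed.

Lemma diff_mulE (f g : V -> R) q w :
  differentiable f q -> differentiable g q ->
  'd (fun x => f x * g x) q w = f q * 'd g q w + g q * 'd f q w.
Proof. by move=> df dg; rewrite [LHS](congr1 (@^~ w) (diffM df dg)). Qed.

Lemma diff_sumE {W : normedModType R} n (F : 'I_n -> V -> W) q w :
  (forall j, differentiable (F j) q) ->
  'd (fun x => \sum_j F j x) q w = \sum_j 'd (F j) q w.
Proof.
move=> dF; have dS : differentiable (\sum_j F j) q by exact: differentiable_sum.
have -> : (fun x => \sum_j F j x) = \sum_j F j by apply/funext => x; rewrite fct_sumE.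
rewrite -deriveE// derive_sum; last by move=> j; exact/diff_derivable/dF.
by apply: eq_bigr => j _; rewrite deriveE.
Qed.

Lemma differentiable_entry n (f : V -> 'rV[R]_n) q j :
  differentiable f q -> differentiable (fun x => f x 0 j) q.
Proof.
by move=> df; exact: (@differentiable_comp _ _ _ _ f (fun N : 'rV[R]_n => N 0 j) q df
  (differentiable_coord _ _ _)).
Qed.

Lemma diff_coordE n (f : V -> 'rV[R]_n) q w j :
  differentiable f q -> 'd (fun x => f x 0 j) q w = 'd f q w 0 j.
Proof.
move=> df; rewrite -!deriveE//; last exact: differentiable_entry.
by rewrite derive_mx ?mxE//; exact: diff_derivable.
Qed.

Lemma differentiable_row n (f : V -> 'rV[R]_n) q :
  (forall j, differentiable (fun x => f x 0 j) q) -> differentiable f q.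
Proof.
move=> df; have -> : f = \sum_j (fun x => f x 0 j *: delta_mx 0 j).
  by apply/funext => x; rewrite fct_sumE [LHS]row_sum_delta.
by apply: differentiable_sum => j; exact: differentiableZl.
Qed.

Lemma differentiable_scale n (f : V -> R) (g : V -> 'rV[R]_n) q :
  differentiable f q -> differentiable g q -> differentiable (fun x => f x *: g x) q.
Proof.
move=> df dg; apply: differentiable_row => j.
rewrite (_ : (fun _ => _) = fun x => f x * g x 0 j); last by apply/funext=> x; rewrite mxE.
by apply: differentiableM => //; exact: differentiable_entry.
Qed.

Lemma diff_scaleE n (f : V -> R) (g : V -> 'rV[R]_n) q w :
  differentiable f q -> differentiable g q ->
  'd (fun x => f x *: g x) q w = f q *: 'd g q w + 'd f q w *: g q.
Proof.
move=> df dg; have dfg := differentiable_scale df dg.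
apply/rowP => j; rewrite -diff_coordE//.
rewrite (_ : (fun x => (f x *: g x) 0 j) = fun x => f x * g x 0 j); last first.
  by apply/funext=> x; rewrite mxE.
by rewrite diff_mulE ?diff_coordE ?mxE 1?[g q 0 j * _]mulrC//; exact: differentiable_entry.
Qed.

Lemma diff_dotE n (f g : V -> 'rV[R]_n) q w :
  differentiable f q -> differentiable g q ->
  'd (fun x => dot (f x) (g x)) q w = dot (f q) ('d g q w) + dot ('d f q w) (g q).
Proof.
move=> df dg; rewrite /dot (@diff_sumE _ _ (fun j x => f x 0 j * g x 0 j)).
  rewrite -big_split/=; apply: eq_bigr => j _.
  rewrite diff_mulE ?diff_coordE//; try exact: differentiable_entry.
  by rewrite [g q 0 j * _]mulrC.
by move=> j; apply: differentiableM; exact: differentiable_entry.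
Qed.

End Differential_rules.

(** * Symmetry of second derivatives *)

Section Segments.
Context {R : realType} {V : normedModType R}.
Implicit Types (p q : V).

Lemma near_and {T : topologicalType} (x : T) (P Q : T -> Prop) :
  (\forall y \near x, P y) -> (\forall y \near x, Q y) ->
  \forall y \near x, P y /\ Q y.
Proof. by move=> nP nQ; exact: filterI. Qed.

Lemma near_box p (P : V -> Prop) (u v : V) : (\forall x \near p, P x) ->
  exists2 d : R, 0 < d & forall a b, `|a| <= d -> `|b| <= d -> P (p + a *: u + b *: v).
Proof.
move=> /nbhs_ballP[/= e e0 eP].
have n0 : 0 < `|u| + `|v| + 1 by rewrite ltr_wpDl ?addr_ge0.
(* The [+ 1] keeps the denominator positive when [u = v = 0]; the final [/ 2] fits the closed box
   into the open ball. *)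
exists (e / (`|u| + `|v| + 1) / 2); first by rewrite !divr_gt0.
move=> a b; set d := e / _ / _ => ad bd; apply: eP.
have d0 : 0 < d by rewrite !divr_gt0.
rewrite -ball_normE /ball_/= -addrA opprD addrA subrr add0r normrN.
apply: le_lt_trans (ler_normD _ _) _; rewrite !normrZ.
apply: (@le_lt_trans _ _ (d * (`|u| + `|v| + 1))).
  rewrite mulrDr mulr1 -[leLHS]addr0 lerD ?(ltW d0)//.
  by rewrite mulrDr; apply: lerD; apply: ler_wpM2r.
rewrite /d mulrAC divfK ?gt_eqF// ltr_pdivrMr//; lra.
Qed.

Lemma line_MVT (F : V -> R) q u s : 0 < s ->
  (forall x, 0 <= x <= s -> differentiable F (q + x *: u)) ->
  exists2 x, 0 < x < s & F (q + s *: u) - F q = s * 'd F (q + x *: u) u.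
Proof.
move=> s0 dF; pose c (x : R) := q + x *: u.
have dl x : differentiable (fun x : R => x *: u) x by exact: (@differentiableZl _ _ _ id).
have dc x : differentiable c x.
  by apply: differentiableD => //; exact: differentiable_cst.
have dcE x : 'd c x 1 = u.
  rewrite (diff_addE _ (differentiable_cst _ _) (dl x)).
  rewrite [X in X + _](diff_constE q) add0r [LHS](congr1 (@^~ 1) (@diffZl _ _ _ id u x _))//.
  by rewrite -deriveE// derive_id scale1r.
have dFc x : 0 <= x <= s -> is_derive x 1 (F \o c) ('d F (c x) u).
  move=> xs; have dFx := dF x xs.
  have dcomp : differentiable (F \o c) x by exact: differentiable_comp.
  apply: DeriveDef; first exact: diff_derivable.
  by rewrite deriveE// (diff_compE _ (dc x) dFx) dcE.
have [||x xs E] := @MVT R (F \o c) (fun x => 'd F (c x) u) 0 s s0.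
- by move=> x /[!in_itv]/= /andP[/ltW x0 /ltW xs]; apply: dFc; rewrite x0 xs.
- apply: derivable_within_continuous => x /[!in_itv]/= xs.
  by have [] := dFc x xs.
exists x; first by move: xs; rewrite in_itv.
by move: E; rewrite /c /= scale0r addr0 subr0 mulrC.
Qed.

End Segments.

(* [dirdiff] and [hess] are sealed: unification would otherwise unfold the
   definition of the differential when comparing two of them. *)
HB.lock Definition dirdiff {R : realType} {V W : normedModType R} (f : V -> W)
  (q w : V) : W := 'd f q w.

HB.lock Definition hess {R : realType} {V : normedModType R} (F : V -> R)
  (p w v : V) : R := 'd (fun q => 'd F q v) p w.

Lemma dirdiffE {R : realType} {V W : normedModType R} (f : V -> W) q w :
  dirdiff f q w = 'd f q w.
Proof. by rewrite unlock. Qed.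

Lemma hessE {R : realType} {V : normedModType R} (F : V -> R) p w v :
  hess F p w v = 'd (fun q => 'd F q v) p w.
Proof. by rewrite unlock. Qed.

Section Hessian.
Context {R : realType}.

Lemma smooth_at_diff_cst {V : normedModType R} {W : normedModType R} p (F : V -> W) v :
  smooth_at p F -> smooth_at p (fun q => 'd F q v).
Proof.
move=> sF; apply: smooth_at_ext (smooth_at_derive v sF).
apply: filterS (smooth_at_near sF) => q /smooth_at_differentiable dF.
by rewrite deriveE.
Qed.

Section symmetry.
Context {V : normedModType R}.

(** The mean value theorem is used twice: along [u] for [G q = F (q + s v) - F q], then along [v]
    for the function ['d F q u]. *)
Lemma second_difference (F : V -> R) p u v s : 0 < s ->
  (forall a b, 0 <= a <= s -> 0 <= b <= s ->
    smooth_at (p + a *: u + b *: v) F) ->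
  exists a b, [/\ 0 < a < s, 0 < b < s &
    F (p + s *: u + s *: v) - F (p + s *: u) - (F (p + s *: v) - F p)
      = s * s * hess F (p + a *: u + b *: v) v u].
Proof.
move=> s0 sF; have ss : 0 <= s <= s by rewrite ltW//=.
have s00 : 0 <= (0 : R) <= s by rewrite lexx ltW.
pose G q := F (q + s *: v) - F q.
have dsh q : differentiable (fun x : V => x + s *: v) q.
  by apply: differentiableD => //; exact: differentiable_cst.
have Esh q w : 'd (fun x : V => x + s *: v) q w = w.
  rewrite (diff_addE w (f := id) (g := fun=> s *: v))//.
  by rewrite [X in _ + X]diff_constE addr0 -[LHS]/('d id q w) -deriveE// derive_id.
have [|a as_ E] := @line_MVT _ _ G p u s s0.
  move=> x xs; apply: differentiableB.
    apply: (@differentiable_comp _ _ _ _ (fun x => x + s *: v)) => //.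
    exact/smooth_at_differentiable/sF.
  by have := smooth_at_differentiable (sF x 0 xs s00); rewrite scale0r addr0.
have as' : 0 <= a <= s by case/andP: as_ => /ltW -> /ltW ->.
have dFa b : 0 <= b <= s -> differentiable F (p + a *: u + b *: v).
  by move=> bs; exact/smooth_at_differentiable/sF.
have dF0 : differentiable F (p + a *: u).
  by have := dFa 0 s00; rewrite scale0r addr0.
have EG : 'd G (p + a *: u) u =
    'd F (p + a *: u + s *: v) u - 'd F (p + a *: u) u.
  rewrite -[G]/((fun q => F (q + s *: v)) - F).
  have dFs : differentiable (fun q => F (q + s *: v)) (p + a *: u).
    apply: (@differentiable_comp _ _ _ _ (fun x => x + s *: v)) => //; exact: dFa.
  rewrite [LHS](congr1 (@^~ u) (diffB dFs dF0)) /=; congr (_ - _).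
  by rewrite diff_compE ?Esh//; exact: dFa.
have [|b bs E'] := @line_MVT _ _ (fun q => 'd F q u) (p + a *: u) v s s0.
  by move=> x xs; apply/smooth_at_differentiable/smooth_at_diff_cst/sF.
exists a, b; split=> //; move: E; rewrite EG E' /G => E.
by rewrite hessE -mulrA -E addrAC.
Qed.

(** Schwarz's theorem. The second difference over a parallelogram is symmetric in [u] and [v], so
    the two mixed derivatives agree at two, possibly distinct, points near [p]; continuity brings
    both back to [p]. *)
Lemma hessC (F : V -> R) p u v : smooth_at p F -> hess F p u v = hess F p v u.
Proof.
move=> sF.
have key u' v' : smooth_at p (fun q => hess F q u' v').
  rewrite (_ : (fun q => _) = fun q => 'd (fun q => 'd F q v') q u'); last first.
    by apply/funext => q; rewrite hessE.
  exact: (@smooth_at_diff_cst _ _ p (fun q => 'd F q v' : R) u' (smooth_at_diff_cst v' sF)).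
apply/eqP; rewrite -subr_eq0 -normr_le0; apply/ler_addgt0Pr => e e0; rewrite add0r.
have e20 : 0 < e / 2 by rewrite divr_gt0.
have /cvgr_dist_le/(_ _ e20) c1 := smooth_at_continuous (key u v).
have /cvgr_dist_le/(_ _ e20) c2 := smooth_at_continuous (key v u).
have nF := near_and (smooth_at_near sF) (near_and c1 c2).
have [d d0 dP] := near_box u v nF.
have dbox a b : 0 <= a <= d -> 0 <= b <= d -> `|a| <= d /\ `|b| <= d.
  by move=> /andP[a0 ad] /andP[b0 bd]; rewrite !ger0_norm.
have [|a [b [/andP[a0 ad] /andP[b0 bd] E1]]] := @second_difference F p u v d d0.
  by move=> x y xd yd; have [] := dP _ _ (dbox _ _ xd yd).1 (dbox _ _ xd yd).2.
have [|a' [b' [/andP[a'0 a'd] /andP[b'0 b'd] E2]]] := @second_difference F p v u d d0.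
  move=> x y xd yd; rewrite addrAC.
  by have [] := dP _ _ (dbox _ _ yd xd).1 (dbox _ _ yd xd).2.
have E : hess F (p + a *: u + b *: v) v u = hess F (p + b' *: u + a' *: v) u v.
  apply: (mulfI (lt0r_neq0 (mulr_gt0 d0 d0))); rewrite -E1 [p + b' *: u + _]addrAC -E2.
  by rewrite [p + d *: u + d *: v]addrAC; ring.
have n0 (x : R) : 0 < x -> x < d -> `|x| <= d by move=> x0 xd; rewrite gtr0_norm// ltW.
have [_ [_ k2]] := dP _ _ (n0 _ a0 ad) (n0 _ b0 bd).
have [_ [k1 _]] := dP _ _ (n0 _ b'0 b'd) (n0 _ a'0 a'd).
rewrite [e]splitr; have -> : hess F p u v - hess F p v u =
  (hess F p u v - hess F (p + b' *: u + a' *: v) u v) -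
  (hess F p v u - hess F (p + a *: u + b *: v) v u) by rewrite E; ring.
by apply: le_trans (ler_normB _ _) _; exact: lerD.
Qed.

End symmetry.

Lemma hessDl {V : normedModType R} (F : V -> R) p u v w :
  hess F p (u + v) w = hess F p u w + hess F p v w.
Proof. by rewrite !hessE linearD. Qed.

Lemma hessZl {V : normedModType R} (F : V -> R) p a v w :
  hess F p (a *: v) w = a * hess F p v w.
Proof. by rewrite !hessE linearZ. Qed.

Lemma hessDr {V : normedModType R} (F : V -> R) p u v w : smooth_at p F ->
  hess F p w (u + v) = hess F p w u + hess F p w v.
Proof. by move=> sF; rewrite -!(hessC _ w)// hessDl. Qed.

Lemma hessZr {V : normedModType R} (F : V -> R) p a v w : smooth_at p F ->
  hess F p w (a *: v) = a * hess F p w v.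
Proof. by move=> sF; rewrite -!(hessC _ w)// hessZl. Qed.

Lemma hess_sumr {V : normedModType R} (F : V -> R) p w n (v : 'I_n -> V) :
  smooth_at p F -> hess F p w (\sum_j v j) = \sum_j hess F p w (v j).
Proof.
move=> sF; rewrite hessC// hessE linear_sum; apply: eq_bigr => j _.
by rewrite -hessE; exact: hessC.
Qed.

(** Both the base point [c s] and the vector [Y s] move, whence two terms. At a critical point of
    [F] the second disappears, and derivatives of [dF (Y)] then depend only on the Hessian and on
    the value of [Y]; this is how every vector field is differentiated against [rho] at [p]. *)
Lemma diff_along {V : normedModType R} n (F : 'rV[R]_n -> R) (c Y : V -> 'rV[R]_n) p w :
  smooth_at p c -> smooth_at p Y -> smooth_at (c p) F ->
  'd (fun s => 'd F (c s) (Y s)) p w =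
  hess F (c p) ('d c p w) (Y p) + 'd F (c p) ('d Y p w).
Proof.
move=> sc sY sF.
have dc := smooth_at_differentiable sc.
have dY := smooth_at_differentiable sY.
have dF := smooth_at_differentiable sF.
have sDF j : smooth_at (c p) ('D_(delta_mx 0 j) F) by exact: smooth_at_derive.
have dDF j : differentiable (fun s => 'D_(delta_mx 0 j) F (c s)) p.
  exact: (differentiable_comp dc (smooth_at_differentiable (sDF j))).
pose T j s := Y s 0 j * 'D_(delta_mx 0 j) F (c s).
have dT j : differentiable (T j) p.
  by apply: differentiableM => //; exact: differentiable_entry.
have nE : \forall s \near p, \sum_j T j s = 'd F (c s) (Y s).
  have nF : \forall s \near p, smooth_at (c s) F.
    exact: (smooth_at_continuous sc) (smooth_at_near sF).
  by apply: filterS nF => s /smooth_at_differentiable dFs; rewrite diff_partials.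
rewrite -(diff_ext _ _ nE); last first.
  have := differentiable_sum dT.
  by rewrite (_ : \sum_j T j = fun s => \sum_j T j s)//; apply/funext => x; rewrite fct_sumE.
rewrite diff_sumE// (row_sum_delta (Y p)) hess_sumr// diff_partials// -big_split/=.
apply: eq_bigr => j _; rewrite diff_mulE//; last exact: differentiable_entry.
rewrite diff_coordE// hessZr// mulrC [X in _ + X]mulrC; congr (_ + _).
  rewrite mulrC; congr (_ * _).
  rewrite (diff_compE _ dc (smooth_at_differentiable (sDF j))).
  rewrite hessE; apply: diff_ext; first exact/smooth_at_differentiable/sDF.
  by apply: filterS (smooth_at_near sF) => q /smooth_at_differentiable dFq; rewrite deriveE.
Qed.

End Hessian.

Section Directional_rules.
Context {R : realType} {V : normedModType R}.
Implicit Types (q w : V).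

Lemma dirdiffD {W : normedModType R} (f : V -> W) q w w' :
  dirdiff f q (w + w') = dirdiff f q w + dirdiff f q w'.
Proof. by rewrite !dirdiffE linearD. Qed.

Lemma dirdiffZ {W : normedModType R} (f : V -> W) q a w :
  dirdiff f q (a *: w) = a *: dirdiff f q w.
Proof. by rewrite !dirdiffE linearZ. Qed.

Lemma dirdiff_deriveE {W : normedModType R} (f : V -> W) q w :
  smooth_at q f -> 'D_w f q = dirdiff f q w.
Proof. by move=> sf; rewrite dirdiffE deriveE//; exact: smooth_at_differentiable. Qed.

Lemma dirdiff_ext {W : normedModType R} (f g : V -> W) q w :
  smooth_at q f -> (\forall x \near q, f x = g x) -> dirdiff f q w = dirdiff g q w.
Proof.
by move=> sf fg; rewrite !dirdiffE; apply: diff_ext => //; exact: smooth_at_differentiable.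
Qed.

Lemma dirdiff_cst {W : normedModType R} (c : W) q w : dirdiff (fun=> c) q w = 0.
Proof. by rewrite dirdiffE diff_constE. Qed.

Lemma dirdiff_id q w : dirdiff id q w = w.
Proof. by rewrite dirdiffE -deriveE// derive_id. Qed.

Lemma dirdiff_add {W : normedModType R} (f g : V -> W) q w :
  smooth_at q f -> smooth_at q g ->
  dirdiff (fun x => f x + g x) q w = dirdiff f q w + dirdiff g q w.
Proof.
by move=> sf sg; rewrite !dirdiffE; apply: diff_addE; exact: smooth_at_differentiable.
Qed.

Lemma dirdiff_mul (f g : V -> R) q w : smooth_at q f -> smooth_at q g ->
  dirdiff (fun x => f x * g x) q w = f q * dirdiff g q w + g q * dirdiff f q w.
Proof.
by move=> sf sg; rewrite !dirdiffE; apply: diff_mulE; exact: smooth_at_differentiable.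
Qed.

Lemma dirdiff_scale n (f : V -> R) (g : V -> 'rV[R]_n) q w :
  smooth_at q f -> smooth_at q g ->
  dirdiff (fun x => f x *: g x) q w = f q *: dirdiff g q w + dirdiff f q w *: g q.
Proof.
by move=> sf sg; rewrite !dirdiffE; apply: diff_scaleE; exact: smooth_at_differentiable.
Qed.

Lemma dirdiff_dot n (f g : V -> 'rV[R]_n) q w : smooth_at q f -> smooth_at q g ->
  dirdiff (fun x => dot (f x) (g x)) q w =
  dot (f q) (dirdiff g q w) + dot (dirdiff f q w) (g q).
Proof.
by move=> sf sg; rewrite !dirdiffE; apply: diff_dotE; exact: smooth_at_differentiable.
Qed.

Lemma dirdiff_coord n (f : V -> 'rV[R]_n) q w j : smooth_at q f ->
  dirdiff (fun x => f x 0 j) q w = dirdiff f q w 0 j.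
Proof.
by move=> sf; rewrite !dirdiffE; apply: diff_coordE; exact: smooth_at_differentiable.
Qed.

Lemma dirdiff_comp {W W' : normedModType R} (f : V -> W) (g : W -> W') q w :
  smooth_at q f -> smooth_at (f q) g ->
  dirdiff (fun x => g (f x)) q w = dirdiff g (f q) (dirdiff f q w).
Proof.
by move=> sf sg; rewrite !dirdiffE; apply: diff_compE; exact: smooth_at_differentiable.
Qed.

Lemma dirdiff_along n (F : 'rV[R]_n -> R) (c Y : V -> 'rV[R]_n) p w :
  smooth_at p c -> smooth_at p Y -> smooth_at (c p) F ->
  dirdiff (fun s => dirdiff F (c s) (Y s)) p w =
  hess F (c p) (dirdiff c p w) (Y p) + dirdiff F (c p) (dirdiff Y p w).
Proof.
move=> sc sY sF; rewrite !dirdiffE -diff_along//.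
by congr (diff _ _ _); apply/funext => s; rewrite dirdiffE.
Qed.

End Directional_rules.

Lemma smooth_at_dirdiff {R : realType} n m p (f : 'rV[R]_n -> 'rV[R]_m)
    (X : 'rV[R]_n -> 'rV[R]_n) :
  smooth_at p f -> smooth_at p X -> smooth_at p (fun q => dirdiff f q (X q)).
Proof.
move=> sf sX; rewrite (_ : (fun _ => _) = fun q => 'd f q (X q)); first exact: smooth_at_diff.
by apply/funext => q; rewrite dirdiffE.
Qed.

Lemma smooth_at_dirdiff_scalar {R : realType} n p (f : 'rV[R]_n -> R)
    (X : 'rV[R]_n -> 'rV[R]_n) :
  smooth_at p f -> smooth_at p X -> smooth_at p (fun q => dirdiff f q (X q)).
Proof.
move=> sf sX; rewrite (_ : (fun _ => _) = fun q => 'd f q (X q)).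
  exact: smooth_at_diff_scalar.
by apply/funext => q; rewrite dirdiffE.
Qed.

Lemma smooth_at_dirdiff_cst {R : realType} {V W : normedModType R} p (F : V -> W) v :
  smooth_at p F -> smooth_at p (fun q => dirdiff F q v).
Proof.
move=> sF; rewrite (_ : (fun _ => _) = fun q => 'd F q v); first exact: smooth_at_diff_cst.
by apply/funext => q; rewrite dirdiffE.
Qed.

Lemma hess_dirdiff {R : realType} {V : normedModType R} (F : V -> R) p w v :
  hess F p w v = dirdiff (fun q => dirdiff F q v) p w.
Proof.
rewrite hessE dirdiffE; congr (diff _ _ _).
by apply/funext => q; rewrite dirdiffE.
Qed.

Lemma Cn_comp_scalar {R : realType} {V : normedModType R} n k A B
    (f : V -> 'rV[R]_n) (g : 'rV[R]_n -> R) : open A -> open B ->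
  (forall x, A x -> B (f x)) -> Cn k A f -> Cn k B g -> Cn k A (g \o f).
Proof.
move=> oA oB AB Cf Cg.
have CG : Cn k B (fun y => const_mx (g y) : 'rV[R]_1).
  by apply: Cn_row => // j; apply: Cn_ext Cg => // x _; rewrite mxE.
apply: Cn_ext (Cn_coord 0 0 oA (Cn_comp oA oB AB Cf CG)) => // x _ /=.
by rewrite mxE.
Qed.

(** * The implicit function theorem for curves *)

Section Implicit_curve.
Context {R : realType} (n : nat) (F : 'rV[R]_n -> R) (p Z X : 'rV[R]_n).
Context (B : set 'rV[R]_n) (oB : open B) (sF : smooth_on B F).
Let c (s z : R) : 'rV[R]_n := p + s *: Z + z *: X.
Context (d m : R) (d0 : 0 < d) (m0 : 0 < m).
Hypothesis cB : forall s z, `|s| <= d -> `|z| <= d -> B (c s z).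
Hypothesis cm : forall s z, `|s| <= d -> `|z| <= d -> m <= 'd F (c s z) X.
Hypothesis Fp : F p = 0.

Let cD (s z x : R) : c s z + x *: X = c s (z + x).
Proof. by rewrite /c -addrA -scalerDl. Qed.

Let dF q : B q -> differentiable F q.
Proof. by have [+ _] := sF 1%N; apply. Qed.

Let vertical_MVT (s z1 z2 : R) : `|s| <= d -> `|z1| <= d -> `|z2| <= d -> z1 < z2 ->
  exists2 x, z1 < x < z2 & F (c s z2) - F (c s z1) = (z2 - z1) * 'd F (c s x) X.
Proof.
move=> sd; rewrite !ler_norml => /andP[z1d _] /andP[_ z2d] z12.
have := @line_MVT _ _ F (c s z1) X (z2 - z1); rewrite subr_gt0 => /(_ z12)[x xz|x xz E].
  by rewrite cD; apply/dF/cB => //; rewrite ler_norml; lra.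
exists (z1 + x); first by lra.
by move: E; rewrite !cD [z1 + (z2 - z1)]addrC subrK.
Qed.

Let vertical_increasing (s z1 z2 : R) : `|s| <= d -> `|z1| <= d -> `|z2| <= d -> z1 < z2 ->
  m * (z2 - z1) <= F (c s z2) - F (c s z1).
Proof.
move=> sd z1d z2d z12; have [x xz ->] := vertical_MVT sd z1d z2d z12.
rewrite mulrC ler_pM2l ?subr_gt0//; apply: cm => //.
by move: z1d z2d; rewrite !ler_norml; lra.
Qed.

Let c_is_derive (s z : R) : is_derive s 1 (c ^~ z) Z.
Proof.
rewrite (_ : c ^~ z = fun s => s *: Z + (p + z *: X)); last first.
  by apply/funext => x; rewrite /c addrAC addrC.
have dl x : differentiable (fun x : R => x *: Z) x by exact: (@differentiableZl _ _ _ id).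
have dc : differentiable (fun=> p + z *: X) s by exact: differentiable_cst.
apply: DeriveDef; first exact/diff_derivable/differentiableD.
rewrite deriveE; last exact: differentiableD.
rewrite (diff_addE _ (dl s) dc) [X in _ + X]diff_constE addr0.
rewrite [LHS](congr1 (@^~ 1) (@diffZl _ _ _ id Z s _))//.
by rewrite -deriveE// derive_id scale1r.
Qed.

Let c_continuous s z : {for s, continuous (c ^~ z)}.
Proof.
have [dc _] := c_is_derive s z.
by apply: differentiable_continuous; exact/derivable1_diffP.
Qed.

Let c_continuous2 s z : {for z, continuous (c s)}.
Proof.
apply: differentiable_continuous; apply: differentiableD; first exact: differentiable_cst.
exact: (@differentiableZl _ _ _ id).
Qed.

(** On the line [s = 0] the function is negative at [- d] and positive at [d]. Both signs persist
    for small [s], and the intermediate value theorem gives a root between. *)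
Let root_exists : exists2 d1, 0 < d1 <= d & forall s, `|s| < d1 ->
  exists z, `|z| < d /\ F (c s z) = 0.
Proof.
have dd : `|d| <= d by rewrite gtr0_norm.
have Nd : `|- d| <= d by rewrite normrN.
have z0 : `|0 : R| <= d by rewrite normr0 ltW.
have c00 : F (c 0 0) = 0 by rewrite /c !scale0r !addr0.
have Fd : 0 < F (c 0 d).
  have := vertical_increasing z0 z0 dd d0; rewrite c00 !subr0.
  by apply: lt_le_trans; rewrite mulr_gt0.
have FNd : F (c 0 (- d)) < 0.
  have := @vertical_increasing 0 (- d) 0 z0 Nd z0; rewrite c00 oppr_lt0 => /(_ d0).
  have := mulr_gt0 m0 d0; lra.
have cont z : `|z| <= d -> {for (0 : R), continuous (fun s => F (c s z))}.
  move=> zd; apply: (@continuous_comp _ _ _ (c ^~ z) F); first exact: c_continuous.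
  by apply: differentiable_continuous; exact/dF/cB.
have n1 : \forall s \near (0 : R), 0 < F (c s d).
  by have /cvgr_gt/(_ _ Fd) := cont d dd.
have n2 : \forall s \near (0 : R), F (c s (- d)) < 0.
  by have /cvgr_lt/(_ _ FNd) := cont _ Nd.
have /nbhs_ballP[/= e e0 eP] := near_and n1 n2.
exists (Num.min e d); first by rewrite lt_min e0 d0 ge_min lexx orbT.
move=> s; rewrite lt_min => /andP[se sd].
have [s1 s2] : 0 < F (c s d) /\ F (c s (- d)) < 0.
  by apply: eP; rewrite -ball_normE /ball_/= sub0r normrN.
have [|||z] := @IVT R (F \o c s) (- d) d 0.
- by rewrite ge0_cp// ltW.
- apply: continuous_in_subspaceT => z /[!inE]/=; rewrite in_itv/= => zd.
  apply: continuous_comp; first exact: c_continuous2.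
  by apply/differentiable_continuous/dF/cB; [exact: ltW|rewrite ler_norml].
- by rewrite ge_min le_max /= (ltW s1) (ltW s2) orbT.
rewrite in_itv/= => /andP[z1 z2] Fz; exists z; split=> //.
rewrite ltr_norml !lt_neqAle z1 z2 !andbT; apply/andP; split; apply/eqP.
  by move=> E; move: s2; rewrite E Fz ltxx.
by move=> E; move: s1; rewrite -E Fz ltxx.
Qed.

Let root_unique (s z1 z2 : R) : `|s| <= d -> `|z1| <= d -> `|z2| <= d ->
  F (c s z1) = 0 -> F (c s z2) = 0 -> z1 = z2.
Proof.
move=> sd z1d z2d F1 F2; case: (ltgtP z1 z2) => // z12.
  have := vertical_increasing sd z1d z2d z12; rewrite F1 F2 subrr.
  by rewrite leNgt mulr_gt0// subr_gt0.
have := vertical_increasing sd z2d z1d z12; rewrite F1 F2 subrr.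
by rewrite leNgt mulr_gt0// subr_gt0.
Qed.

Section root_function.
Context (d1 : R) (y : R -> R).
Hypothesis d1d : 0 < d1 <= d.
Hypothesis yP : forall s, `|s| < d1 -> `|y s| < d /\ F (c s (y s)) = 0.
Let A := [set s : R | `|s| < d1].

Let Ad s : A s -> `|s| <= d.
Proof. by move=> /= sd; apply: ltW; apply: lt_le_trans sd _; case/andP: d1d. Qed.

Let oA : open A.
Proof.
rewrite (_ : A = ball (0 : R) d1); first exact: ball_open.
by rewrite -ball_normE; apply/seteqP; split=> s; rewrite /ball_/A/= sub0r normrN.
Qed.

(** The mean value theorem on the vertical line over [s'], between the root [y s'] and the old value
    [y s]. Since the derivative along [X] is at least [m], this bounds the increment of [y], and
    dividing it by [s' - s] gives its difference quotient. *)
Let increment s s' : A s -> A s' -> exists x,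
  `|x - y s| <= `|y s' - y s| /\ `|x| <= d /\
  F (c s' (y s)) = (y s - y s') * 'd F (c s' x) X.
Proof.
move=> As As'; have [/ltW ysd _] := yP As; have [/ltW ys'd Fs'] := yP As'.
have sd' := Ad As'.
case: (ltgtP (y s) (y s')) => [lt|gt|eq].
- have [x /andP[x1 x2]] := vertical_MVT sd' ysd ys'd lt; rewrite Fs' sub0r => E.
  exists x; split; [|split].
  + by rewrite !gtr0_norm ?subr_gt0// lerD2r ltW.
  + by move: ysd ys'd; rewrite !ler_norml; lra.
  + by rewrite -[LHS]opprK E -mulNr opprB.
- have [x /andP[x1 x2]] := vertical_MVT sd' ys'd ysd gt; rewrite Fs' subr0 => E.
  exists x; split; [|split] => //.
  + by rewrite !ltr0_norm ?subr_lt0// lerN2 lerD2r ltW.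
  + by move: ysd ys'd; rewrite !ler_norml; lra.
- exists (y s); split; [|split] => //; first by rewrite eq.
  by rewrite {1}eq Fs' eq subrr mul0r.
Qed.

Let horizontal_continuous s : A s ->
  {for s, continuous (fun s' => F (c s' (y s)))}.
Proof.
move=> As; apply: (@continuous_comp _ _ _ (c ^~ (y s)) F); first exact: c_continuous.
by apply/differentiable_continuous/dF/cB; [exact: Ad|exact/ltW/(yP As).1].
Qed.

Let y_continuous s : A s -> {for s, continuous y}.
Proof.
move=> As; have /cvgrPdist_lt hc := horizontal_continuous As.
apply/cvgrPdist_lt => e e0; have := hc (m * e) (mulr_gt0 m0 e0).
rewrite (yP As).2; apply: filterS2 (open_nbhs_nbhs (conj oA As)) => s' As'.
have [x [_ [xd ->]]] := increment As As'; rewrite sub0r normrN normrM.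
have mx := cm (Ad As') xd.
rewrite [`|'d _ _ _|]gtr0_norm ?(lt_le_trans m0)// => lt.
rewrite -(ltr_pM2l m0); apply: le_lt_trans lt.
by rewrite mulrC ler_wpM2l.
Qed.

Let y_is_derive s : A s ->
  is_derive s 1 y (- ('d F (c s (y s)) Z / 'd F (c s (y s)) X)).
Proof.
move=> As; have cs : B (c s (y s)) by apply: cB; [exact: Ad|exact/ltW/(yP As).1].
(* The intermediate points are turned into a function of [s'], so that they converge to [y s] by
   continuity of [y], and the derivatives along [X] at these points have a limit. *)
have /choice[x xP] s' : exists x, A s' ->
    `|x - y s| <= `|y s' - y s| /\ `|x| <= d /\
    F (c s' (y s)) = (y s - y s') * 'd F (c s' x) X.
  have [As'|nA] := pselect (A s'); last by exists 0.
  by have [x xP] := increment As As'; exists x.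
have xy : x s' @[s' --> s] --> y s.
  apply/cvgrPdist_lt => e e0.
  have /cvgrPdist_lt/(_ e e0) := y_continuous As.
  apply: filterS2 (open_nbhs_nbhs (conj oA As)) => s' /xP[+ _].
  by rewrite distrC [`|y s' - _|]distrC; exact: le_lt_trans.
have cx : c s' (x s') @[s' --> s] --> c s (y s).
  apply: cvgD; last by apply: cvgZr_tmp.
  by apply: cvgD; [exact: cvg_cst|apply: cvgZr_tmp].
have DX : 'd F (c s' (x s')) X @[s' --> s] --> 'd F (c s (y s)) X.
  have sFs : smooth_at (c s (y s)) F by exists B.
  exact: (@cvg_comp _ _ _ (fun s' => c s' (x s')) (fun q => 'd F q X) _ _ _ cx
    (smooth_at_continuous (smooth_at_diff_cst X sFs))).
have DX0 : 'd F (c s (y s)) X != 0.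
  by apply/lt0r_neq0/(lt_le_trans m0)/cm; [exact: Ad|exact/ltW/(yP As).1].
have DZ : h^-1 *: (F (c (h + s) (y s)) - F (c s (y s))) @[h --> 0^'] --> 'd F (c s (y s)) Z.
  have [dc dcE] := c_is_derive s (y s).
  have dc' : differentiable (c ^~ (y s)) s by exact/derivable1_diffP.
  have dFc := differentiable_comp dc' (dF cs).
  have : derivable (F \o c ^~ (y s)) s 1 by exact: diff_derivable.
  move=> /cvg_ex[l Hl].
  have <- : l = 'd F (c s (y s)) Z.
    rewrite -dcE (deriveE _ dc') -(diff_compE (1 : R) dc' (dF cs)) -deriveE//.
    by apply/esym/cvg_lim.
  by move: Hl; under eq_fun do rewrite /= [_%:A]mulr1.
have lim : h^-1 *: (y (h *: 1 + s) - y s) @[h --> 0^'] -->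
    - ('d F (c s (y s)) Z / 'd F (c s (y s)) X).
  have sh : h + s @[h --> (0 : R)^'] --> s.
    rewrite -[X in _ --> X]add0r; apply: cvgD; last exact: cvg_cst.
    exact: cvg_within.
  have DX' : ('d F (c (h + s) (x (h + s))) X)^-1 @[h --> (0 : R)^'] --> ('d F (c s (y s)) X)^-1.
    by apply: cvgV => //; exact: (@cvg_comp _ _ _ (fun h : R => h + s) (fun s' => 'd F (c s' (x s')) X) _ _ _ sh DX).
  have lim0 : - (h^-1 *: (F (c (h + s) (y s)) - F (c s (y s))) *
      ('d F (c (h + s) (x (h + s))) X)^-1) @[h --> (0 : R)^'] -->
      - ('d F (c s (y s)) Z / 'd F (c s (y s)) X).
    exact: cvgN (cvgM DZ DX').
  apply: cvg_trans lim0.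
  apply: near_eq_cvg.
  have As' : \forall h \near (0 : R)^', A (h + s).
    exact: (sh _ (open_nbhs_nbhs (conj oA As))).
  near=> h.
  have Ah : A (h + s) by near: h.
  have [_ [xd E]] := xP _ Ah.
  rewrite /= (yP As).2 subr0 E [h *: 1]mulr1.
  have := lt_le_trans m0 (cm (Ad Ah) xd).
  move: ('d F _ X) => D D0.
  by rewrite -scalerAl mulfK ?gt_eqF// -scalerN opprB.
apply: DeriveDef; first by apply/cvg_ex; eexists; exact: lim.
exact: cvg_lim lim.
Unshelve. all: by end_near. Qed.

(** Bootstrap: [y' = - F_Z / F_X] along the graph of [y], and the right-hand side is of class C^k as
    soon as [y] is. *)
Lemma implicit_root_smooth k : Cn k A y.
Proof.
elim: k => [|k IH]; first by move=> s; exact: y_continuous.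
have dy s : A s -> differentiable y s.
  by move=> /y_is_derive[dy _]; exact/derivable1_diffP.
split=> // v.
pose g s := c s (y s).
have Aid : Cn k A (id : R -> R).
  case: (k) => [|j]; first by move=> s _; exact: cvg_id.
  split=> // w; rewrite (_ : 'D_w _ = fun=> w); first exact: Cn_cst.
  by apply/funext => s; exact: derive_id.
have Cg : Cn k A g.
  apply: CnD => //; last exact: CnZl.
  by apply: CnD => //; [exact: Cn_cst|exact: CnZl].
have gB s : A s -> B (g s).
  by move=> As; apply: cB; [exact: Ad|exact/ltW/(yP As).1].
have CD w : Cn k A (fun s => 'D_w F (g s)).
  by apply: (@Cn_comp_scalar _ _ _ k A B g ('D_w F)) => //; have [_] := sF k.+1; apply.
apply: (@Cn_ext _ _ _ _ _ (fun s => (- v) * ('D_Z F (g s) * ('D_X F (g s))^-1))) => //.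
  move=> s As /=; have [dys dyE] := y_is_derive As.
  have -> : 'D_v y s = v * 'D_1 y s.
    by rewrite !deriveE; [rewrite -[in LHS](mulr1 v) [LHS]linearZ|exact: dy..].
  by rewrite dyE !deriveE ?mulrN ?mulNr//; exact/dF/gB.
apply: CnM => //; first exact: Cn_cst.
apply: CnM => //; apply: CnV => // s As.
rewrite deriveE; last exact/dF/gB.
by apply/lt0r_neq0/(lt_le_trans m0)/cm; [exact: Ad|exact/ltW/(yP As).1].
Qed.

End root_function.

Lemma implicit_curve_box : exists (y : R -> R), [/\ smooth_at (0 : R) y, y 0 = 0,
   \forall s \near (0 : R), F (c s (y s)) = 0 &
   exists2 e, 0 < e & forall s z, `|s| < e -> `|z| < e -> F (c s z) = 0 -> z = y s].
Proof.
have [d1 d1d zP] := root_exists; have [d10 d1d'] := andP d1d.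
have /choice[y yP] s : exists z, `|s| < d1 -> `|z| < d /\ F (c s z) = 0.
  have [sd|_] := ltP `|s| d1; last by exists 0.
  by have [z zs] := zP s sd; exists z.
have n0 : `|0 : R| < d1 by rewrite normr0.
have z0 : `|0 : R| <= d by rewrite normr0 ltW.
have oA : open [set s : R | `|s| < d1].
  rewrite (_ : [set s : R | _] = ball (0 : R) d1); first exact: ball_open.
  by rewrite -ball_normE; apply/seteqP; split=> s; rewrite /ball_/= sub0r normrN.
exists y; split.
- exists [set s | `|s| < d1]; split=> // k.
  exact: (implicit_root_smooth d1d).
- have [y0 Fy0] := yP _ n0; apply: (root_unique z0 (ltW y0) z0) => //.
  by rewrite /c !scale0r !addr0.
- apply: filterS (open_nbhs_nbhs (conj oA n0)) => s /yP[]//.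
- exists d1 => // s z sd zd Fz; have [ysd Fys] := yP _ sd.
  apply: (@root_unique s) => //; first exact/ltW/(lt_le_trans sd).
    exact/ltW/(lt_le_trans zd).
  exact: ltW.
Qed.

End Implicit_curve.

(** The local uniqueness of the root is what later shows that the curve sweeps out all zeros of [F]
    near [p]. Replacing [F] by [- F] reduces to a positive derivative along [X], which half its
    value at [p] then bounds below nearby. *)
Lemma implicit_curve {R : realType} n (F : 'rV[R]_n -> R) (p Z X : 'rV[R]_n) :
  smooth_at p F -> F p = 0 -> 'd F p X != 0 ->
  exists (y : R -> R), [/\ smooth_at (0 : R) y, y 0 = 0,
   \forall s \near (0 : R), F (p + s *: Z + y s *: X) = 0 &
   exists2 e, 0 < e & forall s z, `|s| < e -> `|z| < e ->
     F (p + s *: Z + z *: X) = 0 -> z = y s].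
Proof.
wlog pos : F / 0 < 'd F p X => [wl sF Fp FX0|].
  case: (ltgtP ('d F p X) 0) => [neg|pos|E]; last by rewrite E eqxx in FX0.
    have dF := smooth_at_differentiable sF.
    have dN : 'd (fun q => - F q) p X = - 'd F p X.
      by rewrite [LHS](congr1 (@^~ X) (diffN dF)).
    have [||||y [sy y0 nF [e e0 uniq]]] := wl (fun q => - F q).
    - by rewrite dN oppr_gt0.
    - exact: smooth_atN.
    - by rewrite Fp oppr0.
    - by rewrite dN oppr_eq0.
    exists y; split=> //.
      by apply: filterS nF => s /eqP; rewrite oppr_eq0 => /eqP.
    exists e => // s z se ze Fz; apply: uniq => //; by rewrite Fz oppr0.
  exact: wl.
move=> sF Fp FX0; pose m := 'd F p X / 2.
have m0 : 0 < m by rewrite divr_gt0.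
have sD := smooth_at_diff_cst X sF.
have nm : \forall q \near p, m <= 'd F q X.
  have mlt : m < 'd F p X by rewrite /m; lra.
  have /cvgr_gt/(_ _ mlt) := smooth_at_continuous sD.
  by apply: filterS => q /ltW.
have [B [oB Bp sB]] := sF.
have [d d0 dP] := near_box Z X (near_and (open_nbhs_nbhs (conj oB Bp)) nm).
exact: (@implicit_curve_box _ _ F p Z X B oB sB d m d0 m0
  (fun s z sd zd => (dP s z sd zd).1) (fun s z sd zd => (dP s z sd zd).2) Fp).
Qed.

(** * Euclidean algebra *)

Section Dot.
Context {R : realType} {n : nat}.
Implicit Types x y z : 'rV[R]_n.

Lemma dotC x y : dot x y = dot y x.
Proof. by apply: eq_bigr => j _; rewrite mulrC. Qed.

Lemma dotDl x y z : dot (x + y) z = dot x z + dot y z.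
Proof. by rewrite /dot -big_split; apply: eq_bigr => j _; rewrite mxE mulrDl. Qed.

Lemma dotZl a x z : dot (a *: x) z = a * dot x z.
Proof. by rewrite /dot mulr_sumr; apply: eq_bigr => j _; rewrite mxE mulrA. Qed.

Lemma dotDr x y z : dot z (x + y) = dot z x + dot z y.
Proof. by rewrite dotC dotDl !(dotC z). Qed.

Lemma dotZr a x z : dot z (a *: x) = a * dot z x.
Proof. by rewrite dotC dotZl dotC. Qed.

Lemma dot0l x : dot 0 x = 0.
Proof. by rewrite -(scale0r 0) dotZl mul0r. Qed.

Lemma dot_ge0 x : 0 <= dot x x.
Proof. by apply: sumr_ge0 => j _; rewrite -expr2 sqr_ge0. Qed.

Lemma dot_eq0 x : (dot x x == 0) = (x == 0).
Proof.
apply/eqP/eqP => [/eqP|->]; last by rewrite dot0l.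
rewrite psumr_eq0; last by move=> j _; rewrite -expr2 sqr_ge0.
move=> /allP x0; apply/rowP => j; rewrite mxE.
by have := x0 j (mem_index_enum j); rewrite /= mulf_eq0 orbb => /eqP.
Qed.

Lemma dot_gt0 x : x != 0 -> 0 < dot x x.
Proof. by move=> x0; rewrite lt_def dot_ge0 dot_eq0 x0. Qed.

Lemma enorm_gt0 x : x != 0 -> 0 < enorm x.
Proof. by move=> x0; rewrite sqrtr_gt0 dot_gt0. Qed.

Lemma sqr_enorm x : enorm x ^+ 2 = dot x x.
Proof. by rewrite sqr_sqrtr// dot_ge0. Qed.

End Dot.

Section Space.
Context {R : realType}.
Implicit Types a b c x y z nu n : 'rV[R]_3.

Lemma det3E a b c : det3 a b c =
  (a 0 (inord 1) * b 0 (inord 2) - a 0 (inord 2) * b 0 (inord 1)) * c 0 (inord 0) +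
  (a 0 (inord 2) * b 0 (inord 0) - a 0 (inord 0) * b 0 (inord 2)) * c 0 (inord 1) +
  (a 0 (inord 0) * b 0 (inord 1) - a 0 (inord 1) * b 0 (inord 0)) * c 0 (inord 2).
Proof. by rewrite det3_dot dot3E !crosspE. Qed.

Lemma det3_combination a b c (s t s' t' : R) :
  det3 (s *: a + t *: b) (s' *: a + t' *: b) c = (s * t' - t * s') * det3 a b c.
Proof. by rewrite !det3E !mxE; ring. Qed.

Lemma det3Zl a b c s : det3 (s *: a) b c = s * det3 a b c.
Proof. by rewrite !det3E !mxE; ring. Qed.

(** The squared triple product is the Gram determinant, which is diagonal here. It shows that
    determinants of orthogonal nonzero vectors do not vanish. *)
Lemma gram3 a b c : dot a b = 0 -> dot b c = 0 -> dot a c = 0 ->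
  det3 a b c ^+ 2 = dot a a * dot b b * dot c c.
Proof.
move=> ab bc ac.
suff -> : det3 a b c ^+ 2 = dot a a * dot b b * dot c c
    + 2 * dot a b * dot b c * dot a c - dot a a * dot b c ^+ 2
    - dot b b * dot a c ^+ 2 - dot c c * dot a b ^+ 2.
  by rewrite ab bc ac; ring.
by rewrite !dot3E !det3E; ring.
Qed.

(** The linear relation between four vectors of space, paired with [nu]: two of its terms vanish by
    orthogonality. It reduces the determinant in the singular curvature to the [nu]-component of the
    acceleration. *)
Lemma det3_orthogonal y c n nu : dot nu nu = 1 -> dot y nu = 0 -> dot n nu = 0 ->
  det3 y c n = - det3 nu y n * dot c nu.
Proof.
move=> nu1 ynu nnu; rewrite -[LHS]mulr1 -nu1.
suff -> : det3 y c n * dot nu nu = - det3 nu y n * dot c nu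
    + dot n nu * det3 y c nu - dot y nu * det3 n c nu.
  by rewrite ynu nnu; ring.
by rewrite !dot3E !det3E; ring.
Qed.

End Space.

Section Plane.
Context {R : realType}.
Implicit Types x y w : 'rV[R]_2.

Lemma row2E w : w = w 0 0 *: eu R + w 0 1 *: ev R.
Proof. by apply: row2P; rewrite !mxE /=; ring. Qed.

(** Cramer's rule. *)
Lemma plane_frame x y w : det2 x y != 0 ->
  w = (det2 w y / det2 x y) *: x + (det2 x w / det2 x y) *: y.
Proof.
rewrite !det2E => d0; apply: row2P; rewrite !mxE.
  by field.
by field.
Qed.

Lemma det2_neq0 x y : det2 x y != 0 -> x != 0.
Proof. by apply: contraNneq => ->; rewrite det2E !mxE; apply/eqP; ring. Qed.

End Plane.

(** * Focal surfaces in a principal frame *)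

Lemma dirdiffZ_scalar {R : realType} {V : normedModType R} (F : V -> R) q a w :
  dirdiff F q (a *: w) = a * dirdiff F q w.
Proof. exact: dirdiffZ. Qed.

Section Focal_frame.
Context {R : realType} (f nu C : 'rV[R]_2 -> 'rV[R]_3) (rho mu : 'rV[R]_2 -> R)
  (X Y : 'rV[R]_2 -> 'rV[R]_2) (p : 'rV[R]_2).

(* X and Y are principal directions, with curvatures 1 / rho and mu. *)
Record principal_frame (q : 'rV[R]_2) : Prop := PrincipalFrame {
  pf_smooth_f : smooth_at q f;
  pf_smooth_nu : smooth_at q nu;
  pf_smooth_rho : smooth_at q rho;
  pf_smooth_mu : smooth_at q mu;
  pf_smooth_X : smooth_at q X;
  pf_smooth_Y : smooth_at q Y;
  pf_rho : rho q != 0;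
  pf_unit : dot (nu q) (nu q) = 1;
  pf_tangent : forall w, dot (dirdiff f q w) (nu q) = 0;
  pf_X : rho q *: dirdiff nu q (X q) = - dirdiff f q (X q);
  pf_Y : dirdiff nu q (Y q) = - mu q *: dirdiff f q (Y q);
  pf_orthogonal : dot (dirdiff f q (X q)) (dirdiff f q (Y q)) = 0;
  pf_direct : 0 < det2 (X q) (Y q);
  pf_fX : dirdiff f q (X q) != 0;
  pf_fY : dirdiff f q (Y q) != 0 }.

Hypothesis CE : C = fun q => f q + rho q *: nu q.

Section at_frame_point.
Context (q : 'rV[R]_2) (fr : principal_frame q).

Lemma smooth_focal : smooth_at q C.
Proof.
rewrite CE; apply: smooth_atD; first exact: pf_smooth_f fr.
by apply: smooth_atZ; [exact: pf_smooth_rho fr|exact: pf_smooth_nu fr].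
Qed.

Lemma diff_focal w :
  dirdiff C q w = dirdiff f q w + (rho q *: dirdiff nu q w + dirdiff rho q w *: nu q).
Proof.
have sf := pf_smooth_f fr; have snu := pf_smooth_nu fr; have srho := pf_smooth_rho fr.
rewrite CE dirdiff_add//; last exact: smooth_atZ.
by congr (_ + _); exact: dirdiff_scale.
Qed.

Lemma diff_focal_X : dirdiff C q (X q) = dirdiff rho q (X q) *: nu q.
Proof. by rewrite diff_focal (pf_X fr) addrA subrr add0r. Qed.

Lemma diff_focal_Y :
  dirdiff C q (Y q) = (1 - rho q * mu q) *: dirdiff f q (Y q) + dirdiff rho q (Y q) *: nu q.
Proof.
rewrite diff_focal (pf_Y fr).
move: (dirdiff f q (Y q)) (dirdiff rho q (Y q)) (nu q) (rho q) (mu q) => u r v rh m.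
by apply/rowP => j; rewrite !mxE; ring.
Qed.

Lemma frame_decomposition w : exists a b, w = a *: X q + b *: Y q.
Proof. by do 2!eexists; apply: plane_frame; rewrite gt_eqF// (pf_direct fr). Qed.

Lemma diff_focal_frame a b : dirdiff C q (a *: X q + b *: Y q) =
  dirdiff rho q (a *: X q + b *: Y q) *: nu q + (b * (1 - rho q * mu q)) *: dirdiff f q (Y q).
Proof.
rewrite !dirdiffD !dirdiffZ_scalar !dirdiffZ diff_focal_X diff_focal_Y.
move: (dirdiff f q (Y q)) (dirdiff rho q (X q)) (dirdiff rho q (Y q)) (nu q) (rho q) (mu q).
by move=> u r r' v rh m; apply/rowP => j; rewrite !mxE; ring.
Qed.

(** Both [df] and [dnu] are tangent to the surface, so only the derivative of the coefficient [rho]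
    contributes along [nu]. *)
Lemma dot_diff_focal_nu w : dot (dirdiff C q w) (nu q) = dirdiff rho q w.
Proof.
have [a [b ->]] := frame_decomposition w.
by rewrite diff_focal_frame dotDl !dotZl (pf_unit fr) (pf_tangent fr) mulr1 mulr0 addr0.
Qed.

Lemma focal_area_density (n : 'rV[R]_2 -> 'rV[R]_3) :
  signed_area_density C n q * det2 (X q) (Y q) =
  dirdiff rho q (X q) * (1 - rho q * mu q) * det3 (nu q) (dirdiff f q (Y q)) (n q).
Proof.
rewrite /signed_area_density (dirdiff_deriveE _ smooth_focal) (dirdiff_deriveE _ smooth_focal).
transitivity (det3 (dirdiff C q (X q)) (dirdiff C q (Y q)) (n q)).
  rewrite [in RHS](row2E (X q)) [in RHS](row2E (Y q)) !dirdiffD !dirdiffZ.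
  by rewrite det3_combination det2E mulrC.
rewrite diff_focal_X diff_focal_Y -[_ *: nu q]addr0 -[X in _ + X](scale0r (dirdiff f q (Y q))).
rewrite [X in det3 _ X]addrC det3_combination.
by move: (det3 _ _ _) (dirdiff rho q (X q)) (dirdiff rho q (Y q)) (rho q) (mu q) => *; ring.
Qed.

End at_frame_point.

Hypothesis frames : \forall q \near p, principal_frame q.
Hypothesis mup : mu p = 0.
Hypothesis drhop : forall w, dirdiff rho p w = 0.
Let QXX := hess rho p (X p) (X p).
Let QXY := hess rho p (X p) (Y p).
Let QYY := hess rho p (Y p) (Y p).
Hypothesis QXX0 : QXX != 0.

Let frp : principal_frame p. Proof. exact: nbhs_singleton frames. Qed.
Let srho : smooth_at p rho. Proof. exact: pf_smooth_rho frp. Qed.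
Let xr q := dirdiff rho q (X q).

Let sxr : smooth_at p xr.
Proof. by apply: smooth_at_dirdiff_scalar => //; exact: pf_smooth_X frp. Qed.

(** [rho] is critical at [p], so the derivative of the field [X] drops out. *)
Let dxr w : dirdiff xr p w = hess rho p w (X p).
Proof.
rewrite /xr (@dirdiff_along _ _ _ rho id X); [|exact: smooth_at_id|exact: pf_smooth_X frp|by []].
by rewrite drhop addr0 dirdiff_id.
Qed.

Let focal_at_p w : forall a b, w = a *: X p + b *: Y p ->
  dirdiff C p w = b *: dirdiff f p (Y p).
Proof.
by move=> a b ->; rewrite (diff_focal_frame frp) drhop mup mulr0 subr0 mulr1 scale0r add0r.
Qed.

Section sign.
Context (n : 'rV[R]_2 -> 'rV[R]_3) (sn : smooth_at p n) (n1 : dot (n p) (n p) = 1).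
Hypothesis Cn0 : \forall q \near p, forall w, dot (dirdiff C q w) (n q) = 0.
Let D := det3 (nu p) (dirdiff f p (Y p)) (n p).

(** Orthogonality to [dC (X) = (X rho) nu] says nothing at [p] itself, where [X rho] vanishes.
    Differentiating [(X rho) * dot nu n = 0] along [X] leaves [QXX * dot nu n = 0] at [p], and [QXX]
    is nonzero. *)
Let normal_nu : dot (n p) (nu p) = 0.
Proof.
have sdot : smooth_at p (fun q => dot (nu q) (n q)).
  by apply: smooth_at_dot => //; exact: pf_smooth_nu frp.
have z : \forall q \near p, xr q * dot (nu q) (n q) = 0.
  apply: filterS2 frames Cn0 => q fr /(_ (X q)).
  by rewrite (diff_focal_X fr) dotZl.
have := dirdiff_ext (X p) (smooth_atM sxr sdot) z.
rewrite dirdiff_cst dirdiff_mul//.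
rewrite dxr {1}/xr drhop mul0r add0r => /eqP.
by rewrite mulf_eq0 (negbTE QXX0) orbF dotC => /eqP.
Qed.

Let normal_fY : dot (dirdiff f p (Y p)) (n p) = 0.
Proof.
have := nbhs_singleton Cn0 (Y p); rewrite (@focal_at_p (Y p) 0 1) ?scale1r//.
by rewrite scale0r add0r.
Qed.

Let D2 : D ^+ 2 = dot (dirdiff f p (Y p)) (dirdiff f p (Y p)).
Proof.
rewrite /D gram3 ?(pf_unit frp) ?n1 ?mul1r ?mulr1//.
  by rewrite dotC (pf_tangent frp).
by rewrite dotC.
Qed.

Let D0 : D != 0.
Proof. by rewrite -sqrf_eq0 D2 dot_eq0 (pf_fY frp). Qed.

Let lam := signed_area_density C n.

(** The quotient of the area density by [X rho]. It is smooth and, by [mfactorp], nonzero at [p], so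
    [lam] and [X rho] have proportional differentials there. *)
Let mfactor q := (1 - rho q * mu q) * det3 (nu q) (dirdiff f q (Y q)) (n q) / det2 (X q) (Y q).

Let lamE : \forall q \near p, lam q = xr q * mfactor q.
Proof.
apply: filterS frames => q fr.
have d0 : det2 (X q) (Y q) != 0 by rewrite gt_eqF// (pf_direct fr).
apply: (mulIf d0); rewrite /lam focal_area_density// /mfactor /xr.
by rewrite -[RHS]mulrA divfK// mulrA.
Qed.

Let mfactor_smooth : smooth_at p mfactor.
Proof.
have sfY : smooth_at p (fun q => dirdiff f q (Y q)).
  by apply: smooth_at_dirdiff; [exact: pf_smooth_f frp|exact: pf_smooth_Y frp].
apply: smooth_atM.
  apply: smooth_atM.
    apply: smooth_atB; first exact: smooth_at_cst.
    by apply: smooth_atM => //; exact: pf_smooth_mu frp.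
  apply: (@smooth_at_ext _ _ _ _ (fun q => dot (crossp (nu q) (dirdiff f q (Y q))) (n q))).
    by near=> q; rewrite det3_dot.
  by apply: smooth_at_dot => //; apply: smooth_at_crossp => //; exact: pf_smooth_nu frp.
apply: smooth_atV; first by rewrite gt_eqF// (pf_direct frp).
apply: (@smooth_at_ext _ _ _ _ (fun q => X q 0 0 * Y q 0 1 - X q 0 1 * Y q 0 0)).
  by near=> q; rewrite det2E.
by apply: smooth_atB; apply: smooth_atM; apply: smooth_at_coord;
  (exact: pf_smooth_X frp || exact: pf_smooth_Y frp).
Unshelve. all: by end_near. Qed.

Let mfactorp : mfactor p = D / det2 (X p) (Y p).
Proof. by rewrite /mfactor mup mulr0 subr0 mul1r. Qed.

Let slam : smooth_at p lam.
Proof.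
apply: (smooth_at_ext _ (smooth_atM sxr mfactor_smooth)).
by apply: filterS lamE => q ->.
Qed.

Let dlam w : dirdiff lam p w = mfactor p * hess rho p w (X p).
Proof.
rewrite (dirdiff_ext w slam lamE) dirdiff_mul//.
by rewrite {1}/xr drhop mul0r add0r dxr.
Qed.

Context (gam : R -> 'rV[R]_2) (eta : 'rV[R]_2).
Hypothesis sgam : smooth_at (0 : R) gam.
Hypothesis gam0 : gam 0 = p.
Let w := dirdiff gam 0 1.
Hypothesis w0 : w != 0.
Hypothesis lam_gam : \forall s \near (0 : R), lam (gam s) = 0.
Hypothesis eta_kernel : exists a : R, X p = a *: eta.

Let sgC : smooth_at (gam 0) C. Proof. by rewrite gam0; exact: smooth_focal. Qed.
Let hgam (s : R) := C (gam s).

(** Differentiating [lam (gam s) = 0] at 0: the tangent of the singular curve is conjugate to [X p]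
    with respect to the Hessian of [rho]. *)
Let w_singular : hess rho p w (X p) = 0.
Proof.
have sl : smooth_at (gam 0) lam by rewrite gam0.
have sc : smooth_at (0 : R) (fun s => lam (gam s)) by exact: smooth_at_comp_scalar.
have := dirdiff_ext (1 : R) sc lam_gam.
rewrite dirdiff_cst dirdiff_comp// gam0 dlam => /eqP.
rewrite mulf_eq0 mfactorp mulf_eq0 (negbTE D0) invr_eq0 gt_eqF ?(pf_direct frp)//=.
by move=> /eqP.
Qed.

Let dhgam : \forall s \near (0 : R), derive1 hgam s = dirdiff C (gam s) (dirdiff gam s 1).
Proof.
have nC : \forall s \near (0 : R), smooth_at (gam s) C.
  exact: (smooth_at_continuous sgam) (smooth_at_near sgC).
apply: filterS2 (smooth_at_near sgam) nC => s ss sC.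
rewrite derive1E dirdiff_deriveE; last exact: smooth_at_comp.
by rewrite dirdiff_comp.
Qed.

Let shgam : smooth_at (0 : R) (derive1 hgam).
Proof.
have sh : smooth_at (0 : R) hgam by exact: smooth_at_comp.
rewrite (_ : derive1 hgam = 'D_(1 : R) hgam); first exact: smooth_at_derive.
by apply/funext => s; rewrite derive1E.
Qed.

(** Differentiate [dot hgam' nu = d rho (gam')]. On the right only the Hessian remains, [rho] being
    critical. On the left the extra term [dot hgam' (dnu w)] vanishes: [hgam'] is parallel to
    [df (Y)], [dnu (X)] is parallel to [df (X)], which is orthogonal to [df (Y)], and [dnu (Y) = 0]
    because [mu p = 0]. *)
Let acceleration : dot (derive1n 2 hgam 0) (nu p) = hess rho p w w.
Proof.
have [a [b wE]] := frame_decomposition frp w.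
have snu : smooth_at (gam 0) nu by rewrite gam0; exact: pf_smooth_nu frp.
have E : \forall s \near (0 : R),
    dot (derive1 hgam s) (nu (gam s)) = dirdiff rho (gam s) (dirdiff gam s 1).
  have nfr : \forall s \near (0 : R), principal_frame (gam s).
    by apply: (smooth_at_continuous sgam); rewrite gam0.
  by apply: filterS2 dhgam nfr => s -> fr; rewrite (dot_diff_focal_nu fr).
have snug : smooth_at (0 : R) (fun s => nu (gam s)) by exact: smooth_at_comp.
have sdot : smooth_at (0 : R) (fun s => dot (derive1 hgam s) (nu (gam s))).
  exact: smooth_at_dot.
have := dirdiff_ext (1 : R) sdot E.
rewrite dirdiff_dot// (@dirdiff_along _ _ _ rho gam (fun s => dirdiff gam s 1)); first last.
- by rewrite gam0.
- exact: smooth_at_dirdiff_cst.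
- exact: sgam.
rewrite gam0 drhop addr0 dirdiff_comp// gam0 => <-.
rewrite (nbhs_singleton dhgam) gam0 -/w (focal_at_p wE) wE !dirdiffD !dirdiffZ.
have pX : dirdiff nu p (X p) = - (rho p)^-1 *: dirdiff f p (X p).
  by rewrite scaleNr -scalerN -(pf_X frp) scalerA mulVf ?scale1r// (pf_rho frp).
rewrite pX (pf_Y frp) mup oppr0 scale0r scaler0 addr0.
rewrite dotZl !dotZr [dot (dirdiff f p (Y p)) _]dotC (pf_orthogonal frp) !mulr0 add0r.
by rewrite /derive1n/= derive1E dirdiff_deriveE.
Qed.

(** With [w = a X + b Y], the scale of [eta], the sign of [n] (through [D]) and the speed and
    orientation of [gam] (through [b]) all occur squared; what is left is [QXX] times the Hessian on
    [w]. *)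
Lemma singular_curvature_sign :
  Num.sg (Num.sg ('D_eta lam p * det2 (derive1 gam 0) eta) *
            (det3 (derive1 hgam 0) (derive1n 2 hgam 0) (n p)
             / enorm (derive1 hgam 0) ^+ 3)) =
  Num.sg (QXX * QYY - QXY ^+ 2).
Proof.
have [a [b wE]] := frame_decomposition frp w.
have [e Xe] := eta_kernel.
have X0 : X p != 0 by apply: (@det2_neq0 _ _ (Y p)); rewrite gt_eqF// (pf_direct frp).
have e0 : e != 0 by apply: contraNneq X0 => e0; rewrite Xe e0 scale0r.
have etaE : eta = e^-1 *: X p by rewrite Xe scalerA mulVf// scale1r.
have QYX : hess rho p (Y p) (X p) = QXY by rewrite hessC.
have sing : a * QXX + b * QXY = 0.
  by move: w_singular; rewrite wE hessDl !hessZl QYX.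
have b0 : b != 0.
  apply: contraNneq w0 => b0; move: sing; rewrite b0 mul0r addr0 => /eqP.
  by rewrite mulf_eq0 (negbTE QXX0) orbF wE b0 => /eqP ->; rewrite !scale0r addr0.
have h1 : derive1 hgam 0 = b *: dirdiff f p (Y p).
  by rewrite (nbhs_singleton dhgam) gam0 -/w (focal_at_p wE).
have g1 : derive1 gam 0 = w by rewrite derive1E dirdiff_deriveE.
have d0 : 0 < det2 (X p) (Y p) := pf_direct frp.
have E3 : det3 (derive1 hgam 0) (derive1n 2 hgam 0) (n p) = b * (- D * hess rho p w w).
  rewrite h1 det3Zl (det3_orthogonal _ (pf_unit frp) (pf_tangent frp _) normal_nu).
  by rewrite acceleration.
(* Completing the square: the conjugacy [a QXX + b QXY = 0] removes the square term and leaves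
   [b ^+ 2] times the determinant. *)
have EQ : QXX * hess rho p w w = b ^+ 2 * (QXX * QYY - QXY ^+ 2).
  rewrite {1}wE hessDl !hessZl wE !hessDr// !hessZr// QYX -/QXX -/QXY -/QYY.
  have aE : a * QXX = - (b * QXY) by apply/eqP; rewrite -addr_eq0 sing.
  rewrite (_ : QXX * _ = a * QXX * (a * QXX) + a * QXX * (b * QXY) * 2 + b ^+ 2 * (QXX * QYY)); last by ring.
  by rewrite aE; ring.
have N0 : 0 < enorm (derive1 hgam 0) ^+ 3.
  by rewrite exprn_gt0// enorm_gt0// h1 scaler_eq0 negb_or b0 (pf_fY frp).
rewrite sgrM sgr_id [Num.sg (_ / _)]sgrM sgrV [Num.sg (_ ^+ 3)]gtr0_sg// mulr1 -sgrM.
rewrite dirdiff_deriveE// dlam g1 E3 etaE hessZl -/QXX mfactorp.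
have -> : det2 w (e^-1 *: X p) = - (e^-1 * b * det2 (X p) (Y p)).
  by rewrite wE !det2E !mxE; ring.
(* The factor [det2 (X p) (Y p)] cancels between [mfactor p] and [det2 w eta], and their two minus
   signs, from [det2 w eta] and from the triple product, cancel as well. *)
rewrite [X in Num.sg X = _](_ : _ = (D * e^-1 * b) ^+ 2 * (QXX * hess rho p w w)); last first.
  by move: (hess _ _ w w) (det2 _ _) d0 => h d d0; field; rewrite e0 gt_eqF.
rewrite EQ mulrA sgrM gtr0_sg ?mul1r//.
by rewrite mulr_gt0// exprn_even_gt0//= !mulf_neq0// invr_eq0.
Qed.

End sign.

End Focal_frame.

(** * Singular curvature of the focal surface: all admissible choices, and existence of one *)

Section Focal_singular_curvature.
Context {R : realType} (f nu C : 'rV[R]_2 -> 'rV[R]_3) (rho mu : 'rV[R]_2 -> R)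
  (X Y : 'rV[R]_2 -> 'rV[R]_2) (p : 'rV[R]_2).
Hypothesis CE : C = fun q => f q + rho q *: nu q.
Hypothesis frames : \forall q \near p, principal_frame f nu rho mu X Y q.
Hypothesis mup : mu p = 0.
Hypothesis drhop : forall w, dirdiff rho p w = 0.
Let QXX := hess rho p (X p) (X p).
Let QXY := hess rho p (X p) (Y p).
Let QYY := hess rho p (Y p) (Y p).
Hypothesis QXX0 : QXX != 0.

Let frp : principal_frame f nu rho mu X Y p.
Proof. exact: nbhs_singleton frames. Qed.

(** An arbitrary choice meets the frame through the kernel: [X rho] vanishes at [p], so [dC (X) = 0]
    there and [X p] is a multiple of [eta p]. *)
Lemma sg_singular_curvature c : is_singular_curvature C p c ->
  Num.sg c = Num.sg (QXX * QYY - QXY ^+ 2).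
Proof.
move=> [V [n [gam [eta [[oV Vp] [sC sn nP] [sgam gam0 dgam lam0 _] [_ _ ker] ->]]]]].
have sg : smooth_at (0 : R) (gam : R -> 'rV[R]_2) := sgam.
have near0 : \forall q \near p, forall w, dot (dirdiff C q w) (n q) = 0.
  apply: filterS (open_nbhs_nbhs (conj oV Vp)) => q Vq w.
  by have [_ + _] := nP q Vq; rewrite dirdiffE.
have [n1 _ _] := nP p Vp.
apply: (singular_curvature_sign CE frames mup drhop QXX0 _ n1 near0 sg gam0) => //.
- by exists V.
- by move: dgam; rewrite derive1E dirdiff_deriveE.
- have lamp : signed_area_density C n p = 0.
    by have := nbhs_singleton lam0; rewrite gam0.
  apply/(nbhs_singleton ker lamp).
  by rewrite -dirdiffE (diff_focal_X CE frp) drhop scale0r.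
Qed.

(** The unit principal direction for the curvature [1 / rho]. It is normal to the focal surface
    because [dC] takes values in the span of [nu] and [df (Y)]. *)
Let n q : 'rV[R]_3 := (enorm (dirdiff f q (X q)))^-1 *: dirdiff f q (X q).

Section at_frame_point.
Context (q : 'rV[R]_2) (fr : principal_frame f nu rho mu X Y q).

Let sfX : smooth_at q (fun q => dirdiff f q (X q)).
Proof. by apply: smooth_at_dirdiff; [exact: pf_smooth_f fr|exact: pf_smooth_X fr]. Qed.

Lemma normal_unit : dot (n q) (n q) = 1.
Proof.
have e0 := enorm_gt0 (pf_fX fr).
by rewrite dotZl dotZr -sqr_enorm; field; rewrite gt_eqF.
Qed.

Lemma normal_focal w : dot (dirdiff C q w) (n q) = 0.
Proof.
have [a [b ->]] := frame_decomposition fr w.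
rewrite (diff_focal_frame CE fr) dotZr dotDl !dotZl [dot (nu q) _]dotC (pf_tangent fr).
by rewrite [dot (dirdiff f q (Y q)) _]dotC (pf_orthogonal fr) !mulr0 addr0 mulr0.
Qed.

Lemma normal_surface_normal : dot (n q) (nu q) = 0.
Proof. by rewrite dotZl (pf_tangent fr) mulr0. Qed.

End at_frame_point.

Lemma smooth_enorm {V : normedModType R} m (g : V -> 'rV[R]_m) q :
  smooth_at q g -> g q != 0 -> smooth_at q (fun x => enorm (g x)).
Proof.
move=> sg g0; have sd : smooth_at q (fun x => dot (g x) (g x)) by exact: smooth_at_dot.
apply: smooth_at_square_root; first by rewrite gt_eqF// enorm_gt0.
  apply: filterS (smooth_at_near sd) => x /smooth_at_continuous cd.
  apply: (@continuous_comp _ _ _ (fun x => dot (g x) (g x)) Num.sqrt) => //.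
  exact: sqrt_continuous.
by rewrite (_ : (fun _ => _) = fun x => dot (g x) (g x))//; apply/funext => x; rewrite sqr_enorm.
Qed.

Lemma normal_smooth q : principal_frame f nu rho mu X Y q -> smooth_at q n.
Proof.
move=> fr.
have sfX : smooth_at q (fun q => dirdiff f q (X q)).
  by apply: smooth_at_dirdiff; [exact: pf_smooth_f fr|exact: pf_smooth_X fr].
apply: smooth_atZ => //; apply: smooth_atV.
  by rewrite gt_eqF// enorm_gt0// (pf_fX fr).
by apply: smooth_enorm => //; exact: pf_fX fr.
Qed.

Let nondegenerate : \forall q \near p, 1 - rho q * mu q != 0.
Proof.
have sm : smooth_at p (fun q => 1 - rho q * mu q).
  apply: smooth_atB; first exact: smooth_at_cst.
  by apply: smooth_atM; [exact: pf_smooth_rho frp|exact: pf_smooth_mu frp].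
by apply: near_neq0; [exact: smooth_at_continuous|rewrite mup mulr0 subr0 oner_neq0].
Qed.

(** For the immersion property, a vector [a X + b Y] killed by [dC] has [b = 0] by its
    [df (Y)]-component. If [dn] kills it too, the derivative of [dot n nu = 0] gives
    [a * dot n (dnu X) = 0], and [dnu X = - df (X) / rho] is a nonzero multiple of [n]. *)
Lemma focal_front : exists V, [/\ open V, V p & front_on V C n].
Proof.
have [V [oV Vp VP]] := near_open (near_and frames nondegenerate).
have [A [oA Ap sC sn]] := smooth_at2 (smooth_focal CE frp) (normal_smooth frp).
exists (V `&` A); split; [exact: openI|by []|split].
- by move=> k; apply: Cn_subset (sC k) => x [].
- by move=> k; apply: Cn_subset (sn k) => x [].
move=> q [Vq Aq]; have [fr m0] := VP q Vq; split.
- exact: normal_unit.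
- by move=> w; rewrite -dirdiffE; exact: normal_focal.
have dC : differentiable C q by exact: smooth_at_differentiable (smooth_focal CE fr).
have dn : differentiable n q by exact: smooth_at_differentiable (normal_smooth fr).
have dP : 'd (fun x => (C x, n x)) q = (fun w => (dirdiff C q w, dirdiff n q w)) :> (_ -> _).
  by rewrite diff_pair//; apply/funext => w; rewrite !dirdiffE.
have kernel w : dirdiff C q w = 0 -> dirdiff n q w = 0 -> w = 0.
  have [a [b ->]] := frame_decomposition fr w.
  move=> Cw0 nw0.
  have b0 : b = 0.
    have := congr1 (fun z => dot z (dirdiff f q (Y q))) Cw0.
    rewrite /= dot0l (diff_focal_frame CE fr) dotDl !dotZl [dot (nu q) _]dotC (pf_tangent fr).
    rewrite mulr0 add0r => /eqP.
    by rewrite !mulf_eq0 (negbTE m0) dot_eq0 (negbTE (pf_fY fr)) !orbF => /eqP.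
  have nuX0 : dot (n q) (dirdiff nu q (X q)) != 0.
    have rX : rho q * dot (n q) (dirdiff nu q (X q)) = - enorm (dirdiff f q (X q)).
      have e0 := enorm_gt0 (pf_fX fr).
      rewrite -dotZr (pf_X fr) -scaleN1r dotZr dotZl -sqr_enorm.
      by field; rewrite gt_eqF.
    apply: contraTneq (enorm_gt0 (pf_fX fr)) => n0.
    by move: rX; rewrite n0 mulr0 => /eqP; rewrite eq_sym oppr_eq0 => /eqP ->; rewrite ltxx.
  have nnu : \forall x \near q, dot (n x) (nu x) = 0.
    apply: filterS (open_nbhs_nbhs (conj oV Vq)) => x /VP[frx _].
    exact: normal_surface_normal.
  have sd : smooth_at q (fun x => dot (n x) (nu x)).
    by apply: smooth_at_dot; [exact: normal_smooth|exact: pf_smooth_nu fr].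
  have := dirdiff_ext (a *: X q + b *: Y q) sd nnu.
  rewrite dirdiff_cst dirdiff_dot; [|exact: normal_smooth|exact: pf_smooth_nu fr].
  rewrite nw0 dot0l addr0 b0 scale0r addr0 dirdiffZ dotZr => /eqP.
  by rewrite mulf_eq0 (negbTE nuX0) orbF => /eqP ->; rewrite scale0r.
move=> w1 w2; rewrite dP => -[C12 n12]; apply/eqP; rewrite -subr_eq0; apply/eqP.
by apply: kernel; rewrite dirdiffE linearB/= -!dirdiffE ?C12 ?n12 subrr.
Qed.

Let sxr : smooth_at p (fun q => dirdiff rho q (X q)).
Proof.
by apply: smooth_at_dirdiff_scalar; [exact: pf_smooth_rho frp|exact: pf_smooth_X frp].
Qed.

Let lamE : \forall q \near p,
  signed_area_density C n q = 0 <-> dirdiff rho q (X q) = 0.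
Proof.
apply: filterS2 frames nondegenerate => q fr m0.
have d0 := pf_direct fr.
have D0 : det3 (nu q) (dirdiff f q (Y q)) (n q) != 0.
  rewrite -sqrf_eq0 gram3 ?(pf_unit fr) ?(normal_unit fr) ?mul1r ?mulr1.
  - by rewrite dot_eq0 (pf_fY fr).
  - by rewrite dotC (pf_tangent fr).
  - by rewrite dotZr dotC (pf_orthogonal fr) mulr0.
  - by rewrite dotC normal_surface_normal.
have := focal_area_density CE fr n; split=> E.
  have : dirdiff rho q (X q) * (1 - rho q * mu q) *
     det3 (nu q) (dirdiff f q (Y q)) (n q) == 0 by rewrite -H E mul0r.
  by rewrite !mulf_eq0 (negbTE m0) (negbTE D0) !orbF => /eqP.
apply/eqP; have : signed_area_density C n q * det2 (X q) (Y q) == 0.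
  by rewrite H E !mul0r.
by rewrite mulf_eq0 [det2 _ _ == _]gt_eqF// orbF.
Qed.

Lemma focal_null_field : null_field C n p X.
Proof.
split.
- exact: pf_smooth_X frp.
- apply: filterS frames => q fr.
  by apply: (@det2_neq0 _ _ (Y q)); rewrite gt_eqF// (pf_direct fr).
near=> q => lam0 w.
have fr : principal_frame f nu rho mu X Y q by near: q; exact: frames.
have m0 : 1 - rho q * mu q != 0 by near: q; exact: nondegenerate.
have xr0 : dirdiff rho q (X q) = 0 by move: lam0; near: q; apply: filterS lamE => q [].
rewrite -dirdiffE; split=> [|[a ->]]; last first.
  by rewrite dirdiffZ (diff_focal_X CE fr) xr0 scale0r scaler0.
have [a [b ->]] := frame_decomposition fr w.
move=> /(congr1 (fun z => dot z (dirdiff f q (Y q)))).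
rewrite /= dot0l (diff_focal_frame CE fr) dotDl !dotZl [dot (nu q) _]dotC (pf_tangent fr).
rewrite mulr0 add0r => /eqP.
rewrite !mulf_eq0 (negbTE m0) dot_eq0 (negbTE (pf_fY fr)) !orbF => /eqP ->.
by exists a; rewrite scale0r addr0.
Unshelve. all: by end_near. Qed.

(** The singular set is [X rho = 0], and the derivative of [X rho] along [X] at [p] is the nonzero
    [QXX]; it is therefore a graph over the direction [Y p]. *)
Lemma focal_singular_curve : exists gam, singular_curve C n p gam.
Proof.
pose xr q := dirdiff rho q (X q).
have dxr : 'd xr p (X p) != 0.
  rewrite -dirdiffE /xr (@dirdiff_along _ _ _ rho id X); first last.
  - exact: pf_smooth_rho frp.
  - exact: pf_smooth_X frp.
  - exact: smooth_at_id.
  by rewrite drhop addr0 dirdiff_id.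
have [y [sy y0 ny [e e0 uniq]]] := implicit_curve (Y p) sxr (drhop _) dxr.
pose gam (s : R) : 'rV[R]_2 := p + s *: Y p + y s *: X p.
have sgam : smooth_at (0 : R) gam.
  apply: smooth_atD; last exact: smooth_atZl.
  apply: smooth_atD; first exact: smooth_at_cst.
  by apply: smooth_atZl; exact: smooth_at_id.
have gam0 : gam 0 = p by rewrite /gam y0 !scale0r !addr0.
have d0 := pf_direct frp.
exists gam; split => //.
- have sid : smooth_at (0 : R) (id : R -> R) by exact: smooth_at_id.
  have coord j : derive1 gam 0 0 j = Y p 0 j + dirdiff y 0 1 * X p 0 j.
    rewrite derive1E dirdiff_deriveE// -dirdiff_coord//.
    rewrite (_ : (fun s => gam s 0 j) = fun s => p 0 j + (s * Y p 0 j + y s * X p 0 j)).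
      have sc (c : R) : smooth_at (0 : R) (fun _ : R => c) by exact: smooth_at_cst.
      rewrite !dirdiff_add//; try (by do ?apply: smooth_atD; apply: smooth_atM).
      rewrite !dirdiff_mul// !dirdiff_cst dirdiff_id; ring.
    by apply/funext => s; rewrite !mxE addrA.
  (* The velocity is [Y p] plus a multiple of [X p], so this determinant equals
     [det2 (X p) (Y p)]. *)
  have : det2 (X p) (derive1 gam 0) != 0.
    rewrite det2E !coord (_ : _ - _ = det2 (X p) (Y p)); first by rewrite gt_eqF.
    by rewrite det2E; ring.
  by apply: contraNneq => ->; rewrite det2E !mxE; apply/eqP; ring.
- have ng : \forall s \near (0 : R), signed_area_density C n (gam s) = 0 <->
      xr (gam s) = 0.
    have := smooth_at_continuous sgam; rewrite /prop_for /continuous_at gam0 => cgam.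
    exact: (cgam _ lamE).
  by apply: filterS2 ng ny => s -> .
move=> r r0.
(* [s] and [z] are the coordinates of [q - p] along [Y p] and [X p]. For a singular [q] near [p],
   uniqueness of the root forces [z q = y (s q)], that is, [q = gam (s q)]. *)
pose s q := det2 (X p) (q - p) / det2 (X p) (Y p).
pose z q := det2 (q - p) (Y p) / det2 (X p) (Y p).
have sdet (a b : 'rV[R]_2 -> 'rV[R]_2) : smooth_at p a -> smooth_at p b ->
    smooth_at p (fun q => det2 (a q) (b q) / det2 (X p) (Y p)).
  move=> sa sb; apply: smooth_atM; last exact: smooth_at_cst.
  rewrite (_ : (fun _ => _) = fun q => a q 0 0 * b q 0 1 - a q 0 1 * b q 0 0).
    by apply: smooth_atB; apply: smooth_atM; exact: smooth_at_coord.
  by apply/funext => q; rewrite det2E.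
have sqp : smooth_at p (fun q => q - p).
  by apply: smooth_atD; [exact: smooth_at_id|exact: smooth_at_cst].
have sp (c : 'rV[R]_2) : smooth_at p (fun q : 'rV[R]_2 => c) by exact: smooth_at_cst.
have small (g : 'rV[R]_2 -> R) t : smooth_at p g -> g p = 0 -> 0 < t ->
    \forall q \near p, `|g q| < t.
  move=> sg g0 t0; have /cvgrPdist_lt/(_ t t0) := smooth_at_continuous sg.
  by rewrite g0; apply: filterS => q; rewrite sub0r normrN.
have det0 (a : 'rV[R]_2) : (det2 a 0 = 0) * (det2 0 a = 0).
  by rewrite !det2E !mxE; split; ring.
have ns t : 0 < t -> \forall q \near p, `|s q| < t.
  by apply: small; [exact: sdet|rewrite /s subrr det0 mul0r].
have nz t : 0 < t -> \forall q \near p, `|z q| < t.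
  by apply: small; [exact: sdet|rewrite /z subrr det0 mul0r].
near=> q => lam0.
exists (s q); first by near: q; exact: ns.
have qE : q = p + s q *: Y p + z q *: X p.
  rewrite -addrA [s q *: _ + _]addrC -plane_frame; first by rewrite addrC subrK.
  by rewrite gt_eqF.
have xr0 : xr q = 0 by move: lam0; near: q; apply: filterS lamE => q [].
rewrite /gam -(uniq (s q) (z q)) -?qE//; near: q; [exact: ns|exact: nz].
Unshelve. all: by end_near. Qed.

Lemma singular_curvature_exists : exists c, is_singular_curvature C p c.
Proof.
have [V [oV Vp fV]] := focal_front; have [gam sg] := focal_singular_curve.
eexists; exists V, n, gam, X; split; [by []|exact: fV|exact: sg|exact: focal_null_field|].
by [].
Qed.

End Focal_singular_curvature.

(** * Two-jets and the normal forms of lips and beaks *)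

Section Two_jets.
Context {R : realType} {V : normedModType R}.
Implicit Types (F G : V -> R) (p w v : V).

Lemma dirdiff0r {W : normedModType R} (f : V -> W) p : dirdiff f p 0 = 0.
Proof. by rewrite dirdiffE linear0. Qed.

Lemma hess_ext F G p w v : smooth_at p F -> (\forall q \near p, F q = G q) ->
  hess F p w v = hess G p w v.
Proof.
move=> sF FG; rewrite !hess_dirdiff.
apply: dirdiff_ext; first exact: smooth_at_dirdiff_cst.
(* First derivatives must agree at all points near [p], hence an open set on which the functions
   agree. *)
have [B [oB Bp BP]] := near_open (near_and (smooth_at_near sF) FG).
apply: filterS (open_nbhs_nbhs (conj oB Bp)) => q Bq; have [sFq _] := BP q Bq.
apply: dirdiff_ext => //.
by apply: filterS (open_nbhs_nbhs (conj oB Bq)) => x /BP[].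
Qed.

Lemma hess_mul F G p w v : smooth_at p F -> smooth_at p G ->
  hess (fun q => F q * G q) p w v =
  F p * hess G p w v + dirdiff F p w * dirdiff G p v +
  dirdiff F p v * dirdiff G p w + G p * hess F p w v.
Proof.
move=> sF sG; rewrite !hess_dirdiff.
have sFG : smooth_at p (fun q => F q * G q) by exact: smooth_atM.
have sDF := smooth_at_dirdiff_cst v sF.
have sDG := smooth_at_dirdiff_cst v sG.
have E : \forall q \near p, dirdiff (fun q => F q * G q) q v =
    F q * dirdiff G q v + G q * dirdiff F q v.
  apply: filterS2 (smooth_at_near sF) (smooth_at_near sG) => q sFq sGq.
  exact: dirdiff_mul.
rewrite (dirdiff_ext w (smooth_at_dirdiff_cst v sFG) E).
rewrite dirdiff_add; [|exact: smooth_atM..].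
rewrite !dirdiff_mul//.
move: (dirdiff (fun q => _) _ _) (dirdiff (fun q => _) _ _) => a b.
move: (dirdiff F p w) (dirdiff F p v) (dirdiff G p w) (dirdiff G p v) => *; ring.
Qed.

Lemma hess_mul_flat F G p w v : smooth_at p F -> smooth_at p G ->
  F p = 0 -> (forall w, dirdiff F p w = 0) ->
  hess (fun q => F q * G q) p w v = G p * hess F p w v.
Proof. by move=> sF sG F0 dF0; rewrite hess_mul// F0 !dF0 !mul0r !add0r. Qed.

Lemma dirdiff_mul_flat F G p w : smooth_at p F -> smooth_at p G ->
  F p = 0 -> dirdiff (fun q => F q * G q) p w = G p * dirdiff F p w.
Proof. by move=> sF sG F0; rewrite dirdiff_mul// F0 mul0r add0r. Qed.

Lemma hess_add F G p w v : smooth_at p F -> smooth_at p G ->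
  hess (fun q => F q + G q) p w v = hess F p w v + hess G p w v.
Proof.
move=> sF sG; rewrite !hess_dirdiff.
have sFG : smooth_at p (fun q => F q + G q) by exact: smooth_atD.
have E : \forall q \near p, dirdiff (fun q => F q + G q) q v =
    dirdiff F q v + dirdiff G q v.
  apply: filterS2 (smooth_at_near sF) (smooth_at_near sG) => q sFq sGq.
  exact: dirdiff_add.
rewrite (dirdiff_ext w (smooth_at_dirdiff_cst v sFG) E) dirdiff_add//;
  exact: smooth_at_dirdiff_cst.
Qed.

Lemma hess_cst (c : R) p w v : hess (fun=> c) p w v = 0.
Proof.
rewrite hess_dirdiff (_ : (fun _ => _) = fun=> 0); first exact: dirdiff_cst.
by apply/funext => q; rewrite dirdiff_cst.
Qed.

Lemma hess_scale (c : R) F p w v : smooth_at p F ->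
  hess (fun q => c * F q) p w v = c * hess F p w v.
Proof.
move=> sF; rewrite hess_mul//; last exact: smooth_at_cst.
by rewrite hess_cst !dirdiff_cst !mul0r mulr0 !addr0.
Qed.

(** Compare the coordinates of [s A = m B] up to second order. A product whose first factor has zero
    1-jet has as Hessian the value of the second factor times the Hessian of the first. The
    first-order comparison, at a coordinate with [A_j != 0], shows that [s] is critical too; the
    second-order one gives [A_i Hess s = B_i Hess m] for every [i], so [c = B_j / A_j]. Were [c]
    zero, [Hess s] would vanish, and then [B] at [p], since [Hess m] does not. *)
Lemma proportional_hess n (s m : V -> R) (A B : V -> 'rV[R]_n) p :
  smooth_at p s -> smooth_at p m -> smooth_at p A -> smooth_at p B ->
  (\forall q \near p, s q *: A q = m q *: B q) ->
  s p = 0 -> m p = 0 -> (forall w, dirdiff m p w = 0) -> A p != 0 -> B p != 0 ->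
  (exists w v, hess m p w v != 0) ->
  (forall w, dirdiff s p w = 0) /\
  exists2 c, c != 0 & forall w v, hess s p w v = c * hess m p w v.
Proof.
move=> ss sm sA sB E s0 m0 dm0 A0 B0 [w1 [v1 hm]].
have EE j : \forall q \near p, s q * A q 0 j = m q * B q 0 j.
  by apply: filterS E => q /(congr1 (fun z : 'rV_n => z 0 j)); rewrite !mxE.
have sAj j := smooth_at_coord j sA.
have sBj j := smooth_at_coord j sB.
have [j Aj] : exists j, A p 0 j != 0.
  by apply/rV0Pn.
have ds w : dirdiff s p w = 0.
  have := dirdiff_ext w (smooth_atM ss (sAj j)) (EE j).
  rewrite !dirdiff_mul_flat// dm0 mulr0 => /eqP.
  by rewrite mulf_eq0 (negbTE Aj) => /eqP.
have hs i w v : A p 0 i * hess s p w v = B p 0 i * hess m p w v.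
  have := hess_ext w v (smooth_atM ss (sAj i)) (EE i).
  by rewrite !hess_mul_flat.
split=> //; exists (B p 0 j / A p 0 j); last first.
  by move=> w v; apply: (mulfI Aj); rewrite hs mulrA mulrCA divff// mulr1.
rewrite mulf_neq0 ?invr_eq0//; apply: contra_neq B0 => Bj.
have hs0 : hess s p w1 v1 = 0.
  by apply: (mulfI Aj); rewrite hs Bj mul0r mulr0.
apply/rowP => i; rewrite mxE; apply/eqP.
have := hs i w1 v1; rewrite hs0 mulr0 => /esym/eqP.
by rewrite mulf_eq0 (negbTE hm) orbF.
Qed.

End Two_jets.

Lemma diffeo_germ_immersion {R : realType} n p q (phi : 'rV[R]_n -> 'rV[R]_n) w :
  diffeo_germ p q phi -> dirdiff phi p w = 0 -> w = 0.
Proof.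
move=> [phip sphi [psi [spsi psiK _]]] dw.
have sp : smooth_at (phi p) psi by rewrite phip.
have := dirdiff_ext w (smooth_at_comp sphi sp) psiK.
by rewrite dirdiff_comp// dw dirdiff0r -[RHS]/(dirdiff id p w) dirdiff_id => <-.
Qed.

Lemma diffeo_germ_sym {R : realType} n p q (phi : 'rV[R]_n -> 'rV[R]_n) :
  diffeo_germ p q phi -> exists psi, [/\ diffeo_germ q p psi,
    \forall x \near p, psi (phi x) = x & \forall y \near q, phi (psi y) = y].
Proof.
move=> [phip sphi [psi [spsi psiK phiK]]]; exists psi; split=> //; split=> //.
  by rewrite -phip (nbhs_singleton psiK).
by exists phi.
Qed.

Definition std_germ {R : realType} (s : R) (q : 'rV[R]_2) : 'rV[R]_3 :=
  let u := q 0 0 in let v := q 0 1 in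
  vec3 u (2 * v ^+ 3 + s * (u ^+ 2 * v)) (3 * v ^+ 4 + s * (u ^+ 2 * v ^+ 2)).

Section Standard_germ.
Context {R : realType} (s : R).

Lemma std_germ_lips : std_germ 1 = @std_lips R.
Proof. by apply/funext => q; rewrite /std_germ /std_lips !mul1r. Qed.

Lemma std_germ_beaks : std_germ (-1) = @std_beaks R.
Proof. by apply/funext => q; rewrite /std_germ /std_beaks !mulN1r. Qed.

Lemma dirdiff_entry (q w : 'rV[R]_2) j : dirdiff (fun x : 'rV[R]_2 => x 0 j) q w = w 0 j.
Proof. by rewrite (dirdiff_coord (f := @id 'rV[R]_2)) ?dirdiff_id//; exact: smooth_at_id. Qed.

Lemma dirdiff_vec3 {V : normedModType R} (a b c : V -> R) q w :
  smooth_at q a -> smooth_at q b -> smooth_at q c ->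
  dirdiff (fun x => vec3 (a x) (b x) (c x)) q w =
  vec3 (dirdiff a q w) (dirdiff b q w) (dirdiff c q w).
Proof.
move=> sa sb sc; have sv := smooth_at_vec3 sa sb sc.
by apply: row3P; rewrite -dirdiff_coord// !vec3E;
  congr dirdiff; apply/funext => x; rewrite !vec3E.
Qed.

Let smooth_entry (q : 'rV[R]_2) j : smooth_at q (fun x : 'rV[R]_2 => x 0 j).
Proof. by apply: (smooth_at_coord (f := @id 'rV[R]_2)); exact: smooth_at_id. Qed.

Lemma std_germ_smooth q : smooth_at q (std_germ s).
Proof.
have sc (c : R) : smooth_at q (fun _ : 'rV[R]_2 => c) by exact: smooth_at_cst.
apply: smooth_at_vec3 => //; apply: smooth_atD; apply: smooth_atM => //.
- exact: smooth_atX.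
- by apply: smooth_atM => //; exact: smooth_atX.
- exact: smooth_atX.
- by apply: smooth_atM; exact: smooth_atX.
Qed.

(** The [v]-derivatives of the last two components of the germ, [6 v^2 + s u^2] and
    [12 v^3 + 2 s u^2 v], share the factor [6 v^2 + s u^2]. So the two partial derivatives are
    [std_row1] and [std_density] times [std_row2], with rows that are everywhere independent. *)
Definition std_density (q : 'rV[R]_2) : R := 6 * (q 0 1 * q 0 1) + s * (q 0 0 * q 0 0).
Definition std_row1 (q : 'rV[R]_2) : 'rV[R]_3 :=
  vec3 1 (2 * s * (q 0 0 * q 0 1)) (2 * s * (q 0 0 * (q 0 1 * q 0 1))).
Definition std_row2 (q : 'rV[R]_2) : 'rV[R]_3 := vec3 0 1 (2 * q 0 1).

Lemma dirdiff_std_germ q w : dirdiff (std_germ s) q w =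
  w 0 0 *: std_row1 q + (w 0 1 * std_density q) *: std_row2 q.
Proof.
have sc (c : R) : smooth_at q (fun _ : 'rV[R]_2 => c) by exact: smooth_at_cst.
have -> : std_germ s = fun q => vec3 (q 0 0)
   (2 * (q 0 1 * (q 0 1 * q 0 1)) + s * (q 0 0 * (q 0 0 * q 0 1)))
   (3 * (q 0 1 * (q 0 1 * (q 0 1 * q 0 1))) + s * (q 0 0 * (q 0 0 * (q 0 1 * q 0 1)))).
  by apply/funext => x; rewrite /std_germ; congr vec3; ring.
have s3 : smooth_at q (fun x : 'rV[R]_2 => x 0 1 * (x 0 1 * x 0 1)).
  by do ?apply: smooth_atM.
have s2 (i : 'I_2) : smooth_at q (fun x : 'rV[R]_2 => x 0 i * x 0 1) by exact: smooth_atM.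
have s21 : smooth_at q (fun x : 'rV[R]_2 => x 0 0 * (x 0 0 * x 0 1)) by exact: smooth_atM.
have s4 : smooth_at q (fun x : 'rV[R]_2 => x 0 1 * (x 0 1 * (x 0 1 * x 0 1))).
  exact: smooth_atM.
have s012 : smooth_at q (fun x : 'rV[R]_2 => x 0 0 * (x 0 1 * x 0 1)) by exact: smooth_atM.
have s22 : smooth_at q (fun x : 'rV[R]_2 => x 0 0 * (x 0 0 * (x 0 1 * x 0 1))).
  exact: smooth_atM.
have c1 (c : R) F : smooth_at q F -> smooth_at q (fun x : 'rV[R]_2 => c * F x).
  by move=> sF; exact: smooth_atM.
rewrite dirdiff_vec3; [|exact: smooth_entry|by apply: smooth_atD; exact: c1|
  by apply: smooth_atD; exact: c1].
rewrite !dirdiff_add; try exact: c1.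
rewrite !(dirdiff_mul w (sc _))//.
rewrite !(dirdiff_mul w (smooth_entry q _))// !dirdiff_entry !dirdiff_cst.
by apply: row3P; rewrite !mxE /std_density !inordK//=; ring.
Qed.

End Standard_germ.

Section Independence.
Context {R : realType}.

Lemma crossp_combination (x y : 'rV[R]_3) (a b c d : R) :
  crossp (a *: x + b *: y) (c *: x + d *: y) = (a * d - b * c) *: crossp x y.
Proof. by apply: row3P; rewrite [RHS]mxE !crosspE !mxE; ring. Qed.

Lemma sqr_crossp (x y : 'rV[R]_3) :
  dot (crossp x y) (crossp x y) = dot x x * dot y y - dot x y ^+ 2.
Proof. by rewrite !dot3E !crosspE; ring. Qed.

Lemma crossp_neq0 (x y : 'rV[R]_3) :
  (forall a b : R, a *: x + b *: y = 0 -> a = 0 /\ b = 0) -> crossp x y != 0.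
Proof.
move=> free; apply/eqP => c0.
have g0 : dot x x * dot y y - dot x y ^+ 2 = 0 by rewrite -sqr_crossp c0 dot0l.
(* This is [dot y y] times the component of [x] orthogonal to [y]; its squared length is [dot y y]
   times the Gram determinant. *)
have z0 : dot y y *: x + (- dot x y) *: y = 0.
  apply/eqP; rewrite -dot_eq0 !(dotDl, dotDr, dotZl, dotZr) [dot y x]dotC.
  rewrite (_ : _ + _ = dot y y * (dot x x * dot y y - dot x y ^+ 2)); last by ring.
  by rewrite g0 mulr0.
have [yy0 _] := free _ _ z0.
have y0 : y = 0 by apply/eqP; rewrite -dot_eq0 yy0.
have [|_ /eqP] := free 0 1; first by rewrite y0 scale0r scaler0 addr0.
by rewrite oner_eq0.
Qed.

Lemma smooth_at_dirdiff_along {V : normedModType R} n m p (F : 'rV[R]_n -> 'rV[R]_m)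
    (c Z : V -> 'rV[R]_n) :
  smooth_at p c -> smooth_at p Z -> smooth_at (c p) F ->
  smooth_at p (fun q => dirdiff F (c q) (Z q)).
Proof.
move=> sc sZ sF.
rewrite (_ : (fun _ => _) =
    fun q => \sum_j Z q 0 j *: dirdiff F (c q) (delta_mx 0 j)).
  apply: smooth_at_sum => j; apply: smooth_atZ; first exact: smooth_at_coord.
  apply: (smooth_at_comp (g := fun y => dirdiff F y (delta_mx 0 j)) sc).
  exact: smooth_at_dirdiff_cst.
apply/funext => q; rewrite [in LHS](row_sum_delta (Z q)) dirdiffE linear_sum.
by apply: eq_bigr => j _; rewrite linearZ dirdiffE.
Qed.

Lemma immersion_det2 (phi : 'rV[R]_2 -> 'rV[R]_2) p :
  (forall w, dirdiff phi p w = 0 -> w = 0) ->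
  det2 (dirdiff phi p (eu R)) (dirdiff phi p (ev R)) != 0.
Proof.
move=> inj; set x := dirdiff phi p _; set y := dirdiff phi p _.
apply/eqP; rewrite det2E => /eqP; rewrite subr_eq0 => /eqP d0.
have ord2 (j : 'I_2) : j = 0 \/ j = 1.
  by case: j => -[|[|//]] lt; [left|right]; apply/val_inj.
have key j : y 0 j = 0 /\ x 0 j = 0.
  (* Its image has coordinates [y_j x_i - x_j y_i], which all vanish when the determinant does. *)
  have : y 0 j *: eu R + (- x 0 j) *: ev R = 0.
    apply: inj; rewrite dirdiffD !dirdiffZ -/x -/y; apply: row2P; rewrite !mxE.
      by have [->|->] := ord2 j; lra.
    by have [->|->] := ord2 j; lra.
  move=> /rowP z; move: (z 0) (z 1); rewrite !mxE /= !mulr1 !mulr0 addr0 add0r.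
  by move=> -> /eqP; rewrite oppr_eq0 => /eqP.
have x0 : x = 0 by apply: row2P; rewrite mxE; have [] := key 0; have [] := key 1.
have /rowP/(_ 0) := inj _ x0; rewrite !mxE /= => /eqP.
by rewrite oner_eq0.
Qed.

End Independence.

Section Normal_form.
Context {R : realType} (s : R).

(** Write [g = Psi o std_germ o phi] with [Psi] inverse to [Phi]. By the chain rule every [dg (w)]
    is a combination of the images under [dPsi] of the two rows, with the density in the second
    coefficient, so the cross product acquires the factor [std_density (phi q)]. The density
    vanishes at [p], leaving in [dg (w)] only the first coordinate of [dphi (w)]: hence the
    description of the kernel. *)
Lemma normal_form_area (g : 'rV[R]_2 -> 'rV[R]_3) p : smooth_at p g ->
  A_equivalent g p (std_germ s) 0 ->
  exists phi (B : 'rV[R]_2 -> 'rV[R]_3),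
    [/\ smooth_at p phi /\ phi p = 0, smooth_at p B /\ B p != 0,
        forall w, dirdiff phi p w = 0 -> w = 0,
        \forall q \near p, crossp (dirdiff g q (eu R)) (dirdiff g q (ev R)) =
          std_density s (phi q) *: B q &
        forall w, dirdiff g p w = 0 <-> dirdiff phi p w 0 0 = 0].
Proof.
move=> sg [phi [Phi [dphi dPhi E]]].
have [phip sphi _] := dphi.
have [Psi [dPsi PsiK _]] := diffeo_germ_sym dPhi.
have [Psip sPsi _] := dPsi.
have sc : smooth_at p (fun q => std_germ s (phi q)).
  by apply: smooth_at_comp => //; exact: std_germ_smooth.
have sPsi' : smooth_at (std_germ s (phi p)) Psi by rewrite phip.
have gE : \forall q \near p, g q = Psi (std_germ s (phi q)).
  have := smooth_at_continuous sg PsiK; apply: filterS2 E => q EP /= K.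
  by rewrite -EP K.
have dgE : \forall q \near p, forall w, dirdiff g q w =
   dirdiff phi q w 0 0 *: dirdiff Psi (std_germ s (phi q)) (std_row1 s (phi q)) +
   (dirdiff phi q w 0 1 * std_density s (phi q)) *:
     dirdiff Psi (std_germ s (phi q)) (std_row2 (phi q)).
  have nPsi : \forall q \near p, smooth_at (std_germ s (phi q)) Psi.
    exact: (smooth_at_continuous sc) (smooth_at_near sPsi').
  have [W [oW Wp WP]] := near_open (near_and gE (near_and (near_and
    (smooth_at_near sg) (smooth_at_near sphi)) (near_and (smooth_at_near sc) nPsi))).
  apply: filterS (open_nbhs_nbhs (conj oW Wp)) => q Wq w.
  have [_ [[sgq sphiq] [scq sPsiq]]] := WP q Wq.
  have nq : \forall x \near q, g x = Psi (std_germ s (phi x)).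
    by apply: filterS (open_nbhs_nbhs (conj oW Wq)) => x /WP[].
  rewrite (dirdiff_ext w sgq nq).
  rewrite (dirdiff_comp (f := fun x => std_germ s (phi x))) //.
  rewrite (dirdiff_comp (f := phi)) //; last exact: std_germ_smooth.
  by rewrite dirdiff_std_germ dirdiffD !dirdiffZ.
have srow1 : smooth_at p (fun q => std_row1 s (phi q)).
  have c (j : 'I_2) : smooth_at p (fun q => phi q 0 j) by exact: smooth_at_coord.
  have k (a : R) : smooth_at p (fun _ : 'rV[R]_2 => a) by exact: smooth_at_cst.
  by apply: smooth_at_vec3 => //; apply: smooth_atM => //; do ?apply: smooth_atM => //.
have srow2 : smooth_at p (fun q => std_row2 (phi q)).
  have c (j : 'I_2) : smooth_at p (fun q => phi q 0 j) by exact: smooth_at_coord.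
  have k (a : R) : smooth_at p (fun _ : 'rV[R]_2 => a) by exact: smooth_at_cst.
  by apply: smooth_at_vec3 => //; apply: smooth_atM.
have injphi w := diffeo_germ_immersion (w := w) dphi.
have injPsi w : dirdiff Psi (std_germ s (phi p)) w = 0 -> w = 0.
  by rewrite phip; exact: diffeo_germ_immersion dPsi.
(* [B] is the Jacobian determinant of [phi] times the cross product of the transported rows; it is
   nonzero at [p] because [dphi] and [dPsi] are injective there and the rows are independent. *)
exists phi, (fun q => (dirdiff phi q (eu R) 0 0 * dirdiff phi q (ev R) 0 1 -
    dirdiff phi q (eu R) 0 1 * dirdiff phi q (ev R) 0 0) *:
  crossp (dirdiff Psi (std_germ s (phi q)) (std_row1 s (phi q)))
         (dirdiff Psi (std_germ s (phi q)) (std_row2 (phi q)))).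
split=> //; first split.
- apply: smooth_atZ.
    by apply: smooth_atB; apply: smooth_atM; apply: smooth_at_coord;
      exact: smooth_at_dirdiff_cst.
  by apply: smooth_at_crossp;
    apply: (smooth_at_dirdiff_along (c := fun q => std_germ s (phi q))).
- rewrite scaler_eq0 negb_or -det2E immersion_det2//=.
  apply: crossp_neq0 => a b; rewrite -!dirdiffZ -dirdiffD => /injPsi/rowP z.
  have := z (inord 0); rewrite !mxE !inordK//= mulr1 mulr0 addr0 => a0.
  by have := z (inord 1); rewrite !mxE !inordK//= a0 mul0r add0r mulr1.
- apply: filterS dgE => q dgq; rewrite !dgq crossp_combination scalerA; congr (_ *: _).
  by ring.
- move=> w; rewrite (nbhs_singleton dgE) phip.
  rewrite (_ : std_density s 0 = 0); last by rewrite /std_density !mxE; ring.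
  rewrite mulr0 scale0r addr0 -dirdiffZ; split=> [|->]; last first.
    by rewrite scale0r dirdiff0r.
  rewrite -phip => /injPsi/rowP/(_ (inord 0)).
  by rewrite !mxE inordK//= mulr1.
Qed.

Lemma std_density_hess {V : normedModType R} (phi : V -> 'rV[R]_2) p : smooth_at p phi ->
  phi p = 0 ->
  [/\ smooth_at p (fun q => std_density s (phi q)),
      forall w, dirdiff (fun q => std_density s (phi q)) p w = 0 &
      forall w v, hess (fun q => std_density s (phi q)) p w v =
        12 * (dirdiff phi p w 0 1 * dirdiff phi p v 0 1) +
        2 * s * (dirdiff phi p w 0 0 * dirdiff phi p v 0 0)].
Proof.
move=> sphi phip.
have c (j : 'I_2) : smooth_at p (fun q => phi q 0 j) by exact: smooth_at_coord.
have cc (j : 'I_2) : smooth_at p (fun q => phi q 0 j * phi q 0 j) by exact: smooth_atM.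
have k (a : R) : smooth_at p (fun _ : V => a) by exact: smooth_at_cst.
have kcc (a : R) (j : 'I_2) : smooth_at p (fun q => a * (phi q 0 j * phi q 0 j)).
  exact: smooth_atM.
have p0 (j : 'I_2) : phi p 0 j = 0 by rewrite phip mxE.
split; first exact: smooth_atD.
  move=> w; rewrite /std_density dirdiff_add// !dirdiff_mul// !p0 !dirdiff_cst; ring.
move=> w v; rewrite /std_density hess_add// !hess_scale// !hess_mul// !p0.
rewrite !dirdiff_coord//.
move: (hess _ _ _ _) (hess _ _ _ _) => h0 h1.
move: (dirdiff phi p w) (dirdiff phi p v) => a b; ring.
Qed.

Lemma area_factor_hess (sig : 'rV[R]_2 -> R) n (A B : 'rV[R]_2 -> 'rV[R]_n)
    (phi : 'rV[R]_2 -> 'rV[R]_2) p :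
  smooth_at p sig -> smooth_at p A -> smooth_at p B -> smooth_at p phi ->
  phi p = 0 -> sig p = 0 -> A p != 0 -> B p != 0 ->
  (forall w, dirdiff phi p w = 0 -> w = 0) ->
  (\forall q \near p, sig q *: A q = std_density s (phi q) *: B q) ->
  (forall w, dirdiff sig p w = 0) /\
  exists2 c, c != 0 & forall w v, hess sig p w v =
    c * (12 * (dirdiff phi p w 0 1 * dirdiff phi p v 0 1) +
         2 * s * (dirdiff phi p w 0 0 * dirdiff phi p v 0 0)).
Proof.
move=> ssig sA sB sphi phip sig0 A0 B0 inj E.
have [sm dm hm] := std_density_hess sphi phip.
have m0 : std_density s (phi p) = 0 by rewrite phip /std_density !mxE; ring.
have [|ds [c c0 hs]] := proportional_hess ssig sm sA sB E sig0 m0 dm A0 B0.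
  pose x := dirdiff phi p (eu R); pose y := dirdiff phi p (ev R).
  (* A vector that [dphi] sends to a multiple of the second axis. There the Hessian is 12 times the
     squared Jacobian determinant, nonzero for every [s]. *)
  exists (y 0 0 *: eu R + (- x 0 0) *: ev R), (y 0 0 *: eu R + (- x 0 0) *: ev R).
  rewrite hm dirdiffD !dirdiffZ -/x -/y !mxE.
  have := immersion_det2 inj; rewrite -/x -/y det2E => d0.
  rewrite (_ : _ + _ = 12 * (x 0 0 * y 0 1 - x 0 1 * y 0 0) ^+ 2); last by ring.
  by rewrite mulf_neq0 ?pnatr_eq0// sqrf_eq0.
by split=> //; exists c => // w v; rewrite hs hm.
Qed.

End Normal_form.

(** * Principal frames of an immersed surface *)

Section Two_by_two.
Context {R : realType}.

Lemma mx2E (a b c d : R) : (mx2 a b c d 0 0 = a) * (mx2 a b c d 0 1 = b) *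
  (mx2 a b c d 1 0 = c) * (mx2 a b c d 1 1 = d).
Proof. by rewrite /mx2 !mxE /= ?mxE. Qed.

Lemma big_ord2 (F : 'I_2 -> R) : \sum_j F j = F 0 + F 1.
Proof.
rewrite !big_ord_recl big_ord0 addr0.
by rewrite (_ : lift ord0 ord0 = 1)//; apply/val_inj.
Qed.

Lemma mulmx2E (A B : 'M[R]_2) i j :
  (A *m B) i j = A i 0 * B 0 j + A i 1 * B 1 j.
Proof. by rewrite mxE big_ord2. Qed.

Lemma det_mx2 (W : 'M[R]_2) : \det W = W 0 0 * W 1 1 - W 0 1 * W 1 0.
Proof.
have <- : det2 (row 0 W) (row 1 W) = \det W.
  rewrite /det2; congr (\det _); apply/matrixP => -[[|[|//]] lt] j; rewrite !mxE/=.
    by congr (W _ _); apply/val_inj.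
  by congr (W _ _); apply/val_inj.
by rewrite det2E !mxE.
Qed.

Lemma char_poly_mx2 (W : 'M[R]_2) (a b : R) :
  char_poly W = ('X - a%:P) * ('X - b%:P) ->
  W 0 0 + W 1 1 = a + b /\ \det W = a * b.
Proof.
have -> : ('X - a%:P) * ('X - b%:P) = 'X^2 - (a + b) *: 'X + (a * b)%:P :> {poly R}.
  rewrite mulrBr mulrBl -expr2 mulrBl -polyCM -mul_polyC polyCD; ring.
move=> E; have tr := char_poly_trace W isT; have dt := char_poly_det W.
move: tr dt; rewrite E !coefE/= /mxtrace big_ord2 => tr dt; split.
  by apply/eqP; rewrite -eqr_opp -tr; apply/eqP; ring.
by move: dt; rewrite sqrrN expr1n mul1r => <-; ring.
Qed.

(** The classical formulas for twice the mean curvature and for the Gauss curvature, cleared of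
    denominators. They follow from the four scalar equations of [I W = II], combined as in Cramer's
    rule. *)
Lemma weingarten_invariants (E F G L M N a b : R) : E * G - F ^+ 2 != 0 ->
  char_poly (invmx (mx2 E F F G) *m mx2 L M M N) = ('X - a%:P) * ('X - b%:P) ->
  (a + b) * (E * G - F ^+ 2) = G * L - 2 * F * M + E * N /\
  a * b * (E * G - F ^+ 2) = L * N - M ^+ 2.
Proof.
move=> D0 /char_poly_mx2; set W := _ *m _; move=> [<- <-].
have EW : mx2 E F F G *m W = mx2 L M M N.
  by rewrite /W mulKVmx// unitmxE unitfE det_mx2 !mx2E -expr2.
move: W EW => W EW.
have e i j := congr1 (fun A : 'M[R]_2 => A i j) EW.
have e00 := e 0 0; have e01 := e 0 1; have e10 := e 1 0; have e11 := e 1 1.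
move: e00 e01 e10 e11; rewrite !mulmx2E !mx2E det_mx2 => e00 e01 e10 e11.
split.
  transitivity (G * (E * W 0 0 + F * W 1 0) - F * (F * W 0 0 + G * W 1 0) +
    (E * (F * W 0 1 + G * W 1 1) - F * (E * W 0 1 + F * W 1 1))); first by ring.
  by rewrite e00 e01 e10 e11; ring.
transitivity ((E * W 0 0 + F * W 1 0) * (F * W 0 1 + G * W 1 1) -
  (E * W 0 1 + F * W 1 1) * (F * W 0 0 + G * W 1 0)); first by ring.
by rewrite e00 e01 e10 e11 expr2.
Qed.
End Two_by_two.

Lemma dot_crossp {R : realType} (x y : 'rV[R]_3) :
  (dot x (crossp x y) = 0) * (dot y (crossp x y) = 0).
Proof. by rewrite !dot3E !crosspE; split; ring. Qed.

(** The Gram determinant of [x], [y], [z] is the square of [dot z (crossp x y)]; with the pairings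
    of [z] zero it reads [|z|^2 |x x y|^2 = 0]. *)
Lemma crossp_complement {R : realType} (x y z : 'rV[R]_3) : crossp x y != 0 ->
  dot z x = 0 -> dot z y = 0 -> dot z (crossp x y) = 0 -> z = 0.
Proof.
move=> c0 zx zy zc; apply/eqP; rewrite -dot_eq0.
suff : dot z z * dot (crossp x y) (crossp x y) == 0.
  by rewrite mulf_eq0 [X in _ || X]dot_eq0 (negbTE c0) orbF.
rewrite sqr_crossp; suff -> : dot z z * (dot x x * dot y y - dot x y ^+ 2) =
    dot z x ^+ 2 * dot y y - 2 * dot z x * dot z y * dot x y +
    dot z y ^+ 2 * dot x x + dot z (crossp x y) ^+ 2.
  by rewrite zx zy zc; apply/eqP; ring.
by rewrite !dot3E !crosspE; ring.
Qed.

(** * Unit normal and shape operator of an immersed surface *)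

Section Surface.
Context {R : realType} (U : set 'rV[R]_2) (f : 'rV[R]_2 -> 'rV[R]_3).
Hypothesis U_open : open U.
Hypothesis f_smooth : smooth_on U f.
Hypothesis f_immersion : forall q, U q -> immersion_at f q.
Let nu := unit_normal f.
Let fu q := dirdiff f q (eu R).
Let fv q := dirdiff f q (ev R).
Let nu_u q := dirdiff nu q (eu R).
Let nu_v q := dirdiff nu q (ev R).

Section at_point.
Context (q : 'rV[R]_2) (Uq : U q).

Lemma surface_smooth : smooth_at q f. Proof. by exists U. Qed.

Lemma near_surface : \forall x \near q, U x.
Proof. exact: open_nbhs_nbhs. Qed.

Lemma surface_injective w : dirdiff f q w = 0 -> w = 0.
Proof.
rewrite dirdiffE => dw; apply: (f_immersion Uq).
by rewrite dw linear0.
Qed.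

Lemma area_neq0 : crossp (fu q) (fv q) != 0.
Proof.
apply: crossp_neq0 => a b; rewrite -!dirdiffZ -dirdiffD => /surface_injective/rowP z.
by have := z 0; have := z 1; rewrite !mxE /= !mulr0 !mulr1 add0r addr0.
Qed.

Lemma unit_normalE : nu q = (enorm (crossp (fu q) (fv q)))^-1 *: crossp (fu q) (fv q).
Proof.
by rewrite /nu /unit_normal !(dirdiff_deriveE _ surface_smooth).
Qed.

Lemma unit_normal_smooth : smooth_at q nu.
Proof.
have sc : smooth_at q (fun x => crossp ('D_(eu R) f x) ('D_(ev R) f x)).
  by apply: smooth_at_crossp; apply: smooth_at_derive; exact: surface_smooth.
have c0 : crossp ('D_(eu R) f q) ('D_(ev R) f q) != 0.
  by rewrite !(dirdiff_deriveE _ surface_smooth) area_neq0.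
apply: smooth_atZ => //; apply: smooth_atV; first by rewrite gt_eqF// enorm_gt0.
exact: smooth_enorm.
Qed.

Lemma unit_normal_unit : dot (nu q) (nu q) = 1.
Proof.
have e0 := enorm_gt0 area_neq0.
by rewrite unit_normalE dotZl dotZr -sqr_enorm; field; rewrite gt_eqF.
Qed.

Lemma unit_normal_tangent w : dot (dirdiff f q w) (nu q) = 0.
Proof.
rewrite [w]row2E dirdiffD !dirdiffZ unit_normalE dotDl !dotZl !dotZr.
by rewrite !dot_crossp !mulr0 addr0.
Qed.

Lemma tangent_normal_zero z :
  dot z (fu q) = 0 -> dot z (fv q) = 0 -> dot z (nu q) = 0 -> z = 0.
Proof.
move=> zu zv zn; apply: (crossp_complement area_neq0) => //.
move: zn; rewrite unit_normalE dotZr => /eqP; rewrite mulf_eq0 invr_eq0.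
by rewrite gt_eqF ?enorm_gt0 ?area_neq0//= => /eqP.
Qed.

End at_point.

Section shape.
Context (q : 'rV[R]_2) (Uq : U q).

Lemma dirdiff_normal_tangent w : dot (dirdiff nu q w) (nu q) = 0.
Proof.
have snu := unit_normal_smooth Uq.
have E : \forall x \near q, dot (nu x) (nu x) = 1.
  by apply: filterS (near_surface Uq) => x Ux; exact: unit_normal_unit.
have := dirdiff_ext w (smooth_at_dot snu snu) E.
rewrite dirdiff_dot// dirdiff_cst [dot (nu q) _]dotC => /eqP.
by rewrite -mulr2n mulrn_eq0/= => /eqP.
Qed.

(** Differentiating [dot (df v) nu = 0] along [w] gives minus the normal component of a second
    derivative of [f], symmetric by [hessC] in each coordinate. *)
Lemma second_form_symmetric w v :
  dot (dirdiff nu q w) (dirdiff f q v) = dot (dirdiff nu q v) (dirdiff f q w).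
Proof.
have snu := unit_normal_smooth Uq; have sf := surface_smooth Uq.
have E w' v' : dot (dirdiff nu q w') (dirdiff f q v') =
    - dot (dirdiff (fun x => dirdiff f x v') q w') (nu q).
  have E0 : \forall x \near q, dot (dirdiff f x v') (nu x) = 0.
    by apply: filterS (near_surface Uq) => x Ux; exact: unit_normal_tangent.
  have sDf := smooth_at_dirdiff_cst v' sf.
  have := dirdiff_ext w' (smooth_at_dot sDf snu) E0.
  rewrite dirdiff_dot// dirdiff_cst => /eqP; rewrite addr_eq0 => /eqP <-.
  by rewrite dotC.
rewrite !E; congr (- dot _ _); apply/rowP => j.
have H w' v' : dirdiff (fun x => dirdiff f x v') q w' 0 j =
    hess (fun x => f x 0 j) q w' v'.
  have sDf := smooth_at_dirdiff_cst v' sf.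
  rewrite -dirdiff_coord// hess_dirdiff; apply: dirdiff_ext.
    exact: smooth_at_coord.
  by apply: filterS (smooth_at_near sf) => x sx; rewrite dirdiff_coord.
by rewrite !H; apply: hessC; exact: smooth_at_coord.
Qed.

Let E := dot (fu q) (fu q).
Let F := dot (fu q) (fv q).
Let G := dot (fv q) (fv q).
Let L := - dot (fu q) (nu_u q).
Let M := - dot (fu q) (nu_v q).
Let N := - dot (fv q) (nu_v q).

Lemma first_form_pos : 0 < E /\ 0 < E * G - F ^+ 2.
Proof.
rewrite -sqr_crossp !dot_gt0 ?area_neq0//.
by apply: contraNneq (area_neq0 Uq) => ->; apply/eqP; apply: row3P; rewrite crosspE !mxE; ring.
Qed.

(** Rodrigues' formula. The two equations say that [dnu (w) + k df (w)] is orthogonal to [f_u] and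
    [f_v]; it is also orthogonal to [nu], hence zero. *)
Lemma shape_eigenvector (k : R) (w : 'rV[R]_2) :
  L * w 0 0 + M * w 0 1 = k * (E * w 0 0 + F * w 0 1) ->
  M * w 0 0 + N * w 0 1 = k * (F * w 0 0 + G * w 0 1) ->
  dirdiff nu q w = - k *: dirdiff f q w.
Proof.
move=> e1 e2; apply/eqP; rewrite -subr_eq0; apply/eqP.
have nuE : dirdiff nu q w = w 0 0 *: nu_u q + w 0 1 *: nu_v q.
  by rewrite {1}[w]row2E dirdiffD !dirdiffZ.
have fE : dirdiff f q w = w 0 0 *: fu q + w 0 1 *: fv q.
  by rewrite {1}[w]row2E dirdiffD !dirdiffZ.
have luu : dot (nu_u q) (fu q) = - L by rewrite /L opprK dotC.
have lvu : dot (nu_v q) (fu q) = - M by rewrite /M opprK dotC.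
have lvv : dot (nu_v q) (fv q) = - N by rewrite /N opprK dotC.
have luv : dot (nu_u q) (fv q) = - M by rewrite -lvu; exact: second_form_symmetric.
have fvu : dot (fv q) (fu q) = F by rewrite dotC.
rewrite -scaleNr opprK; apply: (tangent_normal_zero Uq).
- rewrite nuE fE !(dotDl, dotZl) luu lvu fvu -/E.
  by move: e1; move: (L) (M) (E) (F) (w 0 0) (w 0 1) => *; lra.
- rewrite nuE fE !(dotDl, dotZl) luv lvv -/F -/G.
  by move: e2; move: (M) (N) (F) (G) (w 0 0) (w 0 1) => *; lra.
- by rewrite dotDl dotZl dirdiff_normal_tangent unit_normal_tangent// mulr0 addr0.
Qed.

Lemma curvature_invariants (a b : R) :
  char_poly (weingarten f q) = ('X - a%:P) * ('X - b%:P) ->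
  (a + b) * (E * G - F ^+ 2) = G * L - 2 * F * M + E * N /\
  a * b * (E * G - F ^+ 2) = L * N - M ^+ 2.
Proof.
have [_ /lt0r_neq0 D0] := first_form_pos.
rewrite /weingarten /first_form /second_form.
rewrite !(dirdiff_deriveE _ (surface_smooth Uq)) !(dirdiff_deriveE _ (unit_normal_smooth Uq)).
exact: weingarten_invariants.
Qed.

End shape.
End Surface.

(** * Smooth principal curvatures and principal frames *)

Section Principal_curvatures.
Context {R : realType} (U : set 'rV[R]_2) (f : 'rV[R]_2 -> 'rV[R]_3)
  (kap mu : 'rV[R]_2 -> R).
Hypothesis U_open : open U.
Hypothesis f_smooth : smooth_on U f.
Hypothesis f_immersion : forall q, U q -> immersion_at f q.
Hypothesis kap_mu : forall q, U q ->
  char_poly (weingarten f q) = ('X - (kap q)%:P) * ('X - (mu q)%:P).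
Hypothesis kap_continuous : forall q, U q -> {for q, continuous kap}.
Hypothesis mu_continuous : forall q, U q -> {for q, continuous mu}.
Let nu := unit_normal f.
Let E q := dot (dirdiff f q (eu R)) (dirdiff f q (eu R)).
Let F q := dot (dirdiff f q (eu R)) (dirdiff f q (ev R)).
Let G q := dot (dirdiff f q (ev R)) (dirdiff f q (ev R)).
Let L q := - dot (dirdiff f q (eu R)) (dirdiff nu q (eu R)).
Let M q := - dot (dirdiff f q (eu R)) (dirdiff nu q (ev R)).
Let N q := - dot (dirdiff f q (ev R)) (dirdiff nu q (ev R)).
Let Delta q := E q * G q - F q ^+ 2.

Let invariants q : U q ->
  (kap q + mu q) * Delta q = G q * L q - 2 * F q * M q + E q * N q /\
  kap q * mu q * Delta q = L q * N q - M q ^+ 2.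
Proof.
by move=> Uq; exact: (curvature_invariants U_open f_smooth f_immersion Uq (kap_mu Uq)).
Qed.

Let E_Delta_pos q : U q -> 0 < E q /\ 0 < Delta q.
Proof. by move=> Uq; exact: (first_form_pos f_immersion Uq). Qed.

Let smooth_f q : U q -> smooth_at q f.
Proof. by exists U. Qed.

Let smooth_nu q : U q -> smooth_at q nu.
Proof. by move=> Uq; exact: (unit_normal_smooth U_open f_smooth f_immersion Uq). Qed.

Let smooth_df q v : U q -> smooth_at q (fun q => dirdiff f q v).
Proof. by move=> Uq; exact/smooth_at_dirdiff_cst/smooth_f. Qed.

Let smooth_dnu q v : U q -> smooth_at q (fun q => dirdiff nu q v).
Proof. by move=> Uq; exact/smooth_at_dirdiff_cst/smooth_nu. Qed.

Let smooth_forms q : U q ->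
  [/\ smooth_at q E, smooth_at q F & smooth_at q G] /\
  [/\ smooth_at q L, smooth_at q M & smooth_at q N].
Proof.
move=> Uq; split; split; try apply: smooth_atN; apply: smooth_at_dot;
  (exact: smooth_df || exact: smooth_dnu).
Qed.

Section non_umbilic.
Context (p : 'rV[R]_2) (Up : U p) (kap_neq_mu : kap p != mu p).

Let near_U : \forall q \near p, U q. Proof. exact: open_nbhs_nbhs. Qed.

(** Sum and product are rational in the fundamental forms, hence smooth. The difference is
    continuous and nonzero at [p], and its square is the discriminant, so it is smooth as well;
    half-sums recover both curvatures. *)
Lemma principal_curvatures_smooth : smooth_at p kap /\ smooth_at p mu.
Proof.
have [[sE sF sG] [sL sM sN]] := smooth_forms Up.
have [_ /lt0r_neq0 D0] := E_Delta_pos Up.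
have sD : smooth_at p Delta.
  by apply: smooth_atB; [exact: smooth_atM|exact: smooth_atX].
have sDV : smooth_at p (fun q => (Delta q)^-1) by exact: smooth_atV.
have s2 : smooth_at p (fun=> 2 : R) by exact: smooth_at_cst.
have s12 : smooth_at p (fun=> 2^-1 : R) by exact: smooth_at_cst.
have s4 : smooth_at p (fun=> 4 : R) by exact: smooth_at_cst.
have sS : smooth_at p (fun q => kap q + mu q).
  apply: (@smooth_at_ext _ _ _ _
      (fun q => (G q * L q - 2 * F q * M q + E q * N q) * (Delta q)^-1)).
    apply: filterS near_U => q Uq; have [<- _] := invariants Uq.
    by rewrite mulfK// gt_eqF// (E_Delta_pos Uq).2.
  apply: smooth_atM => //; apply: smooth_atD; last exact: smooth_atM.
  by apply: smooth_atB; apply: smooth_atM => //; exact: smooth_atM.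
have sP : smooth_at p (fun q => kap q * mu q).
  apply: (@smooth_at_ext _ _ _ _ (fun q => (L q * N q - M q ^+ 2) * (Delta q)^-1)).
    apply: filterS near_U => q Uq; have [_ <-] := invariants Uq.
    by rewrite mulfK// gt_eqF// (E_Delta_pos Uq).2.
  by apply: smooth_atM => //; apply: smooth_atB; [exact: smooth_atM|exact: smooth_atX].
have sd : smooth_at p (fun q => kap q - mu q).
  apply: smooth_at_square_root; first by rewrite subr_eq0.
    apply: filterS near_U => q Uq; exact: (cvgB (kap_continuous Uq) (mu_continuous Uq)).
  apply: (@smooth_at_ext _ _ _ _
      (fun q => (kap q + mu q) ^+ 2 - 4 * (kap q * mu q))).
    by apply: filterS near_U => q Uq; ring.
  by apply: smooth_atB; [exact: smooth_atX|exact: smooth_atM].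
split.
- apply: (@smooth_at_ext _ _ _ _ (fun q => 2^-1 * ((kap q + mu q) + (kap q - mu q)))).
    by apply: filterS near_U => q _; field.
  by apply: smooth_atM => //; exact: smooth_atD.
- apply: (@smooth_at_ext _ _ _ _ (fun q => 2^-1 * ((kap q + mu q) - (kap q - mu q)))).
    by apply: filterS near_U => q _; field.
  by apply: smooth_atM => //; exact: smooth_atB.
Qed.

(** With [b] and [c], the entries of [II - kap I]. [det_abc] evaluates the characteristic polynomial
    at its root [kap]; [trace_abc] shows that the matrix is nonzero where the curvatures differ. *)
Let a q := L q - kap q * E q.
Let b q := M q - kap q * F q.
Let c q := N q - kap q * G q.

Let det_abc q : U q -> a q * c q = b q ^+ 2.
Proof.
move=> Uq; have [S P] := invariants Uq; rewrite /a /b /c.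
move: S P; rewrite /Delta.
move: (kap q) (mu q) (E q) (F q) (G q) (L q) (M q) (N q) => k m e f' g l m' n S P.
apply/eqP; rewrite -subr_eq0; rewrite (_ : _ - _ =
  (l * n - m' ^+ 2) - k * (g * l - 2 * f' * m' + e * n) + k ^+ 2 * (e * g - f' ^+ 2)).
  by rewrite -P -S; apply/eqP; ring.
by ring.
Qed.

Let trace_abc q : U q ->
  G q * a q - 2 * F q * b q + E q * c q = (mu q - kap q) * Delta q.
Proof.
move=> Uq; have [S _] := invariants Uq; rewrite /a /b /c.
move: S; rewrite /Delta.
move: (kap q) (mu q) (E q) (F q) (G q) (L q) (M q) (N q) => k m e f' g l m' n S.
rewrite (_ : _ + _ = (g * l - 2 * f' * m' + e * n) - 2 * k * (e * g - f' ^+ 2)).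
  by rewrite -S; ring.
by ring.
Qed.

Let smooth_abc : [/\ smooth_at p a, smooth_at p b & smooth_at p c].
Proof.
have [sk _] := principal_curvatures_smooth.
have [[sE sF sG] [sL sM sN]] := smooth_forms Up.
by split; apply: smooth_atB => //; exact: smooth_atM.
Qed.

(* A nonzero column of the adjugate of II - kap I. *)
Lemma eigenvector_field : exists X : 'rV[R]_2 -> 'rV[R]_2,
  [/\ smooth_at p X, X p != 0 & forall q, U q ->
    a q * X q 0 0 + b q * X q 0 1 = 0 /\ b q * X q 0 0 + c q * X q 0 1 = 0].
Proof.
have [sa sb sc] := smooth_abc.
have [cp|cp] := eqVneq (c p) 0.
- exists (fun q => vec2 (- b q) (a q)); split.
  + by apply: smooth_at_vec2 => //; exact: smooth_atN.
  (* If this column vanished too, all three entries would be zero at [p], and [trace_abc] would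
     force an umbilic point. *)
  + apply: contra_neq kap_neq_mu => /rowP z.
    have ap : a p = 0 by have := z 1; rewrite !mxE.
    have bp : b p = 0 by have := z 0; rewrite !mxE /= => /eqP; rewrite oppr_eq0 => /eqP.
    have := trace_abc Up; rewrite ap bp cp !mulr0 subr0 addr0 => /esym/eqP.
    by rewrite mulf_eq0 [Delta p == 0]gt_eqF ?(E_Delta_pos Up).2// orbF subr_eq0 => /eqP.
  + move=> q Uq; rewrite !vec2E; split; first by ring.
    by rewrite [c q * _]mulrC (det_abc Uq); ring.
- exists (fun q => vec2 (c q) (- b q)); split.
  + by apply: smooth_at_vec2 => //; exact: smooth_atN.
  + by apply: contra_neq cp => /rowP/(_ 0); rewrite !mxE.
  + move=> q Uq; rewrite !vec2E; split; last by ring.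
    by rewrite (det_abc Uq); ring.
Qed.

Lemma principal_frame_near : kap p != 0 -> exists X Y,
  \forall q \near p, principal_frame f nu (fun q => (kap q)^-1) mu X Y q.
Proof.
move=> kp0; have [X [sX Xp XP]] := eigenvector_field.
have [sk sm] := principal_curvatures_smooth.
have [[sE sF sG] _] := smooth_forms Up.
have sX0 (j : 'I_2) := smooth_at_coord j sX.
(* A quarter turn of [I X]: orthogonal to [X] for the first fundamental form, with
   [det2 X Y = I (X, X) > 0], so the frame is direct without any choice. *)
pose Y q : 'rV[R]_2 := vec2 (- (F q * X q 0 0 + G q * X q 0 1)) (E q * X q 0 0 + F q * X q 0 1).
have sY : smooth_at p Y.
  by apply: smooth_at_vec2; [apply: smooth_atN|]; apply: smooth_atD; exact: smooth_atM.
have srho : smooth_at p (fun q => (kap q)^-1) by exact: smooth_atV.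
exists X, Y.
have nX : \forall q \near p, X q != 0.
  have nz : dot (X p) (X p) != 0 by rewrite dot_eq0.
  have := near_neq0 (smooth_at_continuous (smooth_at_dot sX sX)) nz.
  by apply: filterS => q; rewrite dot_eq0.
have nk : \forall q \near p, kap q != 0.
  by apply: near_neq0 => //; exact: smooth_at_continuous.
have ns := near_and (smooth_at_near srho) (near_and (smooth_at_near sm)
  (near_and (smooth_at_near sX) (smooth_at_near sY))).
have nn := near_and near_U (near_and nX (near_and nk ns)).
apply: filterS nn => q [Uq [Xq [kq [srq [smq [sXq sYq]]]]]].
have [e1 e2] := XP q Uq.
have [Ep Dp] := E_Delta_pos Uq.
have inj w := @surface_injective _ _ _ f_immersion q Uq w.
have fE w : dirdiff f q w = w 0 0 *: dirdiff f q (eu R) + w 0 1 *: dirdiff f q (ev R).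
  by rewrite {1}[w]row2E dirdiffD !dirdiffZ.
have dotff w v : dot (dirdiff f q w) (dirdiff f q v) =
    w 0 0 * (E q * v 0 0 + F q * v 0 1) + w 0 1 * (F q * v 0 0 + G q * v 0 1).
  rewrite (fE w) (fE v) !(dotDl, dotDr, dotZl, dotZr).
  rewrite [dot (dirdiff f q (ev R)) (dirdiff f q (eu R))]dotC -/(E q) -/(F q) -/(G q).
  by move: (E q) (F q) (G q) => *; ring.
have dXY : det2 (X q) (Y q) = dot (dirdiff f q (X q)) (dirdiff f q (X q)).
  by rewrite dotff det2E /Y !vec2E; move: (E q) (F q) (G q) => *; ring.
have fX : dirdiff f q (X q) != 0 by apply: contra_neq Xq; exact: inj.
have dir : 0 < det2 (X q) (Y q) by rewrite dXY dot_gt0.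
have nuX : dirdiff nu q (X q) = - kap q *: dirdiff f q (X q).
  apply: (shape_eigenvector U_open f_smooth f_immersion Uq);
    rewrite -/(E q) -/(F q) -/(G q) -/(L q) -/(M q) -/(N q).
    by move: e1; rewrite /a /b; move: (E q) (F q) (L q) (M q) (kap q) => *; lra.
  by move: e2; rewrite /b /c; move: (F q) (G q) (M q) (N q) (kap q) => *; lra.
have nuY : dirdiff nu q (Y q) = - mu q *: dirdiff f q (Y q).
  have [S _] := invariants Uq; move: S; rewrite /Delta => S.
  apply: (shape_eigenvector U_open f_smooth f_immersion Uq);
    rewrite -/(E q) -/(F q) -/(G q) -/(L q) -/(M q) -/(N q) /Y !vec2E;
    move: e1 e2 S; rewrite /a /b /c;
    move: (E q) (F q) (G q) (L q) (M q) (N q) (kap q) (mu q) (X q 0 0) (X q 0 1);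
    move=> e f' g l m n k k' x y e1 e2 S; apply/eqP; rewrite -subr_eq0.
    rewrite (_ : _ - _ = e * ((m - k * f') * x + (n - k * g) * y)
       - f' * ((l - k * e) * x + (m - k * f') * y)
       + y * ((k + k') * (e * g - f' ^+ 2) - (g * l - 2 * f' * m + e * n))).
      by rewrite e1 e2 S; apply/eqP; ring.
    by ring.
  rewrite (_ : _ - _ = f' * ((m - k * f') * x + (n - k * g) * y)
     - g * ((l - k * e) * x + (m - k * f') * y)
     - x * ((k + k') * (e * g - f' ^+ 2) - (g * l - 2 * f' * m + e * n))).
    by rewrite e1 e2 S; apply/eqP; ring.
  by ring.
split=> //.
- exact: smooth_f.
- exact: smooth_nu.
- by rewrite invr_eq0.
- by apply: (@unit_normal_unit _ U f).
- by move=> w; apply: (@unit_normal_tangent _ U f).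
- by rewrite nuX scalerA mulrN mulVf// scaleN1r.
- by rewrite dotff /Y !vec2E; move: (E q) (F q) (G q) => *; ring.
- apply/eqP => /inj Y0; move: dir.
  by rewrite Y0 det2E !mxE !mulr0 subrr ltxx.
Qed.

End non_umbilic.

(** For a double eigenvalue, both determinant and trace relative to [I] of the symmetric matrix
    [II - kap I] vanish, and positivity of [I] makes the matrix itself zero. *)
Lemma umbilic_point q w : U q -> kap q = mu q ->
  dirdiff nu q w = - kap q *: dirdiff f q w.
Proof.
move=> Uq km; have [S P] := invariants Uq; have [Ep Dp] := E_Delta_pos Uq.
have [a0 b0 c0] : [/\ L q = kap q * E q, M q = kap q * F q & N q = kap q * G q].
  move: S P Ep Dp; rewrite -km /Delta.
  move: (kap q) (E q) (F q) (G q) (L q) (M q) (N q) => k e f' g l m n S P Ep Dp.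
  have T0 : g * (l - k * e) - 2 * f' * (m - k * f') + e * (n - k * g) = 0.
    rewrite (_ : _ + _ = (g * l - 2 * f' * m + e * n) - (k + k) * (e * g - f' ^+ 2)).
      by rewrite S subrr.
    by ring.
  have D0 : (l - k * e) * (n - k * g) = (m - k * f') ^+ 2.
    apply/eqP; rewrite -subr_eq0 (_ : _ - _ = (l * n - m ^+ 2 - k * k * (e * g - f' ^+ 2))
      - k * (g * (l - k * e) - 2 * f' * (m - k * f') + e * (n - k * g))).
      by rewrite T0 -P; apply/eqP; ring.
    by ring.
  move: T0 D0; set x := l - k * e; set y := m - k * f'; set z := n - k * g => T0 D0.
  (* A sum of two nonnegative terms that is a combination of the trace and determinant relations;
     its second term gives [x = 0]. *)
  have Q : (e * y - f' * x) ^+ 2 + (e * g - f' ^+ 2) * x ^+ 2 = 0.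
    rewrite (_ : _ + _ = e * x * (g * x - 2 * f' * y + e * z) + e ^+ 2 * (y ^+ 2 - x * z)).
      by rewrite T0 D0; ring.
    by ring.
  have x0 : x = 0.
    apply/eqP; rewrite -sqrf_eq0; move/eqP: Q.
    rewrite paddr_eq0 ?sqr_ge0//; last by rewrite mulr_ge0 ?sqr_ge0// ltW.
    by move=> /andP[_]; rewrite mulf_eq0 gt_eqF.
  have y0 : y = 0 by apply/eqP; rewrite -sqrf_eq0 -D0 x0 mul0r.
  have z0 : z = 0.
    move/eqP: T0; rewrite x0 y0 !mulr0 subr0 add0r mulf_eq0 gt_eqF//=.
    by move/eqP.
  by split; apply/eqP; rewrite -subr_eq0; apply/eqP.
apply: (shape_eigenvector U_open f_smooth f_immersion Uq);
  rewrite -/(E q) -/(F q) -/(G q) -/(L q) -/(M q) -/(N q) ?a0 ?b0 ?c0; ring.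
Qed.

End Principal_curvatures.

(** * Parallel surfaces *)

Lemma crossp_frame {R : realType} (h : 'rV[R]_2 -> 'rV[R]_3) q (x y : 'rV[R]_2) :
  crossp (dirdiff h q x) (dirdiff h q y) =
  det2 x y *: crossp (dirdiff h q (eu R)) (dirdiff h q (ev R)).
Proof.
rewrite [in LHS](row2E x) [in LHS](row2E y) !dirdiffD !dirdiffZ crossp_combination.
by rewrite det2E.
Qed.

Section Parallel_surface.
Context {R : realType} (U : set 'rV[R]_2) (f : 'rV[R]_2 -> 'rV[R]_3)
  (kap mu : 'rV[R]_2 -> R) (p : 'rV[R]_2).
Hypothesis U_open : open U.
Hypothesis f_smooth : smooth_on U f.
Hypothesis f_immersion : forall q, U q -> immersion_at f q.
Hypothesis kap_mu : forall q, U q ->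
  char_poly (weingarten f q) = ('X - (kap q)%:P) * ('X - (mu q)%:P).
Hypothesis kap_continuous : forall q, U q -> {for q, continuous kap}.
Hypothesis mu_continuous : forall q, U q -> {for q, continuous mu}.
Hypothesis Up : U p.
Hypothesis kp0 : kap p != 0.
Let nu := unit_normal f.
Let t := (kap p)^-1.
Let g := parallel_surface f t.

Let smooth_f q : U q -> smooth_at q f.
Proof. by exists U. Qed.

Let smooth_nu q : U q -> smooth_at q nu.
Proof. by move=> Uq; exact: (unit_normal_smooth U_open f_smooth f_immersion Uq). Qed.

Let smooth_g q : U q -> smooth_at q g.
Proof.
move=> Uq; apply: smooth_atD; first exact: smooth_f.
by apply: smooth_atZ; [exact: smooth_at_cst|exact: smooth_nu].
Qed.

Let near_U : \forall q \near p, U q. Proof. exact: open_nbhs_nbhs. Qed.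

Lemma dirdiff_parallel q w : U q ->
  dirdiff g q w = dirdiff f q w + t *: dirdiff nu q w.
Proof.
move=> Uq; have sf := smooth_f Uq; have snu := smooth_nu Uq.
have st : smooth_at q (fun=> t : R) by exact: smooth_at_cst.
rewrite -[LHS]/(dirdiff (fun q => f q + t *: nu q) q w).
rewrite (dirdiff_add w sf (smooth_atZ st snu)); congr (_ + _).
by rewrite (dirdiff_scale w st snu) dirdiff_cst scale0r addr0.
Qed.

Lemma parallel_tangent q w : U q -> dot (dirdiff g q w) (nu q) = 0.
Proof.
move=> Uq; rewrite dirdiff_parallel// dotDl dotZl.
rewrite (unit_normal_tangent U_open f_smooth Uq).
by rewrite (dirdiff_normal_tangent U_open f_smooth f_immersion Uq) mulr0 addr0.
Qed.

Lemma parallel_frame X Y q : U q ->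
  principal_frame f nu (fun q => (kap q)^-1) mu X Y q ->
  dirdiff g q (X q) = (1 - t * kap q) *: dirdiff f q (X q) /\
  dirdiff g q (Y q) = (1 - t * mu q) *: dirdiff f q (Y q).
Proof.
move=> Uq fr; have kq : kap q != 0 by have := pf_rho fr; rewrite invr_eq0.
have nuX : dirdiff nu q (X q) = - kap q *: dirdiff f q (X q).
  by rewrite scaleNr -scalerN -(pf_X fr) scalerA divff// scale1r.
rewrite !dirdiff_parallel// nuX (pf_Y fr) !scalerA !mulrN !scaleNr.
by rewrite !scalerBl !scale1r.
Qed.

Section frame.
Context (X Y : 'rV[R]_2 -> 'rV[R]_2).
Hypothesis frames : \forall q \near p,
  principal_frame f nu (fun q => (kap q)^-1) mu X Y q.
Hypothesis kap_neq_mu : kap p != mu p.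

Let frp := nbhs_singleton frames.

Let nondeg : 1 - t * mu p != 0.
Proof.
apply: contra_neq kap_neq_mu => /eqP; rewrite subr_eq0 => /eqP/(congr1 ( *%R (kap p))).
by rewrite mulr1 /t mulrA divff// mul1r.
Qed.

Lemma parallel_rank1 a b :
  dirdiff g p (a *: X p + b *: Y p) = (b * (1 - t * mu p)) *: dirdiff f p (Y p).
Proof.
have [gX gY] := parallel_frame Up frp.
by rewrite dirdiffD !dirdiffZ gX gY /t mulVf// subrr scale0r scaler0 add0r scalerA.
Qed.

(** In adapted coordinates [h_y = 0] makes the second axis principal, along [X], so [phi_x] has a
    nonzero component [b1] along [Y]. When [dot h_xx nu = 0], the derivative of [dot h_x nu = 0]
    leaves [dot h_x (dnu (phi_x)) = 0], which is [- b1^2 (1 - t mu) mu |df Y|^2 = 0]. Only [mu] can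
    vanish. *)
Lemma limiting_normal_curvature0 : is_limiting_normal_curvature g nu p 0 -> mu p = 0.
Proof.
move=> [a [phi [dphi]]]; set h := g \o phi => hv.
have [phia sphi _] := dphi.
have sgp : smooth_at (phi a) g by rewrite phia; exact: smooth_g.
have snup : smooth_at (phi a) nu by rewrite phia; exact: smooth_nu.
have sh : smooth_at a h by exact: smooth_at_comp.
have nU : \forall x \near a, U (phi x).
  by apply: (smooth_at_continuous sphi); rewrite phia.
have dh : \forall x \near a, forall w,
    dirdiff h x w = dirdiff g (phi x) (dirdiff phi x w).
  apply: filterS2 (smooth_at_near sphi) nU => x sphix Ux w.
  exact: (dirdiff_comp w sphix (smooth_g Ux)).
have [a1 [b1 E1]] := frame_decomposition frp (dirdiff phi a (eu R)).
have [a2 [b2 E2]] := frame_decomposition frp (dirdiff phi a (ev R)).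
have b20 : b2 = 0.
  move: hv; rewrite dirdiff_deriveE// (nbhs_singleton dh) phia E2 parallel_rank1 => /eqP.
  by rewrite scaler_eq0 (negbTE (pf_fY frp)) orbF mulf_eq0 (negbTE nondeg) orbF => /eqP.
have b10 : b1 != 0.
  have := immersion_det2 (fun w => @diffeo_germ_immersion _ _ _ _ phi w dphi).
  apply: contraNneq => b10; rewrite E1 E2 b10 b20 det2E !mxE; apply/eqP; ring.
have hu : dirdiff h a (eu R) = (b1 * (1 - t * mu p)) *: dirdiff f p (Y p).
  by rewrite (nbhs_singleton dh) phia E1 parallel_rank1.
have sDh := smooth_at_dirdiff_cst (eu R) sh.
have -> : 'D_(eu R) ('D_(eu R) h) a = dirdiff (fun x => dirdiff h x (eu R)) a (eu R).
  rewrite dirdiff_deriveE; last exact: smooth_at_derive.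
  apply: dirdiff_ext; first exact: smooth_at_derive.
  by apply: filterS (smooth_at_near sh) => x sx; rewrite dirdiff_deriveE.
rewrite dirdiff_deriveE// => /esym/eqP.
rewrite mulf_eq0 invr_eq0 sqrf_eq0 [enorm _ == 0]gt_eqF ?orbF; last first.
  by rewrite enorm_gt0// hu scaler_eq0 negb_or mulf_neq0//= (pf_fY frp).
move=> /eqP c0.
have tang : \forall x \near a, dot (dirdiff h x (eu R)) (nu (phi x)) = 0.
  by apply: filterS2 dh nU => x -> Ux; exact: parallel_tangent.
have snuphi : smooth_at a (fun x => nu (phi x)) by exact: smooth_at_comp.
have := dirdiff_ext (eu R) (smooth_at_dot sDh snuphi) tang.
rewrite dirdiff_cst dirdiff_dot// phia c0 addr0 hu (dirdiff_comp _ sphi snup) phia E1.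
have nuX : dirdiff nu p (X p) = - kap p *: dirdiff f p (X p).
  by rewrite scaleNr -scalerN -(pf_X frp) scalerA divff// scale1r.
rewrite dirdiffD !dirdiffZ nuX (pf_Y frp) dotZl dotDr !dotZr.
rewrite [dot _ (dirdiff f p (X p))]dotC (pf_orthogonal frp) !mulr0 add0r => /eqP.
rewrite !mulf_eq0 oppr_eq0 dot_eq0 (negbTE b10) (negbTE nondeg) (negbTE (pf_fY frp)).
by rewrite /= ?orbF => /eqP.
Qed.

Lemma parallel_area : \forall q \near p,
  crossp (dirdiff g q (eu R)) (dirdiff g q (ev R)) =
  (1 - t * kap q) *: ((1 - t * mu q) *:
    crossp (dirdiff f q (eu R)) (dirdiff f q (ev R))).
Proof.
apply: filterS2 near_U frames => q Uq fr.
have d0 : det2 (X q) (Y q) != 0 by rewrite gt_eqF// (pf_direct fr).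
have [gX gY] := parallel_frame Uq fr.
apply: (scalerI d0); rewrite -crossp_frame gX gY.
rewrite -[_ *: dirdiff f q (X q)]addr0 -[X in _ + X](scale0r (dirdiff f q (Y q))).
rewrite -[_ *: dirdiff f q (Y q) in X in crossp _ X]add0r.
rewrite -[X in crossp _ (X + _)](scale0r (dirdiff f q (X q))) crossp_combination.
rewrite crossp_frame !scalerA mul0r subr0; congr (_ *: _).
by move: (kap q) (mu q) (det2 _ _) => *; ring.
Qed.

End frame.

Lemma focal_singular_curvature_sign (s : R) : s != 0 ->
  A_equivalent g p (std_germ s) 0 -> is_limiting_normal_curvature g nu p 0 ->
  (exists c, is_singular_curvature (focal_surface f kap) p c) /\
  forall c, is_singular_curvature (focal_surface f kap) p c -> Num.sg c = Num.sg s.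
Proof.
move=> s0 eqv lim0.
have [phi [B [[sphi phip] [sB B0] inj area ker]]] := normal_form_area (smooth_g Up) eqv.
(* At an umbilic point [dnu = - kap df], so [dg] would vanish at [p]; by [ker] the first coordinate
   of [dphi] would vanish on all vectors, against injectivity. *)
have kap_neq_mu : kap p != mu p.
  apply: contraNneq (immersion_det2 inj) => km.
  have dg0 w : dirdiff phi p w 0 0 = 0.
    apply/ker; rewrite dirdiff_parallel//.
    rewrite (umbilic_point U_open f_smooth f_immersion kap_mu _ Up km).
    by rewrite scalerA mulrN mulVf// scaleN1r subrr.
  by rewrite det2E !dg0 mul0r mulr0 subrr.
have [X [Y frames]] := principal_frame_near U_open f_smooth f_immersion kap_mu
  kap_continuous mu_continuous Up kap_neq_mu kp0.
have frp := nbhs_singleton frames.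
have mup := limiting_normal_curvature0 frames kap_neq_mu lim0.
have [sk sm] := principal_curvatures_smooth U_open f_smooth f_immersion kap_mu
  kap_continuous mu_continuous Up kap_neq_mu.
have scst (c : R) : smooth_at p (fun _ : 'rV[R]_2 => c) by exact: smooth_at_cst.
pose sig q : R := 1 - t * kap q.
have ssig : smooth_at p sig by apply: smooth_atB => //; exact: smooth_atM.
pose A q := (1 - t * mu q) *: crossp (dirdiff f q (eu R)) (dirdiff f q (ev R)).
have sA : smooth_at p A.
  apply: smooth_atZ; first by apply: smooth_atB => //; exact: smooth_atM.
  by apply: smooth_at_crossp; apply: smooth_at_dirdiff_cst; exact: smooth_f.
have A0 : A p != 0.
  by rewrite /A mup mulr0 subr0 scale1r (area_neq0 f_immersion Up).
have sig0 : sig p = 0 by rewrite /sig /t mulVf// subrr.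
have [|dsig [c c0 hsig]] := area_factor_hess (s := s) ssig sA sB sphi phip sig0 A0 B0 inj.
  by apply: filterS2 area (parallel_area frames) => q <- ->.
pose rho q := (kap q)^-1.
have srho : smooth_at p rho := pf_smooth_rho frp.
(* This identity transfers the 2-jet of [sig] to [rho]: [sig] has zero 1-jet at [p], so the left
   side has Hessian [rho p = t] times that of [sig]. *)
have rho_sig : \forall q \near p, sig q * rho q = rho q + - t.
  apply: filterS frames => q fr; have := pf_rho fr; rewrite invr_eq0 => kq.
  by rewrite /sig /rho mulrBl mul1r -mulrA divff// mulr1.
have drho w : dirdiff rho p w = 0.
  have := dirdiff_ext w (smooth_atM ssig srho) rho_sig.
  by rewrite dirdiff_mul_flat// dsig mulr0 dirdiff_add// dirdiff_cst addr0.
have hrho w v : hess rho p w v = t * hess sig p w v.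
  have := hess_ext w v (smooth_atM ssig srho) rho_sig.
  by rewrite hess_mul_flat// (hess_add w v srho (scst (- t))) hess_cst addr0.
(* [X p] spans the kernel of [dg] at [p], which in the normal form is the [v]-axis; [Y p] lies
   outside it. The Hessian of [rho] is thereby known well enough in the frame. *)
have phiX : dirdiff phi p (X p) 0 0 = 0.
  apply/ker; have := parallel_rank1 frames 1 0.
  by rewrite scale1r scale0r addr0 mul0r scale0r.
have phiX1 : dirdiff phi p (X p) 0 1 != 0.
  apply/eqP => phiX1; have X0 : X p = 0 by apply: inj; apply: row2P; rewrite mxE.
  by have := pf_fX frp; rewrite X0 dirdiff0r eqxx.
have phiY : dirdiff phi p (Y p) 0 0 != 0.
  apply/eqP => /ker; have := parallel_rank1 frames 0 1.
  rewrite scale1r scale0r add0r mul1r mup mulr0 subr0 scale1r => ->.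
  by apply/eqP; exact: pf_fY frp.
have t0 : t != 0 by rewrite invr_eq0.
have QXX0 : hess rho p (X p) (X p) != 0.
  rewrite hrho hsig phiX !mulr0 addr0; apply: mulf_neq0 => //; apply: mulf_neq0 => //.
  by apply: mulf_neq0; [rewrite pnatr_eq0|exact: mulf_neq0].
(* [24 = 12 * 2] comes from the form [12 v^2 + 2 s u^2]. The unknown signs of [t] and [c] are
   squared away, and the [v]-component of [dphi (Y)] cancels. *)
have detQ : hess rho p (X p) (X p) * hess rho p (Y p) (Y p) - hess rho p (X p) (Y p) ^+ 2 =
    24 * (t * c * dirdiff phi p (X p) 0 1 * dirdiff phi p (Y p) 0 0) ^+ 2 * s.
  rewrite !hrho !hsig phiX.
  by move: (dirdiff phi p (X p) 0 1) (dirdiff phi p (Y p)) => *; ring.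
have CE : focal_surface f kap = fun q => f q + rho q *: nu q by [].
split; first exact: (singular_curvature_exists CE frames mup drho QXX0).
move=> d /(sg_singular_curvature CE frames mup drho QXX0) ->.
rewrite detQ sgrM gtr0_sg ?mul1r// mulr_gt0//.
by rewrite exprn_even_gt0//= !mulf_neq0.
Qed.

End Parallel_surface.

Unset Implicit Arguments.

Theorem theorem1p2 (R : realType) (U : set 'rV[R]_2) (f : 'rV[R]_2 -> 'rV[R]_3)
    (k : 'I_2 -> 'rV[R]_2 -> R) (p : 'rV[R]_2) (i : 'I_2)
    (U_open : open U) (f_smooth : smooth_on U f)
    (f_immersion : forall q, U q -> immersion_at f q)
    (k_principal : principal_curvatures U f k)
    (Up : U p) (kp_neq0 : k i p != 0)
    (kappa_nu0 : is_limiting_normal_curvature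
       (parallel_surface f (k i p)^-1) (unit_normal f) p 0) :
  (cuspidal_lips (parallel_surface f (k i p)^-1) p ->
     (exists c : R, is_singular_curvature (focal_surface f (k i)) p c) /\
     (forall c : R, is_singular_curvature (focal_surface f (k i)) p c -> 0 < c)) /\
  (cuspidal_beaks (parallel_surface f (k i p)^-1) p ->
     (exists c : R, is_singular_curvature (focal_surface f (k i)) p c) /\
     (forall c : R, is_singular_curvature (focal_surface f (k i)) p c -> c < 0)).
Proof.
have [char_k k_continuous] := k_principal.
(* Subtraction in ['I_2] is modulo 2, so [j] is the other index. *)
pose j : 'I_2 := 1 - i.
have char_ij q : U q ->
    char_poly (weingarten f q) = ('X - (k i q)%:P) * ('X - (k j q)%:P).
  move=> Uq; rewrite char_k// !big_ord_recl big_ord0 mulr1.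
  have [iE|iE] : i = ord0 \/ i = lift ord0 ord0.
    by case: (i) => -[|[|//]] lt; [left|right]; apply/val_inj.
    by rewrite iE (_ : j = lift ord0 ord0)// /j iE; apply/val_inj.
  by rewrite iE (_ : j = ord0) 1?mulrC// /j iE; apply/val_inj.
have sign s (s0 : s != 0) A :=
  focal_singular_curvature_sign U_open f_smooth f_immersion char_ij
    (k_continuous i) (k_continuous j) Up kp_neq0 s0 A kappa_nu0.
split.
- rewrite /cuspidal_lips -std_germ_lips => A.
  have [ex sg] := sign 1 (oner_neq0 R) A; split=> // c /sg.
  by rewrite sgr1 => /eqP; rewrite sgr_cp0.
- rewrite /cuspidal_beaks -std_germ_beaks => A.
  have n1 : (-1 : R) != 0 by rewrite oppr_eq0 oner_neq0.
  have [ex sg] := sign (-1) n1 A; split=> // c /sg.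
  by rewrite sgrN1 => /eqP; rewrite sgr_cp0.
Qed.
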